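(* Let $\lambda>0$ and let $B^{\lambda,br}$ be a Brownian bridge of length $1$ from $0$ to $\lambda$. Then its Vervaat transform $(V(B^{\lambda,br})_t;\ 0 \leq t \leq 1)$ is not a Markov process with respect to its induced (natural) filtration.
   Context: Vervaat transform: for continuous $f:[0,1]\to\mathbb{R}$ with $f(0)=0$, let $\tau(f)$ be the first time at which $f$ attains its minimum on $[0,1]$. Define $V(f)(t)=f(\tau(f)+t)-f(\tau(f))$ for $0\le t\le 1-\tau(f)$ and $V(f)(t)=f(\tau(f)+t-1)+f(1)-f(\tau(f))$ for $1-\tau(f)\le t\le 1$. Markov is meant in the possibly time-inhomogeneous sense. *)

(* Defs.v *)
From HB Require Import structures.
From mathcomp Require Import all_boot all_order all_algebra.
From mathcomp Require Import all_classical all_reals all_analysis.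
Set Implicit Arguments.
Unset Strict Implicit.
Unset Printing Implicit Defensive.
Import Order.TTheory GRing.Theory Num.Theory numFieldNormedType.Exports.
Local Open Scope classical_set_scope.
Local Open Scope ring_scope.

(* For f continuous on [0, 1] the set of minimizers is nonempty and compact,
   so its infimum is the first time at which f attains its minimum. *)
Definition first_argmin (R : realType) (f : R -> R) : R :=
  inf [set t | t \in `[0, 1] /\ forall s, s \in `[0, 1] -> f t <= f s].

(* When f 0 = 0 both branches agree at t = 1 - first_argmin f; only the values
   for t in [0, 1] are meaningful. *)
Definition vervaat (R : realType) (f : R -> R) (t : R) : R :=
  let tau := first_argmin f in
  if t <= 1 - tau then f (tau + t) - f tau
  else f (tau + t - 1) + f 1 - f tau.

(* The library's normal_prob takes a standard deviation and, when it is 0,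
   denotes the uniform law on [0, 1]; the degenerate normal law is a Dirac
   mass. *)
Definition normal_law (R : realType) (m v : R) : set R -> \bar R :=
  if v == 0 then \d_m : set R -> \bar R
  else normal_prob m (Num.sqrt v).

Definition gaussian_process d (T : measurableType d) (R : realType)
    (P : probability T R) (I : set R) (m : R -> R) (K : R -> R -> R)
    (X : R -> T -> R) : Prop :=
  (forall t, I t -> measurable_fun setT (X t)) /\
  (forall (n : nat) (a u : 'I_n -> R), (forall i, I (u i)) ->
     forall A : set R, measurable A ->
       pushforward P (fun w => \sum_(i < n) a i * X (u i) w) A =
       normal_law (\sum_(i < n) a i * m (u i))
                  (\sum_(i < n) \sum_(j < n) a i * a j * K (u i) (u j)) A).

(* Bridge of length 1 from 0 to lam; X t is only relevant for t in [0, 1].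
   That X 1 = lam almost surely follows from the mean and covariance. *)
Definition brownian_bridge d (T : measurableType d) (R : realType)
    (P : probability T R) (lam : R) (X : R -> T -> R) : Prop :=
  [/\ forall w, X 0 w = 0,
      forall w, {within `[0, 1], continuous (fun t => X t w)}
    & gaussian_process P `[0, 1] (fun t => lam * t)
        (fun s t => Num.min s t - s * t) X].

Definition sigma_rv (T : Type) (R : realType) (Y : T -> R) : set_system T :=
  preimage_set_system setT Y measurable.

Definition natural_filtration (T : Type) (R : realType) (I : set R)
    (Y : R -> T -> R) (s : R) : set_system T :=
  <<s \bigcup_(u in [set u | I u /\ u <= s]) sigma_rv (Y u) >>.

(* f is a version of the conditional expectation of Z given the sub-sigma-
   algebra G. *)
Definition is_cond_exp d (T : measurableType d) (R : realType)
    (P : probability T R) (G : set_system T) (Z f : T -> R) : Prop :=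
  [/\ forall B : set R, measurable B -> G (f @^-1` B),
      P.-integrable setT (EFin \o f)
    & forall A, G A ->
        (\int[P]_(w in A) (f w)%:E = \int[P]_(w in A) (Z w)%:E)%E].

(* P(Y_t \in B | F_s) = P(Y_t \in B | Y_s) almost surely for all s <= t in I and
   all Borel B, where (F_s) is the natural filtration of Y. As versions of a
   conditional expectation are almost surely unique, asking for one pair of
   almost surely equal versions is the same as asking it of all pairs. *)
Definition markov_process d (T : measurableType d) (R : realType)
    (P : probability T R) (I : set R) (Y : R -> T -> R) : Prop :=
  forall (s t : R) (B : set R), I s -> I t -> s <= t -> measurable B ->
  exists f g : T -> R,
    [/\ is_cond_exp P (natural_filtration I Y s) \1_(Y t @^-1` B) f,
        is_cond_exp P (sigma_rv (Y s)) \1_(Y t @^-1` B) g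
      & {ae P, forall w, f w = g w}].

(* Main.v *)
(* Let f be the bridge, tau the time of its minimum and V its Vervaat transform. If
   V were Markov, there would be a function w with P(V(5/8) < lam | F_(1/2)) =
   w(V(1/2)). The law of f is invariant under the point reflection of any block
   of [0, 1] and under the cyclic shift of its increments by 1/2.

   For 1/8 <= a <= 1/4, reflecting the block [tau + a, tau + a + 1/4] exchanges a
   "high" event for V on [a, a + 1/4] with a "low" one and keeps V(1/2) and V(5/8);
   averaging over a makes the location of the block independent of f. Since
   V(5/8) < lam forces tau < 3/8, this shows that w(V(1/2)) has the same integral
   over the high and the low event. On the other hand a low block can always be
   reflected upwards, whereas reflecting a high block downwards may move the
   minimum of the shifted path when tau > 1/2. Comparing the two, w(V(1/2)) must
   vanish almost surely on a certain set of paths with high blocks.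

   The law of f is quasi-invariant under piecewise linear shifts vanishing at 0 and
   1, so every tube around a continuous path from 0 to lam has positive mass. One
   such tube lies in that set, and reflecting [7/8, 1] turns its paths into paths
   with V(5/8) < lam and the same V(1/2), on which w(V(1/2)) cannot vanish. *)

Require Import Defs.
From HB Require Import structures.
From mathcomp Require Import all_boot all_order all_algebra.
From mathcomp Require Import all_classical all_reals all_analysis.
From mathcomp Require Import measurable_realfun ring lra.
Set Implicit Arguments.
Unset Strict Implicit.
Unset Printing Implicit Defensive.
Import Order.TTheory GRing.Theory Num.Theory numFieldNormedType.Exports.
Local Open Scope classical_set_scope.
Local Open Scope ring_scope.

(** * The Cramer-Wold device *)

(** [V] does not show where the path was cut. The trace of the cut that matters: from time [1 - tau]
    on, [V] follows the part of the path before its minimum, raised by [lam], and so stays at or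
    above [lam]. The centre of a low block is below [lam] and therefore comes before the cut; a high
    block gives no such information. As [V(5/8) < lam] also depends on the cut, this is a memory
    that [V(1/2)] cannot carry. No conditional law is computed; everything is a comparison of masses
    under measure-preserving maps. Two obstacles shape this. Reflections preserve the law only for
    blocks at a deterministic place, while the block of interest starts at the random time
    [tau + a], whence the average over [a]. And for [tau > 1/2] that block may run past the end of
    the path, whence the rotation by 1/2, which makes it an ordinary block again. The thresholds
    differ on purpose: a reflected low block lies at least [2 lam] above the minimum and so respects
    the bound [lam] imposed after the cut, while a reflected high block dips below [lam] and may
    violate it. All blocks lie in the times [1/8, 1/2] of [V], so they belong to the past of 1/2. *)

Section SameMean.
Context d1 (T1 : measurableType d1) d2 (T2 : measurableType d2) (R : realType).
Variables (P1 : probability T1 R) (P2 : probability T2 R).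

Definition same_mean (F1 : T1 -> R) (F2 : T2 -> R) : Prop :=
  [/\ measurable_fun setT F1, measurable_fun setT F2,
      (exists M : R, (forall x, `|F1 x| <= M) /\ (forall x, `|F2 x| <= M))
    & (\int[P1]_x (F1 x)%:E = \int[P2]_x (F2 x)%:E)%E].

Lemma bounded_integrable d (T : measurableType d) (P : probability T R)
    (F : T -> R) M :
  measurable_fun setT F -> (forall x, `|F x| <= M) ->
  P.-integrable setT (EFin \o F).
Proof.
move=> mF bF; apply: measurable_bounded_integrable => //.
  by rewrite (le_lt_trans (probability_le1 P measurableT)) ?ltry.
exists M; split; first exact: num_real.
by move=> N MN x _; apply: (le_trans (bF x)); exact: ltW.
Qed.

Lemma same_mean_lin a b F1 F2 G1 G2 : same_mean F1 F2 -> same_mean G1 G2 ->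
  same_mean (fun x => a * F1 x + b * G1 x) (fun x => a * F2 x + b * G2 x).
Proof.
move=> [mF1 mF2 [M [F1M F2M]] eF] [mG1 mG2 [N [G1N G2N]] eG].
have E d (T : measurableType d) (P : probability T R) (F G : T -> R) :
    measurable_fun setT F -> measurable_fun setT G ->
    (forall x, `|F x| <= M) -> (forall x, `|G x| <= N) ->
    (\int[P]_x (a * F x + b * G x)%:E =
     a%:E * (\int[P]_x (F x)%:E) + b%:E * (\int[P]_x (G x)%:E))%E.
  move=> mF mG FM GN.
  have iF := bounded_integrable P mF FM.
  have iG := bounded_integrable P mG GN.
  under eq_integral do rewrite EFinD !EFinM.
  by rewrite integralD//; [rewrite !integralZl|exact: integrableZl..].
split.
- by apply: measurable_funD; apply: measurable_funM => //; exact: measurable_cst.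
- by apply: measurable_funD; apply: measurable_funM => //; exact: measurable_cst.
- exists (`|a| * M + `|b| * N); split => x; rewrite (le_trans (ler_normD _ _))//;
    by rewrite !normrM lerD// ler_wpM2l.
- by rewrite !E// eF eG.
Qed.

Lemma same_mean_lim (M : R) (F1 : nat -> T1 -> R) (F2 : nat -> T2 -> R)
    (G1 : T1 -> R) (G2 : T2 -> R) :
  (forall n, same_mean (F1 n) (F2 n)) ->
  (forall n x, `|F1 n x| <= M) -> (forall n x, `|F2 n x| <= M) ->
  (forall x, F1 ^~ x @ \oo --> G1 x) -> (forall x, F2 ^~ x @ \oo --> G2 x) ->
  same_mean G1 G2.
Proof.
move=> HF b1 b2 c1 c2.
have E d (T : measurableType d) (P : probability T R) (F : nat -> T -> R) (G : T -> R) :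
    (forall n, measurable_fun setT (F n)) -> (forall n x, `|F n x| <= M) ->
    (forall x, F ^~ x @ \oo --> G x) ->
    [/\ measurable_fun setT G, (forall x, `|G x| <= M)
      & (\int[P]_x (F n x)%:E @[n --> \oo] --> \int[P]_x (G x)%:E)%E].
  move=> mF FM FG.
  have mG : measurable_fun setT G.
    by apply: (measurable_fun_cvg mF) => x _; exact: FG.
  have GM x : `|G x| <= M.
    have h : `|F n x| @[n --> \oo] --> `|G x| by apply: cvg_norm; exact: FG.
    rewrite -(cvg_lim _ h)//; apply: limr_le; last exact: nearW.
    by apply/cvg_ex; exists `|G x|.
  split=> //.
  have := @dominated_cvg _ T R P setT measurableT (fun n => EFin \o F n)
    (EFin \o G) (cst M%:E) _ _ _.
  apply.
  - by move=> n; apply/measurable_EFinP.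
  - by move=> x _; apply: cvg_EFin; [exact: nearW|exact: FG].
  - by [].
  - exact: finite_measure_integrable_cst.
  - by move=> n x _; rewrite lee_fin.
have [mG1 G1M cG1] := E _ _ P1 F1 G1 (fun n => let: And4 h _ _ _ := HF n in h) b1 c1.
have [mG2 G2M cG2] := E _ _ P2 F2 G2 (fun n => let: And4 _ h _ _ := HF n in h) b2 c2.
split=> //; first by exists M.
apply: (cvg_unique _ cG1 _) => //.
suff -> : (fun n => \int[P1]_x (F1 n x)%:E)%E = (fun n => \int[P2]_x (F2 n x)%:E)%E by [].
by apply/funext => n; case: (HF n).
Qed.

Variables (X1 : R -> T1 -> R) (X2 : R -> T2 -> R).

Definition lin_comb (T : Type) (X : R -> T -> R) (l : seq (R * R)) (w : T) : R :=
  \sum_(p <- l) p.1 * X p.2 w.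

(** The test functions [h1], [h2] grow from the constant 1 to indicators of boxes. The free factor
    [cos (L + c)] makes the induction possible: multiplying by a cosine of one more coordinate only
    changes [L] and [c], because a product of cosines is a sum of cosines. *)
Definition trig_test (h1 : T1 -> R) (h2 : T2 -> R) : Prop :=
  forall l c, same_mean (fun w => cos (lin_comb X1 l w + c) * h1 w)
                        (fun w => cos (lin_comb X2 l w + c) * h2 w).

Lemma same_mean_ext F1 F2 G1 G2 : F1 =1 G1 -> F2 =1 G2 ->
  same_mean F1 F2 -> same_mean G1 G2.
Proof. by move=> /funext-> /funext->. Qed.

Lemma trig_test_ext F1 F2 G1 G2 : F1 =1 G1 -> F2 =1 G2 ->
  trig_test F1 F2 -> trig_test G1 G2.
Proof. by move=> /funext-> /funext->. Qed.

Lemma trig_test_lin a b F1 F2 G1 G2 : trig_test F1 F2 -> trig_test G1 G2 ->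
  trig_test (fun x => a * F1 x + b * G1 x) (fun x => a * F2 x + b * G2 x).
Proof.
move=> tF tG l c.
by apply: same_mean_ext (same_mean_lin a b (tF l c) (tG l c)) => x /=; ring.
Qed.

Lemma trig_test_lim (M : R) (F1 : nat -> T1 -> R) (F2 : nat -> T2 -> R)
    (G1 : T1 -> R) (G2 : T2 -> R) :
  (forall n, trig_test (F1 n) (F2 n)) ->
  (forall n x, `|F1 n x| <= M) -> (forall n x, `|F2 n x| <= M) ->
  (forall x, F1 ^~ x @ \oo --> G1 x) -> (forall x, F2 ^~ x @ \oo --> G2 x) ->
  trig_test G1 G2.
Proof.
move=> tF b1 b2 c1 c2 l c.
have B (y z : R) : `|z| <= M -> `|cos y * z| <= M.
  by move=> zM; rewrite normrM (le_trans _ zM)// ler_piMl// ler_norml cos_geN1 cos_le1.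
apply: (same_mean_lim (M := M) (fun n => tF n l c)).
- by move=> n x; apply: B.
- by move=> n x; apply: B.
- by move=> x; apply: cvgMr; exact: c1.
- by move=> x; apply: cvgMr; exact: c2.
Qed.

Definition half_cos (b c x : R) : R := (1 + cos (b * x + c)) / 2.

Lemma half_cos_ge0 b c x : 0 <= half_cos b c x.
Proof. by rewrite /half_cos; have := cos_geN1 (b * x + c); lra. Qed.

Lemma half_cos_le1 b c x : half_cos b c x <= 1.
Proof. by rewrite /half_cos; have := cos_le1 (b * x + c); lra. Qed.

Lemma trig_test_half_cos b c u h1 h2 : trig_test h1 h2 ->
  trig_test (fun w => half_cos b c (X1 u w) * h1 w)
            (fun w => half_cos b c (X2 u w) * h2 w).
Proof.
move=> th l e.
have A := same_mean_lin (2^-1) (2^-1) (th l e)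
  (same_mean_lin (2^-1) (2^-1) (th ((b, u) :: l) (e + c)) (th ((- b, u) :: l) (e - c))).
have E (L x h : R) :
    2^-1 * (cos (L + e) * h) +
    2^-1 * (2^-1 * (cos (b * x + L + (e + c)) * h) +
            2^-1 * (cos (- b * x + L + (e - c)) * h)) =
    cos (L + e) * (half_cos b c x * h).
  rewrite (_ : b * x + L + (e + c) = (L + e) + (b * x + c)); last by ring.
  rewrite (_ : - b * x + L + (e - c) = (L + e) - (b * x + c)); last by ring.
  by rewrite (cosD (L + e)) (cosB (L + e)) /half_cos; field.
by apply: same_mean_ext A => w /=;
  rewrite /lin_comb !big_cons /= -/(lin_comb _ _ _) E.
Qed.

(* Products with polynomials in [y := half_cos b c] preserve [trig_test], and
   (1 - y ^ n) ^ (n 2 ^ n) tends to the indicator of [y < 1 / 2]. *)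
Lemma trig_test_step (u c b : R) h1 h2 :
  (exists M : R, (forall w, `|h1 w| <= M) /\ (forall w, `|h2 w| <= M)) ->
  trig_test h1 h2 ->
  trig_test (fun w => (half_cos b c (X1 u w) < 2^-1)%R%:R * h1 w)
            (fun w => (half_cos b c (X2 u w) < 2^-1)%R%:R * h2 w).
Proof.
move=> [M [h1M h2M]] th.
pose y := half_cos b c.
have tn n g1 g2 : trig_test g1 g2 ->
  trig_test (fun w => y (X1 u w) ^+ n * g1 w) (fun w => y (X2 u w) ^+ n * g2 w).
  move=> tg; elim: n => [|n IH].
    by apply: trig_test_ext tg => w; rewrite expr0 mul1r.
  by apply: trig_test_ext (trig_test_half_cos b c u IH) => w; rewrite exprS mulrA.
have tp n k : trig_test (fun w => (1 - y (X1 u w) ^+ n) ^+ k * h1 w)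
                        (fun w => (1 - y (X2 u w) ^+ n) ^+ k * h2 w).
  elim: k => [|k IH].
    by apply: trig_test_ext th => w; rewrite expr0 mul1r.
  by apply: trig_test_ext (trig_test_lin 1 (-1) IH (tn n _ _ IH)) => w;
    rewrite exprS; ring.
have y01 x : 0 <= y x <= 1 by rewrite half_cos_ge0 half_cos_le1.
have p01 n k x : 0 <= (1 - y x ^+ n) ^+ k <= 1.
  have /andP[y0 y1] := y01 x.
  have q1 : y x ^+ n <= 1 by rewrite exprn_ile1.
  have q0 : 0 <= y x ^+ n by rewrite exprn_ge0.
  by rewrite exprn_ge0 ?subr_ge0//= exprn_ile1 ?subr_ge0// gerBl.
have bern (a : R) k : 0 <= a -> 1 + k%:R * a <= (1 + a) ^+ k.
  move=> a0; elim: k => [|k IH]; first by rewrite expr0 mul0r addr0.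
  rewrite exprS; apply: (@le_trans _ _ ((1 + a) * (1 + k%:R * a))).
    rewrite -natr1; have : 0 <= k%:R * a * a by rewrite !mulr_ge0.
    by set z := k%:R; nra.
  by rewrite ler_wpM2l// addr_ge0.
have bernB (a : R) k : 0 <= a <= 1 -> 1 - k%:R * a <= (1 - a) ^+ k.
  move=> /andP[a0 a1]; elim: k => [|k IH]; first by rewrite expr0 mul0r subr0.
  rewrite exprS; apply: (@le_trans _ _ ((1 - a) * (1 - k%:R * a))).
    rewrite -natr1; have : 0 <= k%:R * a * a by rewrite !mulr_ge0.
    by set z := k%:R; nra.
  by rewrite ler_wpM2l// subr_ge0.
have lim x : (1 - y x ^+ n) ^+ (n * 2 ^ n) @[n --> \oo] --> ((y x < 2^-1)%R%:R : R).
  have /andP[y0 y1] := y01 x.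
  have [yl|yg] := ltP (y x) 2^-1.
  (* Here [n 2 ^ n y ^ n = n w ^ (2 n)], and [nw] bounds [n w ^ n] by [(1 - w)^-1]; by Bernoulli's
     inequality the distance to 1 is at most [w ^ n / (1 - w)]. *)
  - pose w := Num.sqrt (2 * y x).
    have w0 : 0 <= w by exact: sqrtr_ge0.
    have w2 : w ^+ 2 = 2 * y x by rewrite sqr_sqrtr// mulr_ge0.
    have w1 : w < 1 by rewrite -(ltr_pXn2r (ltn0Sn 1)) ?nnegrE// expr1n w2; lra.
    have nw n : n%:R * (1 - w) * w ^+ n <= 1 - w ^+ n.
      elim: n => [|n IH]; first by rewrite !mul0r subrr.
      have : w ^+ n <= 1 by rewrite exprn_ile1// ltW.
      have : 0 <= w ^+ n by rewrite exprn_ge0.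
      rewrite exprS -natr1; move: IH; set k := n%:R; set v := w ^+ n => IH v0 v1.
      have : 0 <= w * (1 - v - k * (1 - w) * v) by rewrite mulr_ge0// subr_ge0.
      have : 0 <= (1 - w) * (1 - w * v).
        by rewrite mulr_ge0// subr_ge0 ?(ltW w1)// mulr_ile1// ltW.
      nra.
    have lw : 1 - (1 - w)^-1 * w ^+ n @[n --> \oo] --> (1 - (1 - w)^-1 * 0 : R).
      apply: cvgB; first exact: cvg_cst.
      by apply: cvgMr; apply: cvg_expr; rewrite ger0_norm.
    rewrite mulr0 subr0 in lw.
    rewrite [X in _ --> X](_ : _ = 1 :> R)//.
    apply: (squeeze_cvgr _ lw (cvg_cst (1 : R))); apply: nearW => n.
    rewrite (andP (p01 _ _ _)).2 andbT.
    apply: le_trans (bernB _ (n * 2 ^ n)%N _); last first.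
      by rewrite exprn_ge0// exprn_ile1.
    rewrite lerD2l lerN2 natrM natrX -mulrA -exprMn -w2 -exprM mulnC exprM expr2.
    rewrite mulrA ler_wpM2r ?exprn_ge0//.
    rewrite -[leRHS]mul1r ler_pdivlMr ?subr_gt0// mulrAC (le_trans (nw n))//.
    by rewrite gerBl exprn_ge0.
  - rewrite [X in _ --> X](_ : _ = 0 :> R)//.
    apply: (squeeze_cvgr _ (cvg_cst (0 : R)) (@cvg_harmonic R)); apply: nearW => n.
    rewrite (andP (p01 _ _ _)).1 /=.
    (* Since [2 y >= 1], [k a >= n]. Then [(1 - a) ^ k (1 + a) ^ k <= 1] and
       [(1 + a) ^ k >= 1 + k a] bound the power by [1 / (n + 1)]. *)
    set a := y x ^+ n; set k := (n * 2 ^ n)%N.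
    have a0 : 0 <= a by rewrite exprn_ge0.
    have a1 : a <= 1 by rewrite exprn_ile1.
    have ka : n%:R <= k%:R * a.
      rewrite natrM natrX -mulrA -exprMn ler_peMr// exprn_ege1//; lra.
    rewrite -[leRHS]mul1r ler_pdivlMr ?ltr0n//.
    apply: (@le_trans _ _ ((1 - a) ^+ k * (1 + a) ^+ k)).
      apply: ler_wpM2l; first by rewrite exprn_ge0// subr_ge0.
      by apply: le_trans (bern _ _ a0); rewrite -natr1; lra.
    by rewrite -exprMn exprn_ile1//; nra.
apply: (trig_test_lim (M := M) (fun n => tp n (n * 2 ^ n)%N)).
- move=> n x; rewrite normrM ger0_norm ?(andP (p01 _ _ _)).1//.
  by rewrite (le_trans _ (h1M x))// ler_piMl// (andP (p01 _ _ _)).2.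
- move=> n x; rewrite normrM ger0_norm ?(andP (p01 _ _ _)).1//.
  by rewrite (le_trans _ (h2M x))// ler_piMl// (andP (p01 _ _ _)).2.
- by move=> x; apply: cvgMl; exact: lim.
- by move=> x; apply: cvgMl; exact: lim.
Qed.

Lemma trig_test_half_line (u c : R) h1 h2 :
  (exists M : R, (forall w, `|h1 w| <= M) /\ (forall w, `|h2 w| <= M)) ->
  trig_test h1 h2 ->
  trig_test (fun w => (X1 u w <= c)%R%:R * h1 w)
            (fun w => (X2 u w <= c)%R%:R * h2 w).
Proof.
move=> [M [h1M h2M]] th.
have M0 : 0 <= M by apply: le_trans (h1M point); exact: normr_ge0.
have bb (b : bool) (x : R) : `|x| <= M -> `|b%:R * x| <= M.
  by case: b; rewrite ?mul1r// mul0r normr0.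
have lt_test e : trig_test (fun w => (X1 u w < e)%R%:R * h1 w)
                           (fun w => (X2 u w < e)%R%:R * h2 w).
  (* The phase turns the cosine into [sin (b (x - e))]. As the frequency [b] tends to 0, [b |x - e|]
     drops below [pi], and the sine then has the sign of [x - e]. *)
  pose b n : R := n.+1%:R^-1; pose d n : R := - (e * b n + pi / 2).
  have lim x : ((half_cos (b n) (d n) x < 2^-1)%R%:R : R) @[n --> \oo] -->
               ((x < e)%R%:R : R).
    have b0 : b n * `|x - e| @[n --> \oo] --> (0 * `|x - e| : R).
      by apply: cvgMl; exact: cvg_harmonic.
    rewrite mul0r in b0.
    apply: cvg_near_cst; near=> n; congr (_%:R); congr nat_of_bool.
    have bn0 : 0 < b n by rewrite invr_gt0 ltr0n.
    have /= bpi : b n * `|x - e| < pi.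
      by near: n; exact: (cvgr_lt _ b0 _ (pi_gt0 R)).
    rewrite /half_cos (_ : b n * x + d n = b n * (x - e) - pi / 2); last first.
      by rewrite /d; ring.
    have -> : cos (b n * (x - e) - pi / 2) = sin (b n * (x - e)).
      by rewrite cosB cos_pihalf sin_pihalf; ring.
    have [xe|xe|->] := ltgtP x e.
    - have : 0 < sin (b n * (e - x)).
        apply: sin_gt0_pi; rewrite mulr_gt0 ?subr_gt0//=.
        by move: bpi; rewrite distrC gtr0_norm// subr_gt0.
      by rewrite -opprB mulrN sinN oppr_gt0; lra.
    - have : 0 < sin (b n * (x - e)).
        apply: sin_gt0_pi; rewrite mulr_gt0 ?subr_gt0//=.
        by move: bpi; rewrite gtr0_norm// subr_gt0.
      by move=> s0; apply/negbTE; rewrite -leNgt; lra.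
    - by rewrite subrr mulr0 sin0; apply/negbTE; rewrite -leNgt; lra.
  apply: (trig_test_lim (M := M) (fun n => trig_test_step u (d n) (b n) _ th)).
  - by exists M.
  - by move=> n w; exact: bb.
  - by move=> n w; exact: bb.
  - by move=> w; apply: cvgMl; exact: lim.
  - by move=> w; apply: cvgMl; exact: lim.
have lim x : ((x < c + n.+1%:R^-1)%R%:R : R) @[n --> \oo] --> ((x <= c)%R%:R : R).
  apply: cvg_near_cst; have [xc|xc] := leP x c.
    near=> n; congr (_%:R); congr nat_of_bool.
    by rewrite (le_lt_trans xc)// ltrDl invr_gt0.
  have xc0 : 0 < x - c by rewrite subr_gt0.
  near=> n; have nxc : n.+1%:R^-1 < x - c.
    by near: n; exact: (cvgr_lt _ (@cvg_harmonic R) _ xc0).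
  by rewrite ltNge -lerBrDl (ltW nxc).
apply: (trig_test_lim (M := M) (fun n => lt_test (c + n.+1%:R^-1))).
- by move=> n w; exact: bb.
- by move=> n w; exact: bb.
- by move=> w; apply: cvgMl; exact: lim.
- by move=> w; apply: cvgMl; exact: lim.
Unshelve. all: by end_near. Qed.

Lemma same_mean_law (L1 : T1 -> R) (L2 : T2 -> R) (g : R -> R) (M : R) :
  measurable_fun setT L1 -> measurable_fun setT L2 ->
  (forall A, measurable A -> P1 (L1 @^-1` A) = P2 (L2 @^-1` A)) ->
  measurable_fun setT g -> (forall x, `|g x| <= M) ->
  same_mean (g \o L1) (g \o L2).
Proof.
move=> mL1 mL2 eL mg gM; split.
- exact: measurableT_comp.
- exact: measurableT_comp.
- by exists M; split=> x; exact: gM.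
have E d (T : measurableType d) (P : probability T R) (L : T -> R)
    (mL : measurable_fun setT L) :
    (\int[P]_x ((g \o L) x)%:E =
     \int[distribution P (mfun_Sub (mem_set mL))]_x (g x)%:E)%E.
  rewrite integral_pushforward//; first exact/measurable_EFinP.
  by apply: (@bounded_integrable _ _ _ _ M); [exact: measurableT_comp|move=> x; exact: gM].
rewrite (E _ _ _ _ mL1) (E _ _ _ _ mL2).
by apply: eq_measure_integral => A mA _; exact: eL.
Qed.

Hypothesis mX1 : forall u, measurable_fun setT (X1 u).
Hypothesis mX2 : forall u, measurable_fun setT (X2 u).
Hypothesis same_comb : forall l A, measurable A ->
  P1 (lin_comb X1 l @^-1` A) = P2 (lin_comb X2 l @^-1` A).

Lemma measurable_lin_comb d (T : measurableType d) (X : R -> T -> R) l :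
  (forall u, measurable_fun setT (X u)) -> measurable_fun setT (lin_comb X l).
Proof.
move=> mX; elim: l => [|p l IH].
  by rewrite (_ : lin_comb X [::] = cst 0)//; apply/funext => w; rewrite /lin_comb big_nil.
rewrite (_ : lin_comb X _ = (fun w => p.1 * X p.2 w + lin_comb X l w)); last first.
  by apply/funext => w; rewrite /lin_comb big_cons.
by apply: measurable_funD => //; exact: measurable_funM.
Qed.

Lemma trig_test1 : trig_test (cst 1) (cst 1).
Proof.
move=> l c; pose g (x : R) := cos (x + c) * 1.
apply: (same_mean_law (g := g) (M := 1)).
- exact: measurable_lin_comb.
- exact: measurable_lin_comb.
- exact: same_comb.
- apply: measurable_funM => //; apply: measurableT_comp.
    by apply: continuous_measurable_fun; exact: continuous_cos.
  exact: measurable_funD.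
- by move=> x; rewrite /g mulr1 cos_max.
Qed.

Definition lower_box (T : Type) (X : R -> T -> R) (s : seq (R * R)) : set T :=
  [set w | all (fun p => X p.1 w <= p.2) s].

Lemma measurable_lower_box d (T : measurableType d) (X : R -> T -> R) s :
  (forall u, measurable_fun setT (X u)) -> measurable (lower_box X s).
Proof.
move=> mX; elim: s => [|p s IH].
  by rewrite (_ : lower_box X [::] = setT)//; apply/seteqP; split.
rewrite (_ : lower_box X (p :: s) = X p.1 @^-1` [set x | x <= p.2] `&` lower_box X s).
  apply: measurableI => //; rewrite -[X in measurable X]setTI; apply: mX => //.
  by rewrite (_ : [set x | x <= p.2] = `]-oo, p.2]%classic)//; apply/seteqP; split => x /=; rewrite in_itv.
by apply/seteqP; split => w /=; [move/andP|move=> ?; exact/andP].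
Qed.

Lemma cramer_wold s : P1 (lower_box X1 s) = P2 (lower_box X2 s).
Proof.
have /(_ [::] 0) [_ _ _] : trig_test
    (fun w => (all (fun p => X1 p.1 w <= p.2) s)%:R)
    (fun w => (all (fun p => X2 p.1 w <= p.2) s)%:R).
  elim: s => [|p s IH]; first exact: trig_test1.
  apply: trig_test_ext (trig_test_half_line p.1 p.2 _ IH).
  - by move=> w /=; case: (_ <= _); rewrite ?mul1r ?mul0r.
  - by move=> w /=; case: (_ <= _); rewrite ?mul1r ?mul0r.
  by exists 1; split => w; case: all; rewrite ?normr1 ?normr0.
have E d (T : measurableType d) (P : probability T R) (X : R -> T -> R) :
    (forall u, measurable_fun setT (X u)) ->
    (\int[P]_x (cos (lin_comb X [::] x + 0) * (all (fun p => X p.1 x <= p.2) s)%:R)%:E =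
     P (lower_box X s))%E.
  move=> mX; rewrite -[lower_box X s]setIT -[RHS]integral_indic//; last exact: measurable_lower_box.
  apply: eq_integral => w _.
  by rewrite /lin_comb big_nil addr0 cos0 mul1r indicE; congr (_%:R%:E);
     congr nat_of_bool; apply/idP/idP => [h|/set_mem//]; exact: mem_set.
by rewrite !E.
Qed.

End SameMean.

(** * The space of paths *)

Section Clip.
Variable R : realType.
Implicit Types a b u v : R.

Definition clip a b u : R := Num.max a (Num.min b u).

Lemma clipP a b u : a <= b ->
  [\/ u <= a /\ clip a b u = a, a <= u <= b /\ clip a b u = u
    | b <= u /\ clip a b u = b].
Proof.
move=> ab; have [ua|au] := leP u a.
  by apply: Or31; rewrite /clip (min_r (le_trans ua ab)) max_l.
have [ub|bu] := leP u b.
  by apply: Or32; rewrite /clip min_r// max_r ?ltW.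
by apply: Or33; rewrite /clip min_l ?ltW// max_r.
Qed.

Lemma clip_in a b u : a <= b -> a <= clip a b u <= b.
Proof. by move=> ab; case: (clipP u ab) => -[? ->]; rewrite ?ab ?lexx. Qed.

Lemma clip_id a b u : a <= u <= b -> clip a b u = u.
Proof. by move=> /andP[au ub]; rewrite /clip min_r// max_r. Qed.

Lemma continuous_clip a b : continuous (clip a b).
Proof.
move=> u; apply: (@continuous_comp _ _ _ (Num.min b) (Num.max a)).
- by apply: continuous_min => //; exact: cvg_cst.
- by apply: continuous_max => //; exact: cvg_cst.
Qed.

End Clip.
Notation clip01 := (clip 0 1).

Definition is_path (R : realType) (f : R -> R) : Prop :=
  [/\ continuous f, f 0 = 0 & forall u, f u = f (clip01 u)].

(* Continuous functions on [0, 1] vanishing at 0, extended to the whole line by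
   constants. *)
Record cpath (R : realType) := Path { path_fun :> R -> R; cpathP : is_path path_fun }.

Lemma is_path0 (R : realType) : is_path (cst (0 : R)).
Proof. by split=> // u; exact: cvg_cst. Qed.

Lemma path_eq (R : realType) (f g : cpath R) : f =1 g -> f = g.
Proof.
case: f g => f pf [g pg] /= /funext fg; rewrite fg in pf *.
by congr Path; exact: Prop_irrelevance.
Qed.

HB.instance Definition _ (R : realType) := gen_eqMixin (cpath R).
HB.instance Definition _ (R : realType) := gen_choiceMixin (cpath R).
HB.instance Definition _ (R : realType) := isPointed.Build (cpath R) (Path (is_path0 R)).

Section PathMeasurable.
Variable R : realType.

(** Lower boxes are closed under intersection, by concatenation of their lists, so two laws on paths
    that agree on them are equal. *)
Definition path_cylinder : set (set (cpath R)) :=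
  [set A | exists s, A = lower_box (fun u (f : cpath R) => f u) s].

Definition path_display : measure_display. Proof. by constructor. Qed.

Definition path_measurable := <<s path_cylinder >>.

Let path_measurable0 : path_measurable set0.
Proof. exact: sigma_algebra0. Qed.

Let path_measurableC (U : set (cpath R)) : path_measurable U -> path_measurable (~` U).
Proof. exact: sigma_algebraC. Qed.

Let path_measurableU (F : (set (cpath R))^nat) :
  (forall i, path_measurable (F i)) -> path_measurable (\bigcup_i F i).
Proof. exact: sigma_algebra_bigcup. Qed.

HB.instance Definition _ := @isMeasurable.Build path_display (cpath R)
  path_measurable path_measurable0 path_measurableC path_measurableU.

Lemma path_coord u : measurable_fun setT (fun f : cpath R => f u).
Proof.
apply: (measurability _ (RGenOInfty.measurableE R)).
move=> _ [_ [x ->] <-]; rewrite setTI.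
rewrite (_ : _ @^-1` _ = ~` lower_box (fun u (f : cpath R) => f u) [:: (u, x)]).
  by apply: measurableC; apply: sub_sigma_algebra; exists [:: (u, x)].
apply/seteqP; split => f /=; rewrite in_itv/= andbT /lower_box /= andbT ltNge.
  by move/negP.
by move/negP.
Qed.

Lemma measurable_path d (T : measurableType d) (X : T -> cpath R) :
  (forall u, measurable_fun setT (fun w => X w u)) -> measurable_fun setT X.
Proof.
move=> mX; apply: (measurability path_cylinder) => //.
move=> _ [_ [s ->] <-]; rewrite setTI.
exact: (@measurable_lower_box _ _ _ (fun u w => X w u) s mX).
Qed.

End PathMeasurable.

(** * Laws of linear combinations of bridge values *)

Section BridgeLaw.
Variables (R : realType) (lam : R).
Implicit Types (l : seq (R * R)) (L : R -> seq (R * R)).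

(** The bilinear extension of a kernel to formal combinations of times; for a covariance kernel it
    is the covariance of the two combinations. *)
Definition pairing (k : R -> R -> R) l1 l2 : R :=
  \sum_(p <- l1) \sum_(q <- l2) p.1 * q.1 * k p.2 q.2.

Definition weight l : R := \sum_(p <- l) p.1 * clip01 p.2.

Definition min01 (s t : R) : R := Num.min (clip01 s) (clip01 t).

Definition bridge_var l : R := pairing min01 l l - weight l ^+ 2.

Definition bridge_marginals d (T : measurableType d) (P : probability T R)
    (X : R -> T -> R) : Prop :=
  (forall u, measurable_fun setT (X u)) /\
  (forall l A, measurable A -> P (lin_comb X l @^-1` A) =
     normal_law (lam * weight l) (bridge_var l) A).

Lemma bridge_marginals_law d1 (T1 : measurableType d1) d2 (T2 : measurableType d2)
    (P1 : probability T1 R) (P2 : probability T2 R)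
    (F1 : T1 -> cpath R) (F2 : T2 -> cpath R) :
  bridge_marginals P1 (fun u w => F1 w u) -> bridge_marginals P2 (fun u w => F2 w u) ->
  forall A, measurable A -> P1 (F1 @^-1` A) = P2 (F2 @^-1` A).
Proof.
move=> [m1 e1] [m2 e2] A mA.
have mF1 : measurable_fun setT F1 by exact: measurable_path.
have mF2 : measurable_fun setT F2 by exact: measurable_path.
change (distribution P1 (mfun_Sub (mem_set mF1)) A =
        distribution P2 (mfun_Sub (mem_set mF2)) A).
apply: (measure_unique (@path_cylinder R) (fun=> setT)) => //.
- move=> _ _ [s ->] [s' ->]; exists (s ++ s').
  by apply/seteqP; split => f /=; rewrite /lower_box /= all_cat => /andP.
- move=> _; exists [::]; by apply/seteqP; split.
- by rewrite bigcup_const.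
- move=> _ [s ->]; rewrite /= /distribution /pushforward /=.
  apply: (cramer_wold m1 m2) => l B mB.
  by rewrite e1// e2.
- by move=> _; rewrite /= (le_lt_trans (probability_le1 _ _)) ?ltry.
Qed.

Definition subst_comb L l : seq (R * R) :=
  flatten [seq [seq (p.1 * q.1, q.2) | q <- L p.2] | p <- l].

Lemma lin_comb_subst (T : Type) (X : R -> T -> R) L l w :
  lin_comb X (subst_comb L l) w = lin_comb (fun u => lin_comb X (L u)) l w.
Proof.
rewrite /lin_comb /subst_comb big_flatten big_map; apply: eq_bigr => p _.
by rewrite big_map mulr_sumr; apply: eq_bigr => q _; rewrite mulrA.
Qed.

Lemma weight_subst L l : (forall u, weight (L u) = clip01 u) ->
  weight (subst_comb L l) = weight l.
Proof.
move=> wL; rewrite /weight /subst_comb big_flatten big_map; apply: eq_bigr => p _.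
by rewrite big_map -wL mulr_sumr; apply: eq_bigr => q _; rewrite mulrA.
Qed.

Lemma pairing_subst k L l l' :
  pairing k (subst_comb L l) (subst_comb L l') =
  pairing (fun s t => pairing k (L s) (L t)) l l'.
Proof.
rewrite /pairing /subst_comb big_flatten big_map; apply: eq_bigr => p _.
rewrite big_map; under eq_bigr do rewrite big_flatten big_map.
rewrite exchange_big; apply: eq_bigr => q _.
rewrite mulr_sumr; apply: eq_bigr => p' _; rewrite big_map mulr_sumr.
by apply: eq_bigr => q' _ /=; ring.
Qed.

(** The covariance [min(s, t) - s t] consists of the [min01] kernel and a product of weights. A
    substitution that respects both keeps the mean and the variance of every combination, so
    invariance of the law becomes two finite identities. *)
Lemma bridge_marginals_subst d (T : measurableType d) (P : probability T R)
    (X : R -> T -> R) L :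
  bridge_marginals P X -> (forall u, weight (L u) = clip01 u) ->
  (forall s t, pairing min01 (L s) (L t) = min01 s t) ->
  bridge_marginals P (fun u => lin_comb X (L u)).
Proof.
move=> [mX eX] wL mL; split=> [u|l A mA]; first exact: measurable_lin_comb.
rewrite (_ : lin_comb _ l = lin_comb X (subst_comb L l)); last first.
  by apply/funext => w; rewrite lin_comb_subst.
rewrite (eX _ _ mA) /bridge_var (weight_subst l wL) (pairing_subst min01 L l l).
suff -> : (fun s t => pairing min01 (L s) (L t)) = min01 by [].
by apply/funext => s; apply/funext => t.
Qed.

End BridgeLaw.

(** * Reflections and rotations of the bridge *)

Ltac elim_min :=
  repeat match goal with |- context[Order.min ?x ?y] =>
    first [ rewrite (@min_l _ _ x y); [|solve [lra]]
          | rewrite (@min_r _ _ x y); [|solve [lra]]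
          | case: (leP x y) => ? ] end.

Section PathMaps.
Variable R : realType.
Implicit Types (f : cpath R) (a b u lam : R).

Lemma path_continuous f : continuous f. Proof. by case: (cpathP f). Qed.
Lemma path0 f : f 0 = 0. Proof. by case: (cpathP f). Qed.
Lemma path_clip f u : f (clip01 u) = f u. Proof. by case: (cpathP f). Qed.

Lemma path_le0 f u : u <= 0 -> f u = 0.
Proof.
move=> u0; rewrite -path_clip; case: (@clipP R 0 1 u) => // -[h ->].
- exact: path0.
- by rewrite (_ : u = 0) ?path0//; lra.
- by lra.
Qed.

Lemma path_ge1 f u : 1 <= u -> f u = f 1.
Proof.
move=> u1; rewrite -path_clip; case: (@clipP R 0 1 u) => // -[h ->] //.
  by lra.
by rewrite (_ : u = 1)//; lra.
Qed.

Lemma min01E u v : 0 <= u <= 1 -> min01 u v = Num.min u (clip01 v).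
Proof. by move=> u01; rewrite /min01 (clip_id u01). Qed.

Lemma min01C u v : min01 u v = min01 v u.
Proof. by rewrite /min01 minC. Qed.

Lemma cvg_path f (h : R -> R) u : {for u, continuous h} -> {for u, continuous (f \o h)}.
Proof. by move=> ch; apply: continuous_comp => //; exact: path_continuous. Qed.

(* Point reflection of the block [a, b], which reverses the increments there. *)
Definition flip_fun a b (f : R -> R) u : R :=
  let c := clip a b u in f u - f c + f a + f b - f (a + b - c).

Lemma is_path_flip a b f : 0 <= a -> a <= b -> b <= 1 -> is_path (flip_fun a b f).
Proof.
move=> a0 ab b1; split.
- move=> u; rewrite /flip_fun.
  have c1 : {for u, continuous (f \o clip a b)}.
    by apply: cvg_path; exact: continuous_clip.
  have c2 : {for u, continuous (f \o (fun v => a + b - clip a b v))}.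
    by apply: cvg_path; apply: cvgB; [exact: cvg_cst|exact: continuous_clip].
  apply: cvgB => //; apply: cvgD; last exact: cvg_cst.
  apply: cvgD; last exact: cvg_cst.
  by apply: cvgB => //; exact: path_continuous.
- rewrite /flip_fun; case: (@clipP R a b 0) => // -[h ->].
  + by rewrite (addrC a b) addrK path0; ring.
  + by rewrite (_ : a = 0) ?path0 ?add0r ?subr0; [ring|lra].
  + rewrite (_ : a = 0) ?path0; last by lra.
    have -> : b = 0 by lra.
    by rewrite (_ : 0 + 0 - 0 = 0 :> R) ?path0; ring.
- move=> u; rewrite /flip_fun path_clip.
  suff -> : clip a b (clip01 u) = clip a b u by [].
  case: (@clipP R 0 1 u) => // -[h ->//].
  + by case: (@clipP R a b 0) => // -[h' ->]; case: (@clipP R a b u) => // -[h'' ->]; lra.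
  + by case: (@clipP R a b 1) => // -[h' ->]; case: (@clipP R a b u) => // -[h'' ->]; lra.
Qed.

(** Made total by the identity because the block will later start at the random time [tau f + a]. *)
Definition flip a b f : cpath R :=
  match pselect [/\ 0 <= a, a <= b & b <= 1] with
  | left H => let: And3 a0 ab b1 := H in Path (is_path_flip f a0 ab b1)
  | right _ => f
  end.

Section FlipValues.
Variables (a b : R).
Hypotheses (a0 : 0 <= a) (ab : a <= b) (b1 : b <= 1).

Lemma flipE f u : flip a b f u = flip_fun a b f u.
Proof. by rewrite /flip; case: pselect => [[]|[]]. Qed.

Lemma flip_in f u : a <= u <= b -> flip a b f u = f a + f b - f (a + b - u).
Proof. by move=> ub; rewrite flipE /flip_fun clip_id//; ring. Qed.

Lemma flip_out f u : (u <= a) || (b <= u) -> flip a b f u = f u.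
Proof.
rewrite flipE /flip_fun => ub; case: (clipP u ab) => -[h ->].
- by rewrite (addrC a b) addrK; ring.
- have [-> | ->] : u = a \/ u = b by case/orP: ub => ?; [left|right]; lra.
  + by rewrite (addrC a b) addrK; ring.
  + by rewrite addrK; ring.
- by rewrite addrK; ring.
Qed.

Definition flip_comb u : seq (R * R) :=
  let c := clip a b u in [:: (1, u); (-1, c); (1, a); (1, b); (-1, a + b - c)].

Let ca : clip01 a = a. Proof. by apply: clip_id; rewrite a0 (le_trans ab). Qed.
Let cb : clip01 b = b. Proof. by apply: clip_id; rewrite b1 (le_trans a0). Qed.

Lemma flip_weight u : weight (flip_comb u) = clip01 u.
Proof.
have [a0' ab' b1'] : [/\ 0 <= a, a <= b & b <= 1] by [].
rewrite /weight !big_cons big_nil /= ca cb.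
have /andP[h1 h2] := clip_in u ab.
rewrite (@clip_id _ 0 1 (clip a b u)); last by apply/andP; split; lra.
by rewrite (@clip_id _ 0 1 (a + b - clip a b u)); [ring|apply/andP; split; lra].
Qed.

Lemma flip_pairing s t :
  pairing (@min01 R) (flip_comb s) (flip_comb t) = min01 s t.
Proof.
have [a0' ab' b1'] : [/\ 0 <= a, a <= b & b <= 1] by [].
have E c x : a <= c <= b -> min01 c x = Num.min c (clip01 x) by move=> /andP[? ?]; apply: min01E; apply/andP; split; lra.
have E' c x : a <= c <= b -> min01 x c = Num.min c (clip01 x) by rewrite min01C; exact: E.
have out x : x <= a \/ b <= x -> clip01 x <= a \/ b <= clip01 x.
  move=> h; case: (@clipP R 0 1 x) => // -[h' ->].
  - by left; lra.
  - by [].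
  - by right; lra.
(* Against a time outside the block, [min01] is constant (left of it) or affine (right of it) on the
   block, so a time and its mirror image have the same total as the two endpoints. *)
have inout s' t' : a <= s' <= b -> t' <= a \/ b <= t' ->
    min01 a t' + min01 b t' - min01 (a + b - s') t' = min01 s' t'.
  move=> h /out h'; rewrite !E//; try lra.
  by case: h' => h'; elim_min; lra.
have abaE : a + b - a = b by ring.
have abbE : a + b - b = a by ring.
rewrite /pairing /flip_comb !big_cons !big_nil /=.
case: (clipP s ab) => -[hs cs]; case: (clipP t ab) => -[ht ct]; rewrite cs ct ?abaE ?abbE.
- by ring.
- by rewrite [RHS]min01C -(inout t s) ?(min01C s); [ring|lra|left].
- by ring.
- by rewrite -(inout s t); [ring|lra|left].
- pose phi x := min01 a x + min01 b x - min01 (a + b - s) x.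
  have : phi a + phi b - phi (a + b - t) = min01 s t.
    rewrite /phi !E; try lra.
    rewrite !clip_id; try lra.
    by elim_min; lra.
  by move=> <-; rewrite /phi; ring.
- by rewrite -(inout s t); [ring|lra|right].
- by ring.
- by rewrite [RHS]min01C -(inout t s) ?(min01C s); [ring|lra|right].
- by ring.
Qed.

Lemma flip_marginals lam (mu : probability (cpath R) R) :
  bridge_marginals lam mu (fun u f => f u) ->
  bridge_marginals lam mu (fun u f => flip a b f u).
Proof.
move=> hmu.
rewrite (_ : (fun u f => _) = (fun u => lin_comb (fun v f => f v) (flip_comb u))).
  apply: bridge_marginals_subst hmu _ _; [exact: flip_weight|exact: flip_pairing].
apply/funext => u; apply/funext => f.
by rewrite flipE /flip_fun /lin_comb !big_cons big_nil /=; ring.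
Qed.

End FlipValues.

Lemma measurable_flip a b : measurable_fun setT (flip a b).
Proof.
apply: measurable_path => u; have [[a0 ab b1]|h] := pselect [/\ 0 <= a, a <= b & b <= 1].
  under eq_fun do rewrite flipE// /flip_fun.
  apply: measurable_funB; last exact: path_coord.
  apply: measurable_funD; last exact: path_coord.
  apply: measurable_funD; last exact: path_coord.
  by apply: measurable_funB; exact: path_coord.
rewrite (_ : (fun w => _) = (fun w : cpath R => w u)); first exact: path_coord.
by apply/funext => f; rewrite /flip; case: pselect.
Qed.

End PathMaps.

Section Rotation.
Variable R : realType.
Implicit Types (f : cpath R) (a b u lam : R).

(* Cyclic shift of the increments by 1/2. *)
Definition rot_fun (f : R -> R) u : R :=
  let c := clip01 u in f (c + 2^-1) - f 2^-1 + f (c - 2^-1).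

(** The constant extension of [f] lets one formula serve both halves: the last term is [f 0 = 0] up
    to 1/2, and the first is [f 1] afterwards. Continuity thus needs no gluing at 1/2. *)
Lemma is_path_rot f : is_path (rot_fun f).
Proof.
split.
- move=> u; rewrite /rot_fun.
  have c1 : {for u, continuous (f \o (fun v => clip01 v + 2^-1))}.
    by apply: cvg_path; apply: cvgD; [exact: continuous_clip|exact: cvg_cst].
  have c2 : {for u, continuous (f \o (fun v => clip01 v - 2^-1))}.
    by apply: cvg_path; apply: cvgB; [exact: continuous_clip|exact: cvg_cst].
  by apply: cvgD => //; apply: cvgB => //; exact: cvg_cst.
- rewrite /rot_fun (@clip_id _ 0 1 0) ?lexx ?ler01// add0r subrr add0r sub0r.
  by rewrite path_le0// oppr_le0 invr_ge0.
- by move=> u; rewrite /rot_fun (@clip_id _ 0 1 (clip01 u))// clip_in.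
Qed.

Definition rotp f : cpath R := Path (is_path_rot f).

Lemma rot_lo f u : 0 <= u <= 2^-1 -> rotp f u = f (u + 2^-1) - f 2^-1.
Proof.
move=> /andP[u0 u1]; rewrite /rotp /= /rot_fun (@clip_id _ 0 1 u); last by apply/andP; split; lra.
by rewrite (path_le0 f (u := u - 2^-1)) ?addr0//; lra.
Qed.

Lemma rot_hi f u : 2^-1 <= u <= 1 -> rotp f u = f (u - 2^-1) + f 1 - f 2^-1.
Proof.
move=> /andP[u0 u1]; rewrite /rotp /= /rot_fun (@clip_id _ 0 1 u); last by apply/andP; split; lra.
by rewrite (path_ge1 f (u := u + 2^-1)); [ring|lra].
Qed.

Lemma measurable_rot : measurable_fun setT rotp.
Proof.
apply: measurable_path => u; rewrite /rotp /= /rot_fun.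
apply: measurable_funD; last exact: path_coord.
by apply: measurable_funB; exact: path_coord.
Qed.

Definition rot_comb u : seq (R * R) :=
  let c := clip01 u in [:: (1, c + 2^-1); (-1, 2^-1); (1, c - 2^-1)].

Lemma clip01_half_lo (c : R) : 0 <= c <= 2^-1 ->
  clip01 (c + 2^-1) = c + 2^-1 /\ clip01 (c - 2^-1) = 0.
Proof.
move=> /andP[c0 c1]; split; first by rewrite clip_id//; apply/andP; split; lra.
by case: (@clipP _ 0 1 (c - 2^-1) ler01) => // -[h ->]; lra.
Qed.

Lemma clip01_half_hi (c : R) : 2^-1 <= c <= 1 ->
  clip01 (c + 2^-1) = 1 /\ clip01 (c - 2^-1) = c - 2^-1.
Proof.
move=> /andP[c0 c1]; split; last by rewrite clip_id//; apply/andP; split; lra.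
by case: (@clipP _ 0 1 (c + 2^-1) ler01) => // -[h ->]; lra.
Qed.

Lemma rot_weight u : weight (rot_comb u) = clip01 u.
Proof.
have /andP[c0 c1] := @clip_in _ 0 1 u ler01.
rewrite /weight !big_cons big_nil /=.
rewrite (@clip_id _ 0 1 2^-1); last by apply/andP; split; lra.
set c := clip01 u in c0 c1 *; have [h|h] := leP c 2^-1.
- have [|-> ->] := @clip01_half_lo c; [by apply/andP; split|by ring].
- have [|-> ->] := @clip01_half_hi c; [by apply/andP; split; lra|by lra].
Qed.

Lemma rot_pairing s t : pairing (@min01 R) (rot_comb s) (rot_comb t) = min01 s t.
Proof.
have /andP[s0 s1] := @clip_in _ 0 1 s ler01.
have /andP[t0 t1] := @clip_in _ 0 1 t ler01.
rewrite /pairing /rot_comb !big_cons !big_nil /= /min01.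
rewrite (@clip_id _ 0 1 2^-1); last by apply/andP; split; lra.
set c := clip01 s in s0 s1 *; set d := clip01 t in t0 t1 *.
have [h1|h1] := ltP c 2^-1.
- have [|-> ->] := @clip01_half_lo c; first by apply/andP; split; lra.
  have [h2|h2] := ltP d 2^-1.
  + have [|-> ->] := @clip01_half_lo d; first by apply/andP; split; lra.
    by elim_min; lra.
  + have [|-> ->] := @clip01_half_hi d; first by apply/andP; split; lra.
    by elim_min; lra.
- have [|-> ->] := @clip01_half_hi c; first by apply/andP; split; lra.
  have [h2|h2] := ltP d 2^-1.
  + have [|-> ->] := @clip01_half_lo d; first by apply/andP; split; lra.
    by elim_min; lra.
  + have [|-> ->] := @clip01_half_hi d; first by apply/andP; split; lra.
    by elim_min; lra.
Qed.

Section Invariance.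
Variables (lam : R) (mu : probability (cpath R) R).
Hypothesis hmu : bridge_marginals lam mu (fun u f => f u).

Lemma rot_marginals : bridge_marginals lam mu (fun u f => rotp f u).
Proof.
rewrite (_ : (fun u f => _) = (fun u => lin_comb (fun v f => f v) (rot_comb u))).
  by apply: bridge_marginals_subst hmu _ _; [exact: rot_weight|exact: rot_pairing].
apply/funext => u; apply/funext => f.
by rewrite /rotp /= /rot_fun /lin_comb !big_cons big_nil /=; ring.
Qed.

Lemma flip_measure a b A : 0 <= a -> a <= b -> b <= 1 -> measurable A ->
  mu (flip a b @^-1` A) = mu A.
Proof.
move=> a0 ab b1 mA.
exact: (bridge_marginals_law (flip_marginals a0 ab b1 hmu) (F2 := id) hmu mA).
Qed.

Lemma rot_measure A : measurable A -> mu (rotp @^-1` A) = mu A.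
Proof.
move=> mA; exact: (bridge_marginals_law rot_marginals (F2 := id) hmu mA).
Qed.

Lemma ge0_integral_preserved (h : cpath R -> cpath R) (g : cpath R -> \bar R) :
  measurable_fun setT h -> (forall A, measurable A -> mu (h @^-1` A) = mu A) ->
  measurable_fun setT g -> (forall f, 0 <= g f)%E ->
  (\int[mu]_f g (h f) = \int[mu]_f g f)%E.
Proof.
move=> mh eh mg g0.
rewrite -[LHS](@ge0_integral_distribution _ _ _ _ _ mu (mfun_Sub (mem_set mh)) g)//.
by apply: eq_measure_integral => A mA _; exact: eh.
Qed.

End Invariance.

End Rotation.

(** * Time and value of the minimum *)

Section DenseSequence.
Variable R : realType.
Implicit Types (f : cpath R) (c t u : R).

(** Replaces conditions on all times of an interval by countably many, which for continuous paths
    are equivalent and are visibly measurable. *)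
Definition dense01 (n : nat) : R := clip01 (ratr (odflt 0 (@unpickle rat n))).

Lemma dense01_in n : 0 <= dense01 n <= 1.
Proof. exact: clip_in. Qed.

Lemma dense01P t (e : R) : 0 <= t <= 1 -> 0 < e -> exists n, `|dense01 n - t| < e.
Proof.
move=> /andP[t0 t1] e0.
have [|q] := @rat_in_itvoo R (t - e) (t + e); first by lra.
rewrite in_itv/= => /andP[q1 q2]; exists (pickle q).
rewrite /dense01 pickleK/= ltr_norml.
by case: (@clipP R 0 1 (ratr q) (@ler01 R)) => // -[h ->]; apply/andP; split; lra.
Qed.

Lemma cont_near (g : R -> R) t (e : R) : continuous g -> 0 < e ->
  exists2 d, 0 < d & forall u, `|u - t| < d -> `|g u - g t| < e.
Proof.
move=> cg e0; have /cvgrPdist_lt /(_ _ e0) := cg t.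
move=> /nbhs_ballP[d /= d0 h]; exists d => // u ut.
by rewrite distrC; apply: h; rewrite /ball /= distrC.
Qed.

Lemma cont_dense (g : R -> R) (c t e : R) : continuous g -> 0 <= t <= c -> 0 < e ->
  exists n, `|g (c * dense01 n) - g t| < e.
Proof.
move=> cg /andP[t0 tc] e0; have [d d0 hd] := cont_near t cg e0.
have [c0|c0] := leP c 0.
  have [-> ->] : t = 0 /\ c = 0 by split; lra.
  by exists 0%N; rewrite mul0r subrr normr0.
have [||n hn] := @dense01P (t / c) (d / c).
- by rewrite divr_ge0//= ?(ltW c0)// ler_pdivrMr// mul1r.
- by rewrite divr_gt0.
exists n; apply: hd.
rewrite (_ : c * dense01 n - t = (dense01 n - t / c) * c); last by field; rewrite gt_eqF.
by rewrite normrM (gtr0_norm c0) -ltr_pdivlMr.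
Qed.

Lemma cont_ge_dense (g : R -> R) (c v : R) : continuous g ->
  (forall n, v <= g (c * dense01 n)) -> forall t, 0 <= t <= c -> v <= g t.
Proof.
move=> cg h t tc; rewrite leNgt; apply/negP => ftv.
have [|n] := @cont_dense g c t (v - g t) cg tc; first by rewrite subr_gt0.
by have := h n; rewrite ltr_norml; lra.
Qed.

Lemma cont_le_dense (g : R -> R) (c v : R) : continuous g ->
  (forall n, g (c * dense01 n) <= v) -> forall t, 0 <= t <= c -> g t <= v.
Proof.
move=> cg h t tc; rewrite leNgt; apply/negP => ftv.
have [|n] := @cont_dense g c t (g t - v) cg tc; first by rewrite subr_gt0.
by have := h n; rewrite ltr_norml; lra.
Qed.

Lemma path_min f (a b : R) : a <= b ->
  exists2 t, a <= t <= b & forall u, a <= u <= b -> f t <= f u.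
Proof.
move=> ab; have [|t tab ht] := @EVT_min R f a b ab.
  by apply: continuous_subspaceT => x; exact: path_continuous.
by exists t => // u uab; apply: ht.
Qed.

End DenseSequence.

Section Argmin.
Variable R : realType.
Implicit Types (f : cpath R) (c t u : R).

Definition tau f : R := first_argmin f.

Lemma tau_spec f : [/\ 0 <= tau f <= 1, forall u, f (tau f) <= f u
  & forall u, 0 <= u < tau f -> f (tau f) < f u].
Proof.
have [t0 t0i ht0] := path_min f (@ler01 R).
set A := [set t | t \in `[0, 1]%R /\ forall s, s \in `[0, 1]%R -> f t <= f s].
have At0 : A t0 by split; rewrite ?in_itv// => s; rewrite in_itv; exact: ht0.
have lA : has_inf A.
  by split; [exists t0|exists 0 => t [] /[!in_itv]/= /andP[]].
have tA : tau f = inf A by [].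
have i01 : 0 <= inf A <= 1.
  apply/andP; split.
    by apply: lb_le_inf; [exists t0|move=> t [] /[!in_itv]/= /andP[]].
  by apply: (@le_trans _ _ t0); [exact: ge_inf lA.2 _ At0|case/andP: t0i].
have mu u : f t0 <= f u.
  by rewrite -(path_clip f u); apply: ht0; apply: clip_in.
have it0 : f (inf A) <= f t0.
  rewrite leNgt; apply/negP => lt.
  have [|d d0 hd] := @cont_near R f (inf A) (f (inf A) - f t0) (@path_continuous R f); first by rewrite subr_gt0.
  have [t At tl] := inf_adherent d0 lA.
  have := hd t; have := ge_inf lA.2 At => it.
  rewrite ger0_norm ?subr_ge0// ltrBlDl => /(_ tl).
  have : f t <= f t0 by apply: At.2; rewrite in_itv.
  by rewrite ltr_norml; lra.
rewrite tA; split => // [u|u /andP[u0 ui]]; first exact: le_trans (mu u).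
rewrite ltNge; apply/negP => fu.
have : A u.
  split; first by rewrite in_itv/= u0 (le_trans (ltW ui)) //; case/andP: i01.
  by move=> s _; apply: le_trans (mu s); exact: le_trans it0.
by move=> /(ge_inf lA.2); lra.
Qed.

Lemma tau_in f : 0 <= tau f <= 1. Proof. by case: (tau_spec f). Qed.
Lemma tau_min f u : f (tau f) <= f u. Proof. by case: (tau_spec f). Qed.
Lemma tau_first f u : 0 <= u < tau f -> f (tau f) < f u.
Proof. by case: (tau_spec f) => _ _; apply. Qed.

Lemma tau_unique f t : 0 <= t <= 1 -> (forall u, 0 <= u <= 1 -> f t <= f u) ->
  (forall u, 0 <= u < t -> f t < f u) -> tau f = t.
Proof.
move=> ti h1 h2; have := tau_in f; have := @tau_first f t; have := @tau_min f t.
have := h1 _ (tau_in f); have := h2 (tau f).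
have [l|l|//] := ltgtP (tau f) t => H1 H2 H3 H4 /andP[i0 i1].
- by have := H1 _; rewrite i0; lra.
- by have := H4; case/andP: ti => t0 _; rewrite t0 => /(_ isT); lra.
Qed.

(** As [tau] is the first minimizer, [tau > c] holds exactly when the infimum over [0, 1] is
    strictly below the infimum over [0, c]. By continuity both are infima over a dense sequence. *)
Lemma measurable_tau : measurable_fun setT tau.
Proof.
apply: (measurability _ (RGenOInfty.measurableE R)) => _ [_ [c ->] <-].
rewrite setTI.
have [c0|c0] := ltP c 0.
  rewrite (_ : _ @^-1` _ = setT)//; apply/seteqP; split=> // f _ /=.
  by rewrite in_itv/= andbT; have := tau_in f; case/andP; lra.
have [c1|c1] := leP 1 c.
  rewrite (_ : _ @^-1` _ = set0)//; apply/seteqP; split=> // f /=.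
  by rewrite in_itv/= andbT; have := tau_in f; case/andP; lra.
pose h (k : R) (n : nat) f := f (k * dense01 R n).
have lb k f : 0 <= k <= 1 -> has_lbound (range (h k ^~ f)).
  by move=> _; exists (f (tau f)) => _ [n _ <-]; exact: tau_min.
have mh k n : measurable_fun setT (h k n) by exact: path_coord.
have mi k : 0 <= k <= 1 -> measurable_fun setT (fun f => infs (h k ^~ f) 0%N).
  by move=> k01; apply: measurable_fun_infs => // f _; exact: lb.
have infE k f t : 0 <= k <= 1 -> 0 <= t <= k -> (forall u, 0 <= u <= k -> f t <= f u) ->
    infs (h k ^~ f) 0%N = f t.
  move=> k01 tk ft; apply/eqP; rewrite eq_le; apply/andP; split.
    apply: (cont_ge_dense (@path_continuous R f) _ tk) => n.
    by apply: ge_inf; [exact/has_lbound_sdrop/lb|exists n].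
  apply: lb_le_inf; first by exists (h k 0%N f); exists 0%N.
  move=> _ [n _ <-]; apply: ft; have /andP[d0 d1] := dense01_in R n.
  by case/andP: k01 => k0 k1; rewrite mulr_ge0// ler_piMr.
have c01 : 0 <= c <= 1 by rewrite c0 ltW.
rewrite (_ : _ @^-1` _ = [set f | infs (h 1 ^~ f) 0%N < infs (h c ^~ f) 0%N]).
  have := measurable_fun_ltr (mi 1 _) (mi c c01).
  rewrite lexx ler01 => /(_ isT) /(_ measurableT [set true] _).
  by rewrite setTI; apply.
apply/seteqP; split => f /=; rewrite in_itv/= andbT;
  have [t tc ht] := path_min f c0;
  rewrite (infE _ _ _ c01 tc ht) (infE 1 f (tau f)) ?lexx ?ler01 ?tau_in//;
  try by move=> *; exact: tau_min.
- by move=> ct; apply: tau_first; case/andP: tc => -> /= tc; exact: le_lt_trans ct.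
- move=> ft; rewrite ltNge; apply/negP => tc'.
  by have := ht (tau f); rewrite tc'; have := tau_in f; case/andP => -> _ /(_ isT); lra.
Qed.

End Argmin.

(** * Joint measurability of evaluation and of the Vervaat transform *)

Section Evaluation.
Variable R : realType.
Implicit Types (f : cpath R).

Lemma measurable_clip (a b : R) : measurable_fun setT (clip a b).
Proof. by apply: continuous_measurable_fun; exact: continuous_clip. Qed.

(** Rounding the time down to a grid gives a finite sum of products of measurable functions;
    continuity of the path gives the limit. *)
Lemma measurable_eval : measurable_fun setT (fun p : cpath R * R => p.1 p.2).
Proof.
pose B n (k : nat) : set R := [set u | k%:R <= n.+1%:R * clip01 u < k.+1%:R].
(* The index goes up to [n.+1] because the time 1 falls into a cell of its own. *)
pose h n (p : cpath R * R) :=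
  \sum_(k < n.+2) \1_(B n k) p.2 * p.1 (k%:R / n.+1%:R).
pose r n (u : R) : R := (Num.truncn (n.+1%:R * clip01 u))%:R / n.+1%:R.
have hE n p : h n p = p.1 (r n p.2).
  have /andP[c0 c1] := @clip_in R 0 1 p.2 ler01.
  have nc0 : 0 <= n.+1%:R * clip01 p.2 by rewrite mulr_ge0.
  have kn : (Num.truncn (n.+1%:R * clip01 p.2) < n.+2)%N.
    rewrite truncn_lt_nat// (@le_lt_trans _ _ n.+1%:R)// ?ltr_nat//.
    by rewrite ler_piMr.
  rewrite /h (bigD1 (Ordinal kn))//= big1 ?addr0.
    by rewrite indicE mem_set ?mul1r//= /B/= truncn_itv.
  move=> i ik; rewrite indicE memNset ?mul0r//= /B /= -truncn_eq// => /eqP e.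
  by move/eqP: ik; apply; apply: val_inj.
have rc u : r ^~ u @ \oo --> clip01 u.
  have /andP[c0 c1] := @clip_in R 0 1 u ler01.
  have lim : clip01 u - n.+1%:R^-1 @[n --> \oo] --> clip01 u - 0.
    by apply: cvgB; [exact: cvg_cst|exact: cvg_harmonic].
  rewrite subr0 in lim.
  apply: (squeeze_cvgr _ lim (cvg_cst (clip01 u))); apply: nearW => n.
  have nc0 : 0 <= n.+1%:R * clip01 u by rewrite mulr_ge0.
  have /andP[h1 h2] := truncn_itv nc0.
  have n0 : 0 < n.+1%:R :> R by rewrite ltr0n.
  rewrite /r ler_pdivlMr// ler_pdivrMr// mulrBl mulVf ?gt_eqF// mulrC.
  apply/andP; split=> //.
  by rewrite lerBlDr natr1 ltW.
apply: (@measurable_fun_cvg _ _ _ _ h).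
- move=> n; apply: measurable_sum => k; apply: measurable_funM.
    apply: measurableT_comp measurable_snd; apply: measurable_indic.
    rewrite (_ : B n k = (fun u => n.+1%:R * clip01 u) @^-1` `[k%:R, k.+1%:R[%classic).
      rewrite -[X in measurable X]setTI; apply: measurable_funM => //.
      exact: measurable_clip.
    by apply/seteqP; split => u /=; rewrite in_itv.
  by apply: (measurableT_comp (path_coord _)); exact: measurable_fst.
- move=> p _; under eq_fun do rewrite hE.
  rewrite -(path_clip p.1 p.2).
  apply: (@cvg_comp _ _ _ (r ^~ p.2) p.1); first exact: rc.
  exact: path_continuous.
Qed.

Lemma measurable_eval_comp d (T : measurableType d) (F : T -> cpath R) (g : T -> R) :
  measurable_fun setT F -> measurable_fun setT g ->
  measurable_fun setT (fun x => F x (g x)).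
Proof.
by move=> mF mg; exact: (measurableT_comp measurable_eval (measurable_fun_pair mF mg)).
Qed.

Definition V (f : cpath R) (t : R) : R := vervaat f t.

Lemma VE f t : V f t = if t <= 1 - tau f then f (tau f + t) - f (tau f)
  else f (tau f + t - 1) + f 1 - f (tau f).
Proof. by []. Qed.

Lemma measurable_V d (T : measurableType d) (F : T -> cpath R) (g : T -> R) :
  measurable_fun setT F -> measurable_fun setT g ->
  measurable_fun setT (fun x => V (F x) (g x)).
Proof.
move=> mF mg.
have mt : measurable_fun setT (fun x => tau (F x)) by exact: (measurableT_comp (@measurable_tau R) mF).
under eq_fun do rewrite VE.
apply: measurable_fun_ifT.
- by apply: measurable_fun_ler => //; exact: measurable_funB.
- by apply: measurable_funB; apply: measurable_eval_comp => //; exact: measurable_funD.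
- apply: measurable_funB; last exact: measurable_eval_comp.
  apply: measurable_funD; last exact: measurable_eval_comp.
  apply: measurable_eval_comp => //; apply: measurable_funB => //.
  exact: measurable_funD.
Qed.

End Evaluation.

(** * High and low blocks under reflection and rotation *)

Section PathEvents.
Variable R : realType.
Implicit Types (f g : cpath R) (lam a u : R).

(** The reflected block takes the value [V f a + V f (a + 1/4) - v] where the block had [v]. The
    three conditions say that the reflected block satisfies the upper bound of [evt_lo], that it
    does not go below the minimum, and that its centre, fixed by the reflection, falls below
    [lam]. *)
Definition evt_hi lam a f : Prop :=
  [/\ forall n, 2 * lam <= V f (a + 4^-1 * dense01 R n),
      forall n, V f (a + 4^-1 * dense01 R n) <= V f a + V f (a + 4^-1)
    & V f a + V f (a + 4^-1) - lam < V f (a + 8^-1)].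

(** Mirror image of [evt_hi]. It needs no lower bound: [V f >= 0] already gives the upper bound of
    [evt_hi] after reflection. *)
Definition evt_lo lam a f : Prop :=
  (forall n, V f (a + 4^-1 * dense01 R n) <= V f a + V f (a + 4^-1) - 2 * lam) /\
  V f (a + 8^-1) < lam.

Lemma V_lo f u : u <= 1 - tau f -> V f u = f (tau f + u) - f (tau f).
Proof. by move=> h; rewrite VE h. Qed.

(** For [tau f <= 1/2] the block ends at or before time 1, so only the first branch of [V] occurs;
    continuity extends the conditions from the dense times to the whole block. *)
Lemma evt_hiP lam a f : tau f <= 2^-1 -> 8^-1 <= a <= 4^-1 ->
  let al := tau f + a in let be := al + 4^-1 in
  evt_hi lam a f <->
  [/\ forall x, al <= x <= be -> f (tau f) + 2 * lam <= f x,
      forall x, al <= x <= be -> f x <= f al + f be - f (tau f)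
    & f al + f be - f (tau f) - lam < f (al + 8^-1)].
Proof.
move=> t2 /andP[a8 a4] al be.
have vE x : 0 <= x <= 4^-1 -> V f (a + x) = f (al + x) - f (tau f).
  by move=> /andP[x0 x4]; rewrite V_lo ?addrA//; lra.
have va : V f a = f al - f (tau f) by rewrite V_lo//; lra.
have cg : continuous (fun x => f (al + x)).
  by move=> x; apply: cvg_path; apply: cvgD; [exact: cvg_cst|exact: cvg_id].
have din n : 0 <= 4^-1 * dense01 R n <= 4^-1.
  by have /andP[d0 d1] := dense01_in R n; apply/andP; split; lra.
rewrite /evt_hi !vE ?va; try by apply/andP; split; lra.
split=> -[h1 h2 h3]; split.
- move=> x /andP[x1 x2]; rewrite (_ : x = al + (x - al)); last by ring.
  apply: (@cont_ge_dense R (fun x => f (al + x)) 4^-1) => //.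
    by move=> n; have := h1 n; rewrite vE//; lra.
  by apply/andP; split; rewrite /be in x2; lra.
- move=> x /andP[x1 x2]; rewrite (_ : x = al + (x - al)); last by ring.
  apply: (@cont_le_dense R (fun x => f (al + x)) 4^-1) => //.
    by move=> n; have := h2 n; rewrite vE// -/be; lra.
  by apply/andP; split; rewrite /be in x2; lra.
- by rewrite -/be in h3; lra.
- move=> n; rewrite vE//; have /andP[d0 d1] := din n.
  by have := h1 (al + 4^-1 * dense01 R n); rewrite /be lerDl d0 lerD2l d1 => /(_ isT); lra.
- move=> n; rewrite vE// -/be; have /andP[d0 d1] := din n.
  by have := h2 (al + 4^-1 * dense01 R n); rewrite /be lerDl d0 lerD2l d1 => /(_ isT); lra.
- by rewrite -/be; lra.
Qed.

Lemma evt_loP lam a f : tau f <= 2^-1 -> 8^-1 <= a <= 4^-1 ->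
  let al := tau f + a in let be := al + 4^-1 in
  evt_lo lam a f <->
  (forall x, al <= x <= be -> f x <= f al + f be - f (tau f) - 2 * lam) /\
  f (al + 8^-1) < f (tau f) + lam.
Proof.
move=> t2 /andP[a8 a4] al be.
have vE x : 0 <= x <= 4^-1 -> V f (a + x) = f (al + x) - f (tau f).
  by move=> /andP[x0 x4]; rewrite V_lo ?addrA//; lra.
have va : V f a = f al - f (tau f) by rewrite V_lo//; lra.
have cg : continuous (fun x => f (al + x)).
  by move=> x; apply: cvg_path; apply: cvgD; [exact: cvg_cst|exact: cvg_id].
have din n : 0 <= 4^-1 * dense01 R n <= 4^-1.
  by have /andP[d0 d1] := dense01_in R n; apply/andP; split; lra.
rewrite /evt_lo !vE ?va; try by apply/andP; split; lra.
split=> -[h1 h3]; split.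
- move=> x /andP[x1 x2]; rewrite (_ : x = al + (x - al)); last by ring.
  apply: (@cont_le_dense R (fun x => f (al + x)) 4^-1) => //.
    by move=> n; have := h1 n; rewrite vE// -/be; lra.
  by apply/andP; split; rewrite /be in x2; lra.
- by lra.
- move=> n; rewrite vE// -/be; have /andP[d0 d1] := din n.
  by have := h1 (al + 4^-1 * dense01 R n); rewrite /be lerDl d0 lerD2l d1 => /(_ isT); lra.
- by lra.
Qed.

(** The upper bound on the block says precisely that its reflection stays above the old minimum, and
    nothing changes before [tau f], which therefore remains the first minimizer. *)
Lemma tau_flip f al be : tau f <= al -> al <= be -> be <= 1 ->
  (forall x, al <= x <= be -> f x <= f al + f be - f (tau f)) ->
  tau (flip al be f) = tau f.
Proof.
move=> ta ab b1 h; have /andP[t0 t1] := tau_in f.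
have a0 : 0 <= al by exact: le_trans ta.
have ft : flip al be f (tau f) = f (tau f) by rewrite flip_out ?ta.
apply: tau_unique; first exact: tau_in.
- move=> u _; rewrite ft; have [/andP[au ub]|ub] := boolP (al <= u <= be).
    rewrite flip_in ?au//; have := h (al + be - u).
    by rewrite lerBrDr lerD2l ub lerBlDr addrC lerD2l au => /(_ isT); lra.
  rewrite flip_out// ?tau_min//.
  by move: ub; rewrite negb_and -!ltNge => /orP[] /ltW ->; rewrite ?orbT.
- move=> u /andP[u0 ut]; rewrite ft flip_out//; first by apply: tau_first; rewrite u0.
  by rewrite (le_trans (ltW ut)).
Qed.

Section FlipEvents.
Variables (lam a : R) (f : cpath R).
Let al := tau f + a.
Let be := al + 4^-1.
Let g := flip al be f.

Lemma flip_hi_lo : 0 < lam -> tau f <= 2^-1 -> 8^-1 <= a <= 4^-1 -> evt_hi lam a f ->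
  [/\ tau g = tau f, g (tau g) = f (tau f) & evt_lo lam a g].
Proof.
move=> l0 t2 aI /(evt_hiP _ t2 aI); rewrite -/al -/be => -[h1 h2 h3].
have /andP[t0 t1] := tau_in f; have /andP[a8 a4] := aI.
have ta : tau f <= al by rewrite /al; lra.
have a0 : 0 <= al by exact: le_trans ta.
have ab : al <= be by rewrite /be; lra.
have b1 : be <= 1 by rewrite /be /al; lra.
have tg : tau g = tau f by exact: tau_flip.
have gt : g (tau g) = f (tau f) by rewrite tg /g flip_out ?ta.
split => //; apply/evt_loP; rewrite ?tg// -tg gt tg -/al -/be.
have ga : g al = f al by rewrite /g flip_out ?lexx.
have gb : g be = f be by rewrite /g flip_out ?lexx ?orbT.
split.
- move=> x /andP[x1 x2]; rewrite ga gb /g flip_in ?x1//.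
  have := h1 (al + be - x); rewrite (_ : al <= _ <= _); last by apply/andP; split; lra.
  by move=> /(_ isT); lra.
- rewrite /g flip_in//; last by apply/andP; split; rewrite /be; lra.
  by rewrite (_ : al + be - (al + 8^-1) = al + 8^-1); [lra|rewrite /be; field].
Qed.

Lemma flip_lo_hi : 0 < lam -> tau f <= 2^-1 -> 8^-1 <= a <= 4^-1 -> evt_lo lam a f ->
  [/\ tau g = tau f, g (tau g) = f (tau f) & evt_hi lam a g].
Proof.
move=> l0 t2 aI /(evt_loP _ t2 aI); rewrite -/al -/be => -[h1 h2].
have /andP[t0 t1] := tau_in f; have /andP[a8 a4] := aI.
have ta : tau f <= al by rewrite /al; lra.
have a0 : 0 <= al by exact: le_trans ta.
have ab : al <= be by rewrite /be; lra.
have b1 : be <= 1 by rewrite /be /al; lra.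
have tg : tau g = tau f by apply: tau_flip => // x /h1; lra.
have gt : g (tau g) = f (tau f) by rewrite tg /g flip_out ?ta.
split => //; apply/evt_hiP; rewrite ?tg// -tg gt tg -/al -/be.
have ga : g al = f al by rewrite /g flip_out ?lexx.
have gb : g be = f be by rewrite /g flip_out ?lexx ?orbT.
split.
- move=> x /andP[x1 x2]; rewrite /g flip_in ?x1//.
  have := h1 (al + be - x); rewrite (_ : al <= _ <= _); last by apply/andP; split; lra.
  by move=> /(_ isT); lra.
- move=> x /andP[x1 x2]; rewrite ga gb /g flip_in ?x1//.
  by have := tau_min f (al + be - x); lra.
- rewrite ga gb /g flip_in//; last by apply/andP; split; rewrite /be; lra.
  by rewrite (_ : al + be - (al + 8^-1) = al + 8^-1); [lra|rewrite /be; field].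
Qed.

Lemma flip_V u : tau f <= 2^-1 -> 8^-1 <= a <= 4^-1 -> tau g = tau f ->
  a + 4^-1 <= u <= 1 - tau f -> V g u = V f u.
Proof.
move=> t2 /andP[a8 a4] tg /andP[u1 u2]; have /andP[t0 t1] := tau_in f.
have a0 : 0 <= al by rewrite /al; lra.
have ab : al <= be by rewrite /be; lra.
have b1 : be <= 1 by rewrite /be /al; lra.
rewrite !V_lo ?tg// /g !flip_out// /be /al; first by rewrite lerDl; lra.
by apply/orP; right; lra.
Qed.

Lemma flip_1 : tau f <= 2^-1 -> 8^-1 <= a <= 4^-1 -> g 1 = f 1.
Proof.
move=> t2 /andP[a8 a4]; have /andP[t0 t1] := tau_in f.
have a0 : 0 <= al by rewrite /al; lra.
have ab : al <= be by rewrite /be; lra.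
have b1 : be <= 1 by rewrite /be /al; lra.
by rewrite /g flip_out ?b1 ?orbT.
Qed.

End FlipEvents.

Definition evt_c lam f : Prop := V f (5 / 8) < lam /\ f 1 = lam.

(** If [tau f >= 3/8], then at time 5/8 [V] has reached the end of the path or the part before the
    minimum, where it is at least [f 1 = lam]. *)
Lemma evt_c_tau lam f : evt_c lam f -> tau f < 3 / 8.
Proof.
move=> [vl f1]; rewrite ltNge; apply/negP => t38.
have := tau_min f 0; rewrite path0 => ft0.
move: vl; rewrite VE f1; have := tau_min f (tau f + 5 / 8 - 1).
case: ifPn => [h|_]; last by lra.
by rewrite (_ : tau f + 5 / 8 = 1) ?f1; lra.
Qed.

Lemma rotpK f : rotp (rotp f) = f.
Proof.
apply: path_eq => u; rewrite -(path_clip f u) -(path_clip (rotp _) u).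
have /andP[c0 c1] := @clip_in R 0 1 u (@ler01 R).
set c := clip01 u in c0 c1 *.
have r2 : rotp f 2^-1 = f 1 - f 2^-1.
  by rewrite rot_hi; [rewrite subrr path0 add0r|apply/andP; split; lra].
have [h|h] := leP c 2^-1.
- rewrite rot_lo ?c0// r2 rot_hi; last by apply/andP; split; lra.
  by rewrite addrK; ring.
- rewrite rot_hi; last by apply/andP; split; lra.
  rewrite rot_lo; last by apply/andP; split; lra.
  rewrite r2 rot_hi; last by apply/andP; split; lra.
  by rewrite subrK (_ : 1 - 2^-1 = 2^-1); [ring|field].
Qed.

Lemma rotp_1 f : rotp f 1 = f 1.
Proof.
rewrite rot_hi; last by apply/andP; split; lra.
by rewrite (_ : 1 - 2^-1 = 2^-1); [ring|field].
Qed.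

(** Up to a common constant, the rotation plays the second half of [f] first and then the first half
    raised by [f 1]. Its first minimizer is in the latter exactly when that half wins strictly. *)
Lemma tau_rotP f : 0 < f 1 -> 2^-1 < tau (rotp f) <->
  tau f <= 2^-1 /\ forall u, 2^-1 <= u <= 1 -> f (tau f) + f 1 < f u.
Proof.
move=> f10; have /andP[t0 t1] := tau_in f; have /andP[r0 r1] := tau_in (rotp f).
split=> [rt|[t2 h]].
- set rho := tau (rotp f) in r0 r1 rt *.
  have rr : rotp f rho = f (rho - 2^-1) + f 1 - f 2^-1.
    by rewrite rot_hi// (ltW rt).
  have hi u : 2^-1 <= u <= 1 -> f (rho - 2^-1) + f 1 < f u.
    move=> /andP[u1 u2]; have := @tau_first R (rotp f) (u - 2^-1).
    rewrite -/rho rr rot_lo; last by apply/andP; split; lra.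
    rewrite subrK (_ : 0 <= u - 2^-1 < rho) => [/(_ isT)|]; first by lra.
    by apply/andP; split; lra.
  have te : tau f = rho - 2^-1.
    apply: tau_unique => [|u /andP[u0 u1]|u /andP[u0 u1]].
    + by apply/andP; split; lra.
    + have [u2|u2] := leP u 2^-1; last by have := hi u; rewrite (ltW u2) u1 => /(_ isT); lra.
      have := tau_min (rotp f) (u + 2^-1); rewrite -/rho rr rot_hi.
        by rewrite addrK; lra.
      by apply/andP; split; lra.
    + have := @tau_first R (rotp f) (u + 2^-1); rewrite -/rho rr rot_hi.
        rewrite addrK (_ : 0 <= u + 2^-1 < rho) => [/(_ isT)|]; first by lra.
        by apply/andP; split; lra.
      by apply/andP; split; lra.
  by rewrite te; split=> //; lra.
- rewrite ltNge; apply/negP => r2.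
  have := tau_min (rotp f) (tau f + 2^-1).
  rewrite rot_lo ?r0// rot_hi; last by apply/andP; split; lra.
  rewrite addrK; have := h (tau (rotp f) + 2^-1).
  rewrite (_ : 2^-1 <= _ <= 1) => [/(_ isT)|]; first by lra.
  by apply/andP; split; lra.
Qed.

Lemma tau_rot f : 0 < f 1 -> 2^-1 < tau f -> tau (rotp f) = tau f - 2^-1.
Proof.
move=> f10 t2; have /andP[t0 t1] := tau_in f.
have t0r : f (tau f - 2^-1) > f (tau f) by apply: tau_first; apply/andP; split; lra.
have rE u : 0 <= u <= 2^-1 -> rotp f u = f (u + 2^-1) - f 2^-1 by exact: rot_lo.
have rt : rotp f (tau f - 2^-1) = f (tau f) - f 2^-1.
  by rewrite rE ?subrK//; apply/andP; split; lra.
apply: tau_unique => [|u /andP[u0 u1]|u /andP[u0 u1]].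
- by apply/andP; split; lra.
- rewrite rt; have [u2|u2] := leP u 2^-1.
    by rewrite rE ?u0// lerD2r tau_min.
  rewrite rot_hi; last by apply/andP; split; lra.
  by have := tau_min f (u - 2^-1); lra.
- rewrite rt rE; last by apply/andP; split; lra.
  by rewrite ltrD2r; apply: tau_first; apply/andP; split; lra.
Qed.

(** [V] reads the increments cyclically from the minimizer. The minimizer moves along with the
    rotation, because the half of [f] that does not contain it is only raised. *)
Lemma V_rot f u : 0 < f 1 -> 2^-1 < tau f -> 0 <= u <= 2^-1 -> V (rotp f) u = V f u.
Proof.
move=> f10 t2 /andP[u0 u2]; have /andP[t0 t1] := tau_in f.
have tr := tau_rot f10 t2.
rewrite V_lo ?tr; last by lra.
rewrite (rot_lo _ (u := tau f - 2^-1)); last by apply/andP; split; lra.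
rewrite subrK VE; case: ifPn => [h|]; last rewrite -ltNge => h.
- rewrite rot_lo; last by apply/andP; split; lra.
  by rewrite (_ : tau f - 2^-1 + u + 2^-1 = tau f + u); [ring|ring].
- rewrite rot_hi; last by apply/andP; split; lra.
  by rewrite (_ : tau f - 2^-1 + u - 2^-1 = tau f + u - 1); [ring|field].
Qed.

End PathEvents.

(** * Averaging over reflected blocks *)

Section Translation.
Variable R : realType.
Local Notation leb := (@lebesgue_measure R).

Let shiftR (c : R) (x : measurableTypeR R) : measurableTypeR R := x - c.

Let measurable_shiftR c : measurable_fun setT (shiftR c).
Proof. by apply: measurable_funB. Qed.

Lemma lebesgue_translate (c : R) (A : set R) : measurable A ->
  leb ((fun x => x - c) @^-1` A) = leb A.
Proof.
pose phi : {mfun measurableTypeR R >-> measurableTypeR R} :=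
  mfun_Sub (mem_set (measurable_shiftR c)).
move=> mA; apply/esym.
change (leb A = pushforward leb phi A).
apply: lebesgue_measure_unique => //.
move=> _ [[a b] _ <-]; rewrite /= /pushforward.
rewrite (_ : phi @^-1` _ = `]a + c, b + c]%classic); last first.
  by apply/seteqP; split => x /=; rewrite !in_itv/= /shiftR ltrBrDr lerBlDr.
rewrite !lebesgue_measure_itv/= !lte_fin ltrD2r -!EFinB.
by case: ifP => // _; congr (_%:E); ring.
Qed.

Lemma integral_translate (c : R) (G : R -> \bar R) : measurable_fun setT G ->
  (forall x, 0 <= G x)%E ->
  (\int[leb]_x G x = \int[leb]_x G (x - c)%R)%E.
Proof.
move=> mG G0.
rewrite -[RHS](@ge0_integral_pushforward _ _ _ _ _ _ (measurable_shiftR c) leb setT G)//.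
apply: eq_measure_integral => A mA _; exact/esym/lebesgue_translate.
Qed.

End Translation.

Section Averaging.
Variables (R : realType) (lam : R) (mu : probability (cpath R) R).
Hypothesis hmu : bridge_marginals lam mu (fun u f => f u).
Local Notation leb := (@lebesgue_measure R).
Implicit Types (f : cpath R) (g : cpath R * R -> \bar R).
Local Open Scope ereal_scope.

Definition block_flip f (a : R) : cpath R :=
  flip (tau f + a) (tau f + a + 4^-1) f.

(* For a fixed location [al] of the flipped block the map [flip] preserves [mu];
   averaging over [a] makes the random location [tau f + a] uniform given [f]. *)
Lemma average_flip_le g g' :
  measurable_fun setT g -> measurable_fun setT g' ->
  (forall p, 0 <= g p) -> (forall p, 0 <= g' p) ->
  (forall f a, g (f, a) != 0 ->
     [/\ (8^-1 <= a <= 4^-1)%R, (tau f <= 2^-1)%R, tau (block_flip f a) = tau f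
       & g (f, a) <= g' (block_flip f a, a)]) ->
  \int[leb]_a \int[mu]_f g (f, a) <= \int[leb]_a \int[mu]_f g' (f, a).
Proof.
move=> mg mg' g0 g0' H.
pose sh (p : cpath R * measurableTypeR R) : cpath R * measurableTypeR R :=
  (p.1, (p.2 - tau p.1)%R).
have msh : measurable_fun setT sh.
  apply: measurable_fun_pair; first exact: measurable_fst.
  apply: measurable_funB; first exact: measurable_snd.
  exact: (measurableT_comp (@measurable_tau R) measurable_fst).
have E (k : cpath R * R -> \bar R) : measurable_fun setT k -> (forall p, 0 <= k p) ->
    \int[leb]_a \int[mu]_f k (f, a) = \int[leb]_a \int[mu]_f k (f, (a - tau f)%R).
  move=> mk k0.
  have mk' : measurable_fun setT (k \o sh) by exact: measurableT_comp mk msh.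
  rewrite -(fubini_tonelli (m1 := mu) (m2 := leb) k mk k0).
  rewrite -(fubini_tonelli (m1 := mu) (m2 := leb) (k \o sh) mk' (fun p => k0 (sh p))).
  apply: eq_integral => f _.
  rewrite (@integral_translate _ (tau f) (fun a => k (f, a)))//.
  exact: (measurableT_comp mk (pair1_measurable f)).
rewrite (E _ mg g0) (E _ mg' g0').
have mG (k : cpath R * R -> \bar R) al : measurable_fun setT k ->
    measurable_fun setT (fun f : cpath R => k (f, (al - tau f)%R)).
  move=> mk; apply: (measurableT_comp mk); apply: measurable_fun_pair => //.
  by apply: measurable_funB => //; exact: measurable_tau.
have mI (k : cpath R * R -> \bar R) : measurable_fun setT k -> (forall p, 0 <= k p) ->
    measurable_fun [set: measurableTypeR R] (fun a => \int[mu]_f k (f, (a - tau f)%R)).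
  move=> mk k0; have mk' : measurable_fun setT (k \o sh) by exact: measurableT_comp mk msh.
  exact: (measurable_fun_fubini_tonelli_G (m1 := mu) (k \o sh) mk' (fun p => k0 (sh p))).
apply: ge0_le_integral => //.
- by move=> a _; apply: integral_ge0.
- exact: mI.
- exact: mI.
move=> al _.
(* Where [g] is nonzero, [al] is the sum of [tau f] in [0, 1/2] and [a] in [1/8, 1/4]; elsewhere the
   left side vanishes. *)
have [/andP[al0 al1]|alN] := boolP ((0 <= al)%R && (al <= 3 / 4)%R); last first.
  rewrite [X in X <= _]integral0_eq ?integral_ge0// => f _.
  apply/eqP/negP => /negP /H [/andP[a8 a4] t2 _ _].
  have /andP[t0 t1] := tau_in f.
  by move/negP: alN; apply; apply/andP; split; lra.
have ab : (al <= al + 4^-1)%R by lra.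
have b1 : (al + 4^-1 <= 1)%R by lra.
pose h := flip al (al + 4^-1)%R : cpath R -> cpath R.
have mh : measurable_fun setT h by exact: measurable_flip.
rewrite -[X in _ <= X](@ge0_integral_preserved _ mu h)//; last 2 first.
- by move=> A mA; exact: (flip_measure hmu).
- exact: mG.
apply: ge0_le_integral => //.
- exact: mG.
- by apply: (measurableT_comp (mG _ al mg')).
(* After the substitution the right side is taken at [al - tau (h f)]; preservation of [tau]
   identifies it with [al - tau f]. *)
move=> f _; have [->//|] := eqVneq (g (f, (al - tau f)%R)) 0.
move=> /H [_ _]; rewrite /block_flip.
by rewrite (_ : (tau f + (al - tau f))%R = al) -/h; [move=> ->|ring].
Qed.

End Averaging.

(** * Measurability of the events *)

Section MeasurableEvents.
Variables (R : realType) (lam : R).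
Implicit Types (f : cpath R).

Definition window : set R := [set a | 8^-1 <= a <= 4^-1].

Lemma measurable_ler_set d (T : measurableType d) (F G : T -> R) :
  measurable_fun setT F -> measurable_fun setT G -> measurable [set x | F x <= G x].
Proof.
move=> mF mG; have := measurable_fun_ler mF mG measurableT (Y := [set true]).
by rewrite setTI; apply.
Qed.

Lemma measurable_ltr_set d (T : measurableType d) (F G : T -> R) :
  measurable_fun setT F -> measurable_fun setT G -> measurable [set x | F x < G x].
Proof.
move=> mF mG; have := measurable_fun_ltr mF mG measurableT (Y := [set true]).
by rewrite setTI; apply.
Qed.

Lemma measurable_forall d (T : measurableType d) (A : nat -> set T) :
  (forall n, measurable (A n)) -> measurable [set x | forall n, A n x].
Proof.
move=> mA; rewrite (_ : [set x | _] = \bigcap_n A n); first exact: bigcapT_measurable.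
by apply/seteqP; split=> x /= h n; [move=> _|]; exact: h.
Qed.

Section Gen.
Context d (T : measurableType d) (F : T -> cpath R) (a : T -> R).
Hypothesis mV : forall c, 0 <= c <= 4^-1 ->
  measurable_fun setT (fun x => V (F x) (a x + c)).

Let mV0 : measurable_fun setT (fun x => V (F x) (a x)).
Proof.
under eq_fun do rewrite -[a _]addr0.
by apply: mV; rewrite lexx invr_ge0 ler0n.
Qed.

Let mV4 : measurable_fun setT (fun x => V (F x) (a x + 4^-1)).
Proof. by apply: mV; rewrite lexx invr_ge0 ler0n. Qed.

Let mV8 : measurable_fun setT (fun x => V (F x) (a x + 8^-1)).
Proof. by apply: mV; lra. Qed.

Let mVd n : measurable_fun setT (fun x => V (F x) (a x + 4^-1 * dense01 R n)).
Proof.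
by apply: mV; have /andP[d0 d1] := dense01_in R n; apply/andP; split; lra.
Qed.

(** Stated for any sigma-algebra that makes [V] measurable at the times of the block. It thus
    applies to paths, to pairs of a path and a location, and to the natural filtration at time
    1/2. *)
Lemma measurable_evt_hi : measurable [set x | evt_hi lam (a x) (F x)].
Proof.
rewrite (_ : [set x | _] =
  [set x | forall n, 2 * lam <= V (F x) (a x + 4^-1 * dense01 R n)] `&`
  [set x | forall n, V (F x) (a x + 4^-1 * dense01 R n) <=
                     V (F x) (a x) + V (F x) (a x + 4^-1)] `&`
  [set x | V (F x) (a x) + V (F x) (a x + 4^-1) - lam < V (F x) (a x + 8^-1)]).
  apply: measurableI; first apply: measurableI.
  - by apply: measurable_forall => n; exact: measurable_ler_set.
  - apply: measurable_forall => n; apply: measurable_ler_set => //.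
    exact: measurable_funD.
  - apply: measurable_ltr_set => //; apply: measurable_funB => //.
    exact: measurable_funD.
by apply/seteqP; split=> x /=; [case|case=> -[]].
Qed.

Lemma measurable_evt_lo : measurable [set x | evt_lo lam (a x) (F x)].
Proof.
rewrite (_ : [set x | _] =
  [set x | forall n, V (F x) (a x + 4^-1 * dense01 R n) <=
                     V (F x) (a x) + V (F x) (a x + 4^-1) - 2 * lam] `&`
  [set x | V (F x) (a x + 8^-1) < lam]).
  apply: measurableI.
  - apply: measurable_forall => n; apply: measurable_ler_set => //.
    by apply: measurable_funB => //; exact: measurable_funD.
  - by apply: measurable_ltr_set.
by apply/seteqP; split=> x /=; case.
Qed.

End Gen.

Definition at_end : set (cpath R) := [set f | f 1 = lam].

Lemma measurable_at_end : measurable at_end.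
Proof.
rewrite (_ : at_end = (fun f : cpath R => f 1) @^-1` [set lam]); last by [].
by rewrite -[X in measurable X]setTI; apply: path_coord.
Qed.

Definition hi_set : set (cpath R * R) :=
  [set p | [/\ window p.2, evt_hi lam p.2 p.1 & at_end p.1]].

Definition lo_set : set (cpath R * R) :=
  [set p | [/\ window p.2, evt_lo lam p.2 p.1 & at_end p.1]].

Lemma lebesgue_window_lty : (@lebesgue_measure R window < +oo)%E.
Proof.
rewrite (_ : window = `[8^-1, 4^-1]%classic)//.
by rewrite lebesgue_measure_itv/=; case: ifP => // _; rewrite -EFinB ltry.
Qed.

Lemma measurable_window : measurable window.
Proof.
by rewrite (_ : window = `[8^-1, 4^-1]%classic).
Qed.

Let measurable_window_end :
  measurable (snd @^-1` window `&` fst @^-1` at_end : set (cpath R * R)).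
Proof.
apply: measurableI.
- by rewrite -[X in measurable X]setTI; apply: measurable_snd => //; exact: measurable_window.
- by rewrite -[X in measurable X]setTI; apply: measurable_fst => //; exact: measurable_at_end.
Qed.

Lemma measurable_hi_set : measurable hi_set.
Proof.
rewrite (_ : hi_set = [set p | evt_hi lam p.2 p.1] `&`
  (snd @^-1` window `&` fst @^-1` at_end)).
  apply: measurableI => //.
  apply: measurable_evt_hi => c _; apply: measurable_V; first exact: measurable_fst.
  by apply: measurable_funD => //; exact: measurable_snd.
by apply/seteqP; split=> p /=; [case|case=> ? []].
Qed.

Lemma measurable_lo_set : measurable lo_set.
Proof.
rewrite (_ : lo_set = [set p | evt_lo lam p.2 p.1] `&`
  (snd @^-1` window `&` fst @^-1` at_end)).
  apply: measurableI => //.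
  apply: measurable_evt_lo => c _; apply: measurable_V; first exact: measurable_fst.
  by apply: measurable_funD => //; exact: measurable_snd.
by apply/seteqP; split=> p /=; [case|case=> ? []].
Qed.

Definition low_set : set (cpath R) := [set f | V f (5 / 8) < lam].

Lemma measurable_low_set : measurable low_set.
Proof.
apply: measurable_ltr_set => //; apply: measurable_V => //.
Qed.

Definition late_set : set (cpath R) := [set f | 2^-1 < tau f].

Lemma measurable_late_set : measurable late_set.
Proof. by apply: measurable_ltr_set => //; exact: measurable_tau. Qed.

Definition late_rot_set : set (cpath R) := [set f | 2^-1 < tau (rotp f)].

Lemma measurable_late_rot_set : measurable late_rot_set.
Proof.
apply: measurable_ltr_set => //.
exact: (measurableT_comp (@measurable_tau R) (@measurable_rot R)).
Qed.

(** Meant for the rotation of a path with late minimum: it says that on the original path the centre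
    of the block comes before time 1, that is, before the cut. *)
Definition mid_set : set (cpath R * R) := [set p | tau p.1 + p.2 + 8^-1 < 2^-1].

Lemma measurable_mid_set : measurable mid_set.
Proof.
apply: measurable_ltr_set => //; apply: measurable_funD => //.
apply: measurable_funD; last exact: measurable_snd.
exact: (measurableT_comp (@measurable_tau R) measurable_fst).
Qed.

End MeasurableEvents.

Section Weighted.
Variables (R : realType) (lam : R) (mu : probability (cpath R) R).
Hypothesis hmu : bridge_marginals lam mu (fun u f => f u).
Local Notation leb := (@lebesgue_measure R).
Implicit Types (f : cpath R) (S : set (cpath R * R)).
Local Open Scope ereal_scope.

Definition weighted (w : R -> \bar R) S (p : cpath R * R) : \bar R :=
  (\1_S p)%:E * w (V p.1 2^-1).

Definition mass (w : R -> \bar R) S : \bar R :=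
  \int[leb]_a \int[mu]_f weighted w S (f, a).

Section OneWeight.
Variable w : R -> \bar R.
Hypotheses (mw : measurable_fun setT w) (w0 : forall x, 0 <= w x).

Lemma measurable_wV : measurable_fun setT (fun f : cpath R => w (V f 2^-1)).
Proof. by apply: (measurableT_comp mw); exact: measurable_V. Qed.

Lemma measurable_weighted S : measurable S -> measurable_fun setT (weighted w S).
Proof.
move=> mS; apply: emeasurable_funM.
  by apply/measurable_EFinP; exact: measurable_indic.
exact: (measurableT_comp measurable_wV measurable_fst).
Qed.

Lemma weighted_ge0 S p : 0 <= weighted w S p.
Proof. by rewrite /weighted mule_ge0// lee_fin indicE ler0n. Qed.

Lemma measurable_weighted_sec S a : measurable S ->
  measurable_fun setT (fun f => weighted w S (f, a)).
Proof.
by move=> mS; exact: (measurableT_comp (measurable_weighted mS) (pair2_measurable a)).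
Qed.

Lemma measurable_weighted_int S : measurable S ->
  measurable_fun [set: measurableTypeR R] (fun a => \int[mu]_f weighted w S (f, a)).
Proof.
move=> mS; exact: (measurable_fun_fubini_tonelli_G (m1 := mu) (weighted w S)
  (measurable_weighted mS) (weighted_ge0 S)).
Qed.

Lemma mass_ge0 S : 0 <= mass w S.
Proof.
by apply: integral_ge0 => a _; apply: integral_ge0 => f _; exact: weighted_ge0.
Qed.

Lemma mass_split S A : measurable S -> measurable A ->
  mass w S = mass w (S `&` A) + mass w (S `\` A).
Proof.
move=> mS mA.
have mI := measurableI _ _ mS mA; have mD := measurableD mS mA.
rewrite /mass -ge0_integralD//; last 4 first.
- by move=> a _; apply: integral_ge0 => f _; exact: weighted_ge0.
- exact: measurable_weighted_int.
- by move=> a _; apply: integral_ge0 => f _; exact: weighted_ge0.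
- exact: measurable_weighted_int.
apply: eq_integral => a _; rewrite -ge0_integralD//; last 4 first.
- by move=> f _; exact: weighted_ge0.
- exact: measurable_weighted_sec.
- by move=> f _; exact: weighted_ge0.
- exact: measurable_weighted_sec.
apply: eq_integral => f _; rewrite /weighted !indicE in_setI in_setD.
by case: (_ \in S); case: (_ \in A); rewrite /= ?mul0e ?add0e ?adde0.
Qed.

Lemma mass_flip_le S S' : measurable S -> measurable S' ->
  (forall f a, S (f, a) -> [/\ window a, (tau f <= 2^-1)%R,
     tau (block_flip f a) = tau f, V (block_flip f a) 2^-1 = V f 2^-1
     & S' (block_flip f a, a)]) ->
  mass w S <= mass w S'.
Proof.
move=> mS mS' H; apply: (average_flip_le hmu).
- exact: measurable_weighted.
- exact: measurable_weighted.
- exact: weighted_ge0.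
- exact: weighted_ge0.
move=> f a; rewrite /weighted indicE.
have [/set_mem/H[wa t2 tf vf S'f] _|_] := boolP ((f, a) \in S); last by rewrite mul0e eqxx.
by split=> //=; rewrite indicE (mem_set S'f) vf.
Qed.

(** [rotp] is a measure-preserving involution that exchanges [late_set] and [late_rot_set], and on
    late paths it keeps [V] at 1/2, hence the weight. *)
Lemma mass_late S : measurable S ->
  (forall f a, S (f, a) -> window a) ->
  (forall f a, (2^-1 < tau f)%R -> at_end lam f ->
     S (rotp f, a) <-> S (f, a)) ->
  (0 < lam)%R ->
  mass w (S `&` [set p | late_set p.1 /\ at_end lam p.1]) =
  mass w (S `&` [set p | late_rot_set p.1 /\ at_end lam p.1]).
Proof.
move=> mS Sw Srot lam0.
have mfst (A : set (cpath R)) : measurable A -> measurable [set p : cpath R * R | A p.1].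
  by move=> mA; rewrite -[X in measurable X]setTI; exact: measurable_fst.
apply: eq_integral => a _.
set S1 := (S `&` _); set S2 := (S `&` [set p | late_rot_set _ /\ _]).
have mS2 : measurable S2.
  apply: measurableI => //; apply: (mfst (@late_rot_set R `&` at_end lam)).
  by apply: measurableI; [exact: measurable_late_rot_set|exact: measurable_at_end].
rewrite -[RHS](@ge0_integral_preserved R mu (@rotp R))//; last 4 first.
- exact: measurable_rot.
- by move=> A mA; exact: (rot_measure hmu).
- exact: measurable_weighted_sec.
- by move=> f; exact: weighted_ge0.
apply: eq_integral => f _; rewrite /weighted /= !indicE.
suff -> : ((rotp f, a) \in S2) = ((f, a) \in S1).
  have [/set_mem[_ [/= tf ef]]|_] := boolP ((f, a) \in S1); last by rewrite !mul0e.
  rewrite V_rot//; first by rewrite ef.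
  by rewrite invr_ge0 ler0n lexx.
apply/idP/idP => /set_mem [Sf [/= tf ef]]; apply: mem_set; split.
- apply/Srot => //; first by move: tf; rewrite /late_rot_set /= rotpK.
  by rewrite /at_end /= -rotp_1.
- split; first by move: tf; rewrite /late_rot_set /= rotpK.
  by rewrite /at_end /= -rotp_1.
- by apply/Srot.
- by split; [rewrite /late_rot_set /= rotpK|exact: etrans (rotp_1 f) ef].
Qed.

End OneWeight.

End Weighted.

(** Altogether [he + hm + x = h = l = le + lr <= he + hm]; finiteness of [h] allows the
    cancellation. *)
Lemma ereal_gap (R : realType) (h l he le hr lr hm x : \bar R) :
  (h = he + hr -> l = le + lr -> hr = hm + x -> h = l -> le <= he -> lr <= hm ->
  0 <= he -> 0 <= hm -> 0 <= x -> h \is a fin_num -> x = 0)%E.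
Proof.
move=> hE lE hrE hl hele hmlr he0 hm0 x0 hfin.
have hE' : (h = he + hm + x)%E by rewrite hE hrE addeA.
have hsub : (h <= he + hm)%E by rewrite hl lE; exact: leeD.
have hhfin : (he + hm)%E \is a fin_num.
  rewrite ge0_fin_numE ?adde_ge0//; apply: (@le_lt_trans _ _ h).
    by rewrite hE' leeDl.
  by rewrite -ge0_fin_numE// hE' !adde_ge0.
apply/eqP; rewrite eq_le x0 andbT -(@leeD2lE _ (he + hm)%E)// adde0 -hE'.
exact: hsub.
Qed.

(** * Comparison of the masses of high and low blocks *)

Section Contradiction.
Variables (R : realType) (lam : R) (mu : probability (cpath R) R).
Hypothesis hmu : bridge_marginals lam mu (fun u f => f u).
Hypothesis lam0 : (0 < lam)%R.
Local Notation leb := (@lebesgue_measure R).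
Implicit Types (f : cpath R) (S : set (cpath R * R)).
Local Open Scope ereal_scope.

Variable w : R -> \bar R.
Hypotheses (mw : measurable_fun setT w) (w0 : forall x, 0 <= w x).

(** [w (V f (1/2))] stands for the conditional probability of [low_set] given the past of 1/2. It is
    tested on three kinds of past events: high blocks, low blocks, and conditions on the present
    value. *)
Hypothesis kernel_hi : forall a, window a ->
  mu [set f | [/\ evt_hi lam a f, at_end lam f & low_set lam f]] =
  \int[mu]_(f in [set f | evt_hi lam a f /\ at_end lam f]) w (V f 2^-1).
Hypothesis kernel_lo : forall a, window a ->
  mu [set f | [/\ evt_lo lam a f, at_end lam f & low_set lam f]] =
  \int[mu]_(f in [set f | evt_lo lam a f /\ at_end lam f]) w (V f 2^-1).
Hypothesis kernel_mid : forall B, measurable B ->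
  mu [set f | [/\ at_end lam f, low_set lam f & B (V f 2^-1)]] =
  \int[mu]_(f in [set f | at_end lam f /\ B (V f 2^-1)]) w (V f 2^-1).

Variables (tube : set (cpath R)) (a1 a2 : R).
Hypotheses (mtube : measurable tube) (tube0 : 0 < mu tube) (tube_end : tube `<=` at_end lam).
Hypotheses (a12 : (a1 < a2)%R) (aw : forall a, (a1 <= a <= a2)%R -> window a).
Hypothesis tube_hi : forall f a, tube f -> (a1 <= a <= a2)%R -> evt_hi lam a f.
Hypothesis tube_late : forall f, tube f -> late_rot_set f /\ (4^-1 <= tau f)%R.
Hypothesis tube_low : forall f, tube f ->
  [/\ at_end lam (flip (7 / 8) 1 f), low_set lam (flip (7 / 8) 1 f)
    & V (flip (7 / 8) 1 f) 2^-1 = V f 2^-1].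

Local Notation hi := (hi_set lam).
Local Notation lo := (lo_set lam).
Let low : set (cpath R * R) := [set p | low_set lam p.1].
Let early : set (cpath R * R) := ~` [set p | late_set p.1].
Let lrot : set (cpath R * R) := [set p | late_rot_set p.1 /\ at_end lam p.1].
Let one : R -> \bar R := cst 1.

Let mfst (A : set (cpath R)) : measurable A -> measurable [set p : cpath R * R | A p.1].
Proof. by move=> mA; rewrite -[X in measurable X]setTI; exact: measurable_fst. Qed.

Let mlow : measurable low. Proof. exact: mfst (measurable_low_set lam). Qed.
Let mearly : measurable early.
Proof. by apply: measurableC; exact: mfst (@measurable_late_set R). Qed.
Let mlrot : measurable lrot.
Proof.
apply: (mfst (A := @late_rot_set R `&` at_end lam)); apply: measurableI.
  exact: measurable_late_rot_set.
exact: measurable_at_end.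
Qed.
Let mhi : measurable hi. Proof. exact: measurable_hi_set. Qed.
Let mlo : measurable lo. Proof. exact: measurable_lo_set. Qed.

Let early_tau f a : early (f, a) -> (tau f <= 2^-1)%R.
Proof. by rewrite /early /late_set /= leNgt => /negP. Qed.

Let Vhalf f a : (tau f <= 2^-1)%R -> window a -> tau (block_flip f a) = tau f ->
  V (block_flip f a) 2^-1 = V f 2^-1.
Proof.
move=> t2 wa tf; apply: flip_V => //.
by move: wa => /andP[? ?]; apply/andP; split; lra.
Qed.

Let block_end f a : (tau f <= 2^-1)%R -> window a -> at_end lam f ->
  at_end lam (block_flip f a).
Proof. by move=> t2 wa; rewrite /at_end /= => <-; exact: flip_1. Qed.

Let low_tau f : low_set lam f -> at_end lam f -> (tau f <= 2^-1)%R.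
Proof. by move=> lf ef; have := evt_c_tau (conj lf ef); lra. Qed.

Let block_low f a : low_set lam f -> at_end lam f -> window a ->
  tau (block_flip f a) = tau f -> low_set lam (block_flip f a).
Proof.
move=> lf ef wa tf; have t38 := evt_c_tau (conj lf ef).
rewrite /low_set /= flip_V//; first by lra.
by move: wa => /andP[? ?]; apply/andP; split; lra.
Qed.

Lemma mass_hi_low : mass mu one (hi `&` low) = mass mu one (lo `&` low).
Proof.
apply/eqP; rewrite eq_le; apply/andP; split; apply: (mass_flip_le hmu) => //;
  try exact: measurableI; move=> f a [[/= wa ef endf] /= lf];
  have t2 := low_tau lf endf.
- have [tf ft lof] := flip_hi_lo lam0 t2 wa ef.
  split=> //; first exact: Vhalf.
  by split; [split=> //=; exact: block_end|exact: block_low].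
- have [tf ft hif] := flip_lo_hi lam0 t2 wa ef.
  split=> //; first exact: Vhalf.
  by split; [split=> //=; exact: block_end|exact: block_low].
Qed.

Let section_mass (E : R -> set (cpath R)) (S : set (cpath R * R)) :
  (forall a, measurable (E a)) ->
  S = [set p | [/\ window p.2, E p.2 p.1 & at_end lam p.1]] ->
  (forall a, window a ->
    mu [set f | [/\ E a f, at_end lam f & low_set lam f]] =
    \int[mu]_(f in [set f | E a f /\ at_end lam f]) w (V f 2^-1)) ->
  mass mu one (S `&` low) = mass mu w S.
Proof.
move=> mE SE H; apply: eq_integral => a _.
have [wa|wa] := pselect (window a); last first.
  by rewrite !integral0_eq// => f _; rewrite /weighted indicE memNset ?mul0e// SE;
    [move=> -[]|move=> [[]]].
have mEe : measurable (E a `&` at_end lam).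
  by apply: measurableI => //; exact: measurable_at_end.
transitivity (mu (E a `&` at_end lam `&` low_set lam)).
  rewrite -[X in mu X]setIT -integral_indic//; last first.
    by apply: measurableI => //; exact: measurable_low_set.
  apply: eq_integral => f _; rewrite /weighted /one mule1 !indicE.
  congr (_%:R%:E); congr nat_of_bool; apply/idP/idP => /set_mem h; apply: mem_set.
    by move: h; rewrite SE => -[[/= _ h1 h2] h3].
  by move: h => [[h1 h2] h3]; split=> //; rewrite SE.
rewrite (_ : _ `&` _ = [set f | [/\ E a f, at_end lam f & low_set lam f]]); last first.
  by apply/seteqP; split=> f /= [] // [].
rewrite H// integral_mkcond; apply: eq_integral => f _.
rewrite /weighted patchE indicE.
case: (boolP (f \in _)) => [/set_mem[h1 h2]|h].
  by rewrite mem_set ?mul1e// SE.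
rewrite memNset ?mul0e// SE => -[_ h1 h2].
by move/negP: h; apply; apply: mem_set.
Qed.

Lemma mass_hi_kernel : mass mu one (hi `&` low) = mass mu w hi.
Proof.
apply: (section_mass (E := evt_hi lam)); [|by []|exact: kernel_hi].
by move=> a; apply: measurable_evt_hi => c _; exact: measurable_V.
Qed.

Lemma mass_lo_kernel : mass mu one (lo `&` low) = mass mu w lo.
Proof.
apply: (section_mass (E := evt_lo lam)); [|by []|exact: kernel_lo].
by move=> a; apply: measurable_evt_lo => c _; exact: measurable_V.
Qed.

Lemma mass_hi_lo : mass mu w hi = mass mu w lo.
Proof. by rewrite -mass_hi_kernel -mass_lo_kernel; exact: mass_hi_low. Qed.

(** No bound on [w] is at hand, so finiteness comes from the kernel identity: the mass equals that
    of an event, at most the length of [window]. *)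
Lemma mass_hi_fin : mass mu w hi \is a fin_num.
Proof.
rewrite ge0_fin_numE; last exact: mass_ge0.
rewrite -mass_hi_kernel.
apply: (@le_lt_trans _ _ (\int[leb]_a (\1_(@window R) a)%:E)); last first.
  rewrite integral_indic//; last exact: measurable_window.
  by rewrite setIT; exact: lebesgue_window_lty.
apply: ge0_le_integral => //.
- by move=> a _; apply: integral_ge0 => f _; exact: weighted_ge0.
- by apply: measurable_weighted_int => //; exact: measurableI.
- by apply/measurable_EFinP/measurable_indic; exact: measurable_window.
move=> a _; rewrite indicE; have [wa|wa] := boolP (a \in _).
  apply: (@le_trans _ _ (\int[mu]_f cst 1 f)); last first.
    by rewrite integral_cst// mul1e probability_le1.
  apply: ge0_le_integral => //.
  - by move=> f _; exact: weighted_ge0.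
  - by apply: measurable_weighted_sec => //; exact: measurableI.
  move=> f _; rewrite /weighted /one mule1 lee_fin indicE.
  by case: (_ \in _).
rewrite integral0_eq// => f _; rewrite /weighted indicE memNset ?mul0e//.
by move=> [[/= h _ _] _]; move/negP: wa; apply; exact: mem_set.
Qed.

(* [hi] and [lo] have the same mass. Flipping low blocks up shows that [lo] has at
   most the mass of [hi] on [tau <= 1/2] and, after the rotation, at most the mass
   of [hi] inside [mid_set] on [tau > 1/2], so nothing is left outside [mid_set]. *)
Lemma mass_gap : mass mu w (hi `&` lrot `\` @mid_set R) = 0.
Proof.
have mmid := @measurable_mid_set R.
have mhe : measurable (hi `&` early) by exact: measurableI.
have mle : measurable (lo `&` early) by exact: measurableI.
have mge : measurable (hi `&` lrot) by exact: measurableI.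
have hle (S : set (cpath R * R)) : measurable S -> (forall p, S p -> at_end lam p.1) ->
    (forall f a, S (f, a) -> window a) ->
    (forall f a, (2^-1 < tau f)%R -> at_end lam f -> S (rotp f, a) <-> S (f, a)) ->
    mass mu w S = mass mu w (S `&` early) + mass mu w (S `&` lrot).
  move=> mS Se Sw Sr.
  suff <- : mass mu w (S `\` early) = mass mu w (S `&` lrot).
    exact: (mass_split mu mw w0 mS mearly).
  rewrite -[RHS](mass_late hmu mw w0 mS Sw Sr lam0); congr (mass mu w _).
  apply/seteqP; split=> p /=.
    by move=> [Sp]; rewrite /early /= => /contrapT ?; split=> //; split=> //; exact: Se.
  by move=> [Sp [lp _]]; split.
have Vr f u : (2^-1 < tau f)%R -> at_end lam f -> (0 <= u <= 2^-1)%R -> V (rotp f) u = V f u.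
  by move=> tf ef uu; apply: V_rot => //; rewrite ef.
have Vb f a n : (2^-1 < tau f)%R -> at_end lam f -> window a ->
    V (rotp f) (a + 4^-1 * dense01 R n) = V f (a + 4^-1 * dense01 R n).
  move=> tf ef /andP[? ?]; apply: Vr => //; have /andP[? ?] := dense01_in R n.
  by apply/andP; split; lra.
have Vc f a c : (2^-1 < tau f)%R -> at_end lam f -> window a -> (0 <= c <= 4^-1)%R ->
    V (rotp f) (a + c) = V f (a + c).
  by move=> tf ef /andP[? ?] /andP[? ?]; apply: Vr => //; apply/andP; split; lra.
have V0 f a : (2^-1 < tau f)%R -> at_end lam f -> window a -> V (rotp f) a = V f a.
  by move=> tf ef /andP[? ?]; apply: Vr => //; apply/andP; split; lra.
have c8 : (0 <= (8^-1 : R) <= 4^-1)%R by apply/andP; split; lra.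
have c4 : (0 <= (4^-1 : R) <= 4^-1)%R by apply/andP; split; lra.
have er f : at_end lam f -> at_end lam (rotp f) by move=> ef; exact: etrans (rotp_1 f) ef.
have er' f : at_end lam (rotp f) -> at_end lam f by move=> ef; exact: etrans (esym (rotp_1 f)) ef.
have hiE : mass mu w hi = mass mu w (hi `&` early) + mass mu w (hi `&` lrot).
  apply: hle => //; [by move=> p []|by move=> f a []|].
  move=> f a tf ef; split=> -[/= wa [h1 h2 h3] e]; split=> //=; try exact: er;
    rewrite /evt_hi ?(Vc _ _ _ tf ef wa c8) ?(Vc _ _ _ tf ef wa c4) ?(V0 _ _ tf ef wa) in h1 h2 h3 *;
    split=> // n; by [rewrite Vb|rewrite -(Vb _ _ _ tf ef wa)].
have loE : mass mu w lo = mass mu w (lo `&` early) + mass mu w (lo `&` lrot).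
  apply: hle => //; [by move=> p []|by move=> f a []|].
  move=> f a tf ef; split=> -[/= wa [h1 h2] e]; split=> //=; try exact: er;
    rewrite /evt_lo ?(Vc _ _ _ tf ef wa c8) ?(Vc _ _ _ tf ef wa c4) ?(V0 _ _ tf ef wa) in h1 h2 *;
    split=> // n; by [rewrite Vb|rewrite -(Vb _ _ _ tf ef wa)].
have early_le : mass mu w (lo `&` early) <= mass mu w (hi `&` early).
  apply: (mass_flip_le hmu) => // f a [[/= wa ef endf] /early_tau t2].
  have [tf ft hif] := flip_lo_hi lam0 t2 wa ef.
  split=> //; first exact: Vhalf.
  split; first by split=> //=; exact: block_end.
  by rewrite /early /late_set /= tf; apply/negP; rewrite -leNgt.
have late_le : mass mu w (lo `&` lrot) <= mass mu w (hi `&` lrot `&` @mid_set R).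
  apply: (mass_flip_le hmu) => //; [exact: measurableI|exact: measurableI|].
  move=> f a [[/= wa ef endf] [/= lrf _]].
  have f10 : (0 < f 1)%R by rewrite endf.
  have [t2 fK] := (tau_rotP f10).1 lrf.
  have [tf ft hif] := flip_lo_hi lam0 t2 wa ef.
  have gend := block_end t2 wa endf.
  split=> //; first exact: Vhalf.
  have wa' := wa; move: wa' => /andP[wa1 wa2]; have /andP[t0 t1] := tau_in f.
  have gt : block_flip f a (tau f) = f (tau f) by rewrite -[RHS]ft tf.
  split; first split=> //.
  - split=> //; apply/tau_rotP; first by rewrite gend.
    rewrite tf; split=> // u u01; rewrite /fst gend gt.
    (* On the block the new path is at least [2 lam] above the minimum, elsewhere it is the old one;
       either way the second half stays more than [lam] above the minimum. *)
    have [/andP[u1 u2]|un] := boolP ((tau f + a <= u) && (u <= tau f + a + 4^-1))%R.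
      have l0 := lam0; have tg2 : (tau (block_flip f a) <= 2^-1)%R by rewrite tf.
      have [+ _ _] := (evt_hiP lam tg2 wa).1 hif.
      by move=> /(_ u); rewrite ft tf u1 u2 => /(_ isT); lra.
    have -> : block_flip f a u = f u.
      rewrite /block_flip flip_out//; [by lra|by lra|by lra|].
      by move: un; rewrite negb_and -!ltNge => /orP[] /ltW ->; rewrite ?orbT.
    by have := fK u u01; rewrite endf.
  (* The centre of the low block is less than [lam] above the minimum, so it cannot lie in the
     second half. *)
  - rewrite /mid_set /= tf ltNge; apply/negP => m2.
    have [_ vlow] := (evt_loP lam t2 wa).1 ef.
    have := fK (tau f + a + 8^-1)%R; rewrite m2 endf.
    by rewrite (_ : (tau f + a + 8^-1 <= 1)%R) => [/(_ isT)|]; lra.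
apply: (ereal_gap hiE loE (mass_split mu mw w0 mge mmid) mass_hi_lo early_le late_le).
- exact: mass_ge0.
- exact: mass_ge0.
- exact: mass_ge0.
- exact: mass_hi_fin.
Qed.

(** For every [a] in [[a1, a2]] the whole tube lies in the set of [mass_gap], and the weight does
    not depend on [a]; so [a2 - a1] times the integral is bounded by 0. *)
Lemma tube_weight0 : \int[mu]_(f in tube) w (V f 2^-1) = 0.
Proof.
have mwV := measurable_wV mw.
pose J := \int[mu]_(f in tube) w (V f 2^-1).
have J0 : 0 <= J by apply: integral_ge0.
have mS : measurable (hi `&` lrot `\` @mid_set R).
  by apply: measurableD; [exact: measurableI|exact: measurable_mid_set].
have : (a2 - a1)%:E * J <= 0.
  rewrite -mass_gap.
  have ml : leb `[a1, a2]%classic = (a2 - a1)%:E.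
    by rewrite lebesgue_measure_itv/= lte_fin a12.
  rewrite -ml muleC -(integral_cst leb)//.
  rewrite integral_mkcond; apply: ge0_le_integral => //.
  - by move=> a _; rewrite patchE; case: ifP.
  - by apply/(measurable_restrictT _ _).1 => //; exact: measurable_cst.
  - exact: measurable_weighted_int.
  move=> a _; rewrite patchE; case: ifPn => [/set_mem|_]; last first.
    by apply: integral_ge0 => f _; exact: weighted_ge0.
  rewrite /= in_itv/= => aI.
  rewrite /J integral_mkcond; apply: ge0_le_integral => //.
  - by move=> f _; rewrite patchE; case: ifP.
  - by apply/(measurable_restrictT _ _).1 => //; exact: measurable_funTS.
  - exact: measurable_weighted_sec.
  move=> f _; rewrite patchE; case: ifPn => [/set_mem Tf|_]; last exact: weighted_ge0.
  rewrite /weighted indicE mem_set ?mul1e//.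
  have [lrf t4] := tube_late Tf; have ef := tube_end Tf.
  split; first by split; [split=> //=; [exact: aw|exact: tube_hi]|split].
  apply/negP; rewrite /= -leNgt.
  by have /andP[? ?] := aw aI; lra.
have a210 : (0 < a2 - a1)%R by rewrite subr_gt0.
rewrite -/J => h; apply/eqP; rewrite eq_le J0 andbT.
by rewrite -(@lee_pmul2l _ (a2 - a1)%:E) ?mule0.
Qed.

Theorem no_kernel : False.
Proof.
have mwV := measurable_wV mw.
pose B : set R := w @^-1` [set 0].
have mB : measurable B by rewrite -[X in measurable X]setTI; exact: mw.
pose E := [set f | [/\ at_end lam f, low_set lam f & B (V f 2^-1)]].
have mVB : measurable [set f : cpath R | B (V f 2^-1)].
  rewrite -[X in measurable X]setTI.
  by apply: (measurable_V (@measurable_id _ _ _) (@measurable_cst _ _ _ _ _ _)).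
have mE : measurable E.
  rewrite (_ : E = at_end lam `&` low_set lam `&` [set f | B (V f 2^-1)]).
    apply: measurableI => //; apply: measurableI.
      exact: measurable_at_end.
    exact: measurable_low_set.
  by apply/seteqP; split=> f /=; [case|case=> -[]].
have muE : mu E = 0.
  by rewrite kernel_mid// integral0_eq// => f [_].
have h78 : (0 <= 7 / 8 :> R)%R by lra.
have h781 : (7 / 8 <= 1 :> R)%R by lra.
have := flip_measure hmu h78 h781 (lexx 1%R) mE; rewrite muE => flip0.
(* The reflection of [7/8, 1] maps this part of the tube into the null set [E], while the rest of
   the tube is null by [tube_weight0]. *)
have tB : mu (tube `&` [set f | B (V f 2^-1)]) = 0.
  apply/eqP; rewrite eq_le measure_ge0 andbT -flip0.
  apply: le_measure; rewrite ?inE; first exact: measurableI.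
    by rewrite -[X in measurable X]setTI; apply: measurable_flip.
  move=> f [Tf Bf]; have [h1 h2 h3] := tube_low Tf.
  by split=> //; rewrite h3.
have tN : mu (tube `&` ~` [set f | B (V f 2^-1)]) = 0.
  have := ae_eq_integral_abs mu mtube (measurable_funTS mwV).
  move=> [+ _]; under eq_integral do rewrite gee0_abs//.
  move=> /(_ tube_weight0) [N [mN N0 sN]].
  apply: (subset_measure0 _ mN _ N0).
    by apply: measurableI => //; exact: measurableC.
  by move=> f [Tf Bf]; apply: sN => /= h; apply: Bf; rewrite /B /= h.
have : mu tube <= 0.
  rewrite -(setIT tube) -(setvU [set f | B (V f 2^-1)]) setIUr.
  apply: le_trans (measureU2 _ _ _) _ => //; try exact: measurableI.
    by apply: measurableI => //; exact: measurableC.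
  by rewrite [X in X + _]tN [X in _ + X]tB adde0.
by rewrite leNgt tube0.
Qed.

End Contradiction.

(** * Quasi-invariance and positivity of tubes *)

Section NormalLaw.
Variable R : realType.
Local Notation leb := (@lebesgue_measure R).
Implicit Types (m v s c : R).

Lemma integral_normal_prob m s (h : R -> \bar R) : measurable_fun setT h ->
  (\int[normal_prob m s]_x `|h x| < +oo)%E ->
  (\int[normal_prob m s]_x h x = \int[leb]_x (h x * (normal_pdf m s x)%:E))%E.
Proof.
move=> mf finf.
rewrite -(Radon_Nikodym_change_of_variables (normal_prob_dominates m s))//=; last first.
  by apply/integrableP; split.
apply: ae_eq_integral => //.
- apply: emeasurable_funM => //; apply: (measurable_int leb).
  by apply: Radon_Nikodym_integrable; exact: normal_prob_dominates.
- apply: emeasurable_funM => //=; apply/measurableT_comp => //=.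
  exact: measurable_normal_pdf.
- apply: ae_eqe_mul2l => /=.
  rewrite Radon_NikodymE//=; first exact: normal_prob_dominates.
  move=> abmu.
  case: cid => /= h' [h1 h2 h3].
  apply: integral_ae_eq => //=.
  + by apply/measurableT_comp =>//; exact: measurable_normal_pdf.
  + by move=> E E01 mE; rewrite -h3.
Qed.

Lemma normal_prob_translate m s c (A : set R) : s != 0 -> measurable A ->
  normal_prob m s [set x | A (x + c)] = normal_prob (m + c) s A.
Proof.
move=> s0 mA.
have mAc : measurable [set x | A (x + c)].
  have : measurable_fun [set: R] (fun x : R => x + c) by exact: measurable_funD.
  by move=> /(_ measurableT _ mA); rewrite setTI.
rewrite /normal_prob integral_mkcond [RHS]integral_mkcond.
pose G x := ((fun x => (normal_pdf m s x)%:E) \_ [set x | A (x + c)]) x.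
rewrite (@integral_translate _ c G); last 2 first.
- apply/(measurable_restrictT _ _).1 => //; apply: measurable_funTS.
  by apply/measurable_EFinP; exact: measurable_normal_pdf.
- by move=> x; rewrite /G patchE; case: ifP => // _; rewrite lee_fin normal_pdf_ge0.
apply: eq_integral => x _; rewrite /G !patchE.
have -> : (x - c \in [set x | A (x + c)]) = (x \in A).
  by apply/idP/idP => /set_mem /= h; apply: mem_set; rewrite /= ?subrK in h *.
case: ifP => // _; congr (_%:E).
by rewrite !normal_pdfE// /normal_fun (_ : x - c - m = x - (m + c)); last by ring.
Qed.

Lemma normal_law_translate m v c (A : set R) : 0 <= v -> measurable A ->
  normal_law m v [set x | A (x + c)] = normal_law (m + c) v A.
Proof.
move=> v0 mA; rewrite /normal_law; case: ifPn => [_|vN0].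
  by rewrite !diracE.
by apply: normal_prob_translate => //; rewrite gt_eqF// sqrtr_gt0 lt_neqAle eq_sym vN0.
Qed.

Lemma normal_pdf_shift m s y z : normal_pdf (m + y) s z = normal_pdf m s (z - y) :> R \/ s = 0.
Proof.
have [->|s0] := eqVneq s 0; [by right|left].
by rewrite !normal_pdfE// /normal_fun (_ : z - y - m = z - (m + y)); last by ring.
Qed.

Lemma normal_law_ge0 m v (A : set R) : (0 <= normal_law m v A)%E.
Proof. by rewrite /normal_law; case: ifP => _; exact: measure_ge0. Qed.

Lemma normal_law_le1 m v (A : set R) : measurable A -> (normal_law m v A <= 1)%E.
Proof. by rewrite /normal_law; case: ifP => _ mA; exact: probability_le1. Qed.

(* Completing the square. *)
Lemma normal_pdf_conv m1 m2 v1 v2 y z : 0 < v1 -> 0 < v2 ->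
  normal_pdf m1 (Num.sqrt v1) y * normal_pdf (m2 + y) (Num.sqrt v2) z =
  normal_pdf (m1 + m2) (Num.sqrt (v1 + v2)) z *
  normal_pdf ((v2 * m1 + v1 * (z - m2)) / (v1 + v2)) (Num.sqrt (v1 * v2 / (v1 + v2))) y.
Proof.
move=> v10 v20; have v120 : 0 < v1 + v2 by exact: addr_gt0.
have v3 : 0 < v1 * v2 / (v1 + v2) by rewrite divr_gt0// mulr_gt0.
have sq v : 0 < v -> Num.sqrt v != 0 by move=> ?; rewrite gt_eqF// sqrtr_gt0.
rewrite !normal_pdfE ?sq// /normal_peak /normal_fun !sqr_sqrtr ?ltW//.
rewrite mulrACA [RHS]mulrACA -!expRD; congr (_ * expR _); last first.
  by field; rewrite ?gt_eqF.
rewrite -!invfM -!sqrtrM; [|by rewrite ?mulrn_wge0 ?mulr_ge0 ?pi_ge0 ?ltW..].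
congr ((Num.sqrt _)^-1); field; by rewrite gt_eqF.
Qed.

End NormalLaw.

Section Convolution.

Context d1 (T1 : measurableType d1) d2 (T2 : measurableType d2) (R : realType).
Local Notation leb := (@lebesgue_measure R).
Variables (P1 : probability T1 R) (P2 : probability T2 R).
Variables (Y1 : T1 -> R) (Y2 : T2 -> R) (m1 v1 m2 v2 : R).
Hypotheses (mY1 : measurable_fun setT Y1) (mY2 : measurable_fun setT Y2).
Hypotheses (v10 : 0 <= v1) (v20 : 0 <= v2).
Hypothesis lY1 : forall A, measurable A -> P1 (Y1 @^-1` A) = normal_law m1 v1 A.
Hypothesis lY2 : forall A, measurable A -> P2 (Y2 @^-1` A) = normal_law m2 v2 A.

(** If one variance is 0, the sum is a translation of the other variable. Otherwise the product of
    the densities factors into the density of the sum and a normal density in the other variable,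
    which integrates to 1. *)
Lemma normal_law_conv (A : set R) : measurable A ->
  (P1 \x P2)%E [set w | A (Y1 w.1 + Y2 w.2)] = normal_law (m1 + m2) (v1 + v2) A.
Proof.
move=> mA.
have mS : measurable [set w : T1 * T2 | A (Y1 w.1 + Y2 w.2)].
  have : measurable_fun [set: T1 * T2] (fun w => Y1 w.1 + Y2 w.2).
    apply: measurable_funD; first exact: (measurableT_comp mY1 measurable_fst).
    exact: (measurableT_comp mY2 measurable_snd).
  by move=> /(_ measurableT _ mA); rewrite setTI.
have mS' : measurable [set w : R * T2 | A (w.1 + Y2 w.2)].
  have : measurable_fun [set: R * T2] (fun w => w.1 + Y2 w.2).
    apply: measurable_funD; first exact: measurable_fst.
    exact: (measurableT_comp mY2 measurable_snd).
  by move=> /(_ measurableT _ mA); rewrite setTI.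
pose h (y : R) := P2 (xsection [set w : R * T2 | A (w.1 + Y2 w.2)] y).
have mh : measurable_fun setT h by exact: measurable_fun_xsection.
have hE y : h y = normal_law (m2 + y) v2 A.
  rewrite /h (_ : xsection _ _ = Y2 @^-1` [set z | A (z + y)]).
    rewrite lY2 ?normal_law_translate//.
    have : measurable_fun [set: R] (fun z : R => z + y) by exact: measurable_funD.
    by move=> /(_ measurableT _ mA); rewrite setTI.
  by apply/seteqP; split => w2 /=; rewrite /xsection /= inE /= addrC.
have h0 y : (0 <= h y)%E by exact: measure_ge0.
have h1 y : (h y <= 1)%E by rewrite hE normal_law_le1.
have -> : (P1 \x P2)%E [set w | A (Y1 w.1 + Y2 w.2)] = (\int[P1]_w h (Y1 w))%E.
  by [].
have mY1' : @measurable_fun _ _ T1 (measurableTypeR R) setT Y1 by [].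
pose F : {mfun T1 >-> measurableTypeR R} :=
  @mfun_Sub _ _ T1 (measurableTypeR R) Y1 (mem_set mY1').
pose D := distribution P1 F.
rewrite -(@ge0_integral_distribution _ _ T1 (measurableTypeR R) _ P1 F h)// -/D.
have [v1E|v1N0] := eqVneq v1 0.
  rewrite (@eq_measure_integral _ _ _ _ (@dirac _ (measurableTypeR R) m1 R)).
    by rewrite integral_dirac// diracT mul1e hE v1E add0r addrC.
  by move=> B mB _; rewrite -[LHS]/(P1 (Y1 @^-1` B)) lY1// /normal_law v1E eqxx.
have s1 : 0 < v1 by rewrite lt_neqAle eq_sym v1N0.
have eN : (\int[D]_y h y = \int[normal_prob m1 (Num.sqrt v1)]_y h y)%E.
  apply: eq_measure_integral => B mB _; rewrite -[LHS]/(P1 (Y1 @^-1` B)) lY1//.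
  by rewrite /normal_law (negbTE v1N0).
rewrite eN; have [v2E|v2N0] := eqVneq v2 0.
  rewrite (eq_integral (fun y : measurableTypeR R => (\1_[set x : R | A (x + m2)] y)%:E)); last first.
    move=> y _; rewrite hE /normal_law v2E eqxx diracE indicE; congr (_%:R%:E).
    congr nat_of_bool; apply/idP/idP => /set_mem; rewrite /= addrC => ?; exact: mem_set.
  rewrite integral_indic//; last first.
    have : measurable_fun [set: R] (fun z : R => z + m2) by exact: measurable_funD.
    by move=> /(_ measurableT _ mA); rewrite setTI.
  rewrite setIT v2E addr0 /normal_law (negbTE v1N0).
  by apply: normal_prob_translate => //; rewrite gt_eqF// sqrtr_gt0.
have s2 : 0 < v2 by rewrite lt_neqAle eq_sym v2N0.
have sq v : 0 < v -> Num.sqrt v != 0 :> R by move=> ?; rewrite gt_eqF// sqrtr_gt0.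
rewrite integral_normal_prob//; last first.
  apply: (@le_lt_trans _ _ (\int[normal_prob m1 (Num.sqrt v1)]_y cst 1 y)%E).
    apply: ge0_le_integral => //; first exact: measurableT_comp.
    by move=> y _; rewrite gee0_abs.
  rewrite integral_cst// mul1e; set p := (X in (X < _)%E).
  by rewrite (_ : p = 1%E) ?ltry//; exact: probability_setT.
pose G (p : R * R) : \bar R :=
  ((normal_pdf m1 (Num.sqrt v1) p.1 * normal_pdf (m2 + p.1) (Num.sqrt v2) p.2)%:E *
   (\1_A p.2)%:E)%E.
have mG : measurable_fun setT G.
  apply: emeasurable_funM; last first.
    by apply/measurable_EFinP; exact: (measurableT_comp (measurable_indic mA) measurable_snd).
  apply/measurable_EFinP; apply: measurable_funM.
    exact: (measurableT_comp (measurable_normal_pdf _ _) measurable_fst).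
  rewrite (_ : (fun p : R * R => _) = (fun p => normal_pdf m2 (Num.sqrt v2) (p.2 - p.1))).
    apply: (measurableT_comp (measurable_normal_pdf _ _)).
    by apply: measurable_funB; [exact: measurable_snd|exact: measurable_fst].
  apply/funext => p; have [//|e] := normal_pdf_shift m2 (Num.sqrt v2) p.1 p.2.
  by have := sq _ s2; rewrite e eqxx.
have G0 p : (0 <= G p)%E.
  by rewrite /G mule_ge0// ?lee_fin ?mulr_ge0 ?normal_pdf_ge0// indicE ler0n.
transitivity (\int[leb]_y \int[leb]_z G (y, z))%E.
  apply: eq_integral => y _; rewrite hE /normal_law (negbTE v2N0) /normal_prob.
  rewrite integral_mkcond muleC -ge0_integralZl//; last 3 first.
  - apply/(measurable_restrictT _ _).1 => //; apply: measurable_funTS.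
    by apply/measurable_EFinP; exact: measurable_normal_pdf.
  - by move=> x _; rewrite patchE; case: ifP => // _; rewrite lee_fin normal_pdf_ge0.
  - by rewrite lee_fin normal_pdf_ge0.
  apply: eq_integral => z _; rewrite /G /= patchE indicE EFinM.
  by case: ifP => _; rewrite ?mule1 ?mule0.
rewrite (fubini_tonelli (m1 := leb) (m2 := leb) G mG G0).
have v12 : 0 < v1 + v2 by exact: addr_gt0.
have v3 : 0 < v1 * v2 / (v1 + v2) by rewrite divr_gt0// mulr_gt0.
rewrite /normal_law gt_eqF// /normal_prob [RHS]integral_mkcond.
apply: eq_integral => z _; rewrite patchE.
under eq_integral do rewrite /G /= normal_pdf_conv// EFinM -muleA (muleC _ (\1_A z)%:E) muleA.
rewrite ge0_integralZl//; last 3 first.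
- by apply/measurable_EFinP; exact: measurable_normal_pdf.
- by move=> y _; rewrite lee_fin normal_pdf_ge0.
- by rewrite -EFinM lee_fin mulr_ge0// ?normal_pdf_ge0// indicE ler0n.
under eq_integral do rewrite -/(normal_pdf _ _ _).
rewrite integral_normal_pdf mule1 indicE.
by case: ifP => _; rewrite ?mule1 ?mule0.
Qed.

End Convolution.

Section Combinations.
Variable R : realType.
Implicit Types (l : seq (R * R)) (k : R -> R -> R) (c : R).

Definition scale_comb c l : seq (R * R) := [seq (c * p.1, p.2) | p <- l].

Lemma lin_comb_scale (T : Type) (X : R -> T -> R) c l w :
  lin_comb X (scale_comb c l) w = c * lin_comb X l w.
Proof.
by rewrite /lin_comb big_map mulr_sumr; apply: eq_bigr => p _; rewrite mulrA.
Qed.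

Lemma lin_comb_cons (T : Type) (X : R -> T -> R) p l w :
  lin_comb X (p :: l) w = p.1 * X p.2 w + lin_comb X l w.
Proof. by rewrite /lin_comb big_cons. Qed.

Lemma weight_scale c l : weight (scale_comb c l) = c * weight l.
Proof.
by rewrite /weight big_map mulr_sumr; apply: eq_bigr => p _; rewrite mulrA.
Qed.

Lemma weight_cons p l : weight (p :: l) = p.1 * clip01 p.2 + weight l.
Proof. by rewrite /weight big_cons. Qed.

Lemma pairing_scalel k c l l' : pairing k (scale_comb c l) l' = c * pairing k l l'.
Proof.
rewrite /pairing big_map mulr_sumr; apply: eq_bigr => p _.
by rewrite mulr_sumr; apply: eq_bigr => q _; rewrite !mulrA.
Qed.

Lemma pairing_scaler k c l l' : pairing k l (scale_comb c l') = c * pairing k l l'.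
Proof.
rewrite /pairing mulr_sumr; apply: eq_bigr => p _.
by rewrite big_map mulr_sumr; apply: eq_bigr => q _; rewrite /=; ring.
Qed.

Lemma pairing_consl k p l l' :
  pairing k (p :: l) l' = p.1 * pairing k [:: (1, p.2)] l' + pairing k l l'.
Proof.
rewrite /pairing big_cons big_seq1 mulr_sumr; congr (_ + _).
by apply: eq_bigr => q _; rewrite /=; ring.
Qed.

Lemma pairing_consr k p l l' :
  pairing k l (p :: l') = p.1 * pairing k l [:: (1, p.2)] + pairing k l l'.
Proof.
rewrite /pairing mulr_sumr -big_split; apply: eq_bigr => q _ /=.
by rewrite big_cons big_seq1 /=; ring.
Qed.

Lemma pairing11 k u v : pairing k [:: (1, u)] [:: (1, v)] = k u v.
Proof. by rewrite /pairing !big_seq1 /= !mul1r. Qed.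

Lemma pairingC k l l' : (forall u v, k u v = k v u) -> pairing k l l' = pairing k l' l.
Proof.
move=> kC; rewrite /pairing exchange_big; apply: eq_bigr => p _.
by apply: eq_bigr => q _ /=; rewrite kC (mulrC q.1).
Qed.

Lemma pairing_perturb k (h : R -> R) c l l' :
  pairing (fun s t => k s t - c * (h s * h t)) l l' =
  pairing k l l' - c * ((\sum_(p <- l) p.1 * h p.2) * (\sum_(p <- l') p.1 * h p.2)).
Proof.
rewrite /pairing mulr_suml mulr_sumr -sumrB; apply: eq_bigr => p _.
rewrite !mulr_sumr -sumrB; apply: eq_bigr => q _; ring.
Qed.

End Combinations.

Section NormalNull.
Variable R : realType.
Local Notation leb := (@lebesgue_measure R).

(** A nondegenerate normal density is positive everywhere, so its null sets are those of Lebesgue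
    measure, whatever the mean. *)
Lemma normal_prob_null (m m' s : R) (A : set R) : s != 0 -> measurable A ->
  normal_prob m s A = 0%E -> normal_prob m' s A = 0%E.
Proof.
move=> s0 mA; rewrite /normal_prob => A0.
have lA : leb A = 0%E.
  have : (\int[leb]_(x in A) `|(normal_pdf m s x)%:E| = 0)%E.
    by under eq_integral do rewrite gee0_abs ?lee_fin ?normal_pdf_ge0//.
  move/ae_eq_integral_abs => /(_ mA); case.
    by apply: measurable_funTS; apply/measurable_EFinP; exact: measurable_normal_pdf.
  move=> N [mN N0 AN]; apply: (@subset_measure0 _ _ _ leb A N) => // x Ax; apply: AN.
  move=> /(_ Ax) /eqP; rewrite eqe gt_eqF// normal_pdfE//.
  by rewrite mulr_gt0 ?normal_peak_gt0// expR_gt0.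
have /null_content_dominatesP := normal_prob_dominates m' s.
by apply.
Qed.

End NormalNull.

(** * Quasi-invariance under Cameron-Martin shifts *)

Section Drift.
Variables (R : realType) (xi : seq (R * R)).
Implicit Types (f : cpath R).

(** The regression coefficient of the value at [u] on the combination [xi]: when [xi] has weight 0,
    the bridge covariance with [xi] reduces to the [min01] pairing. *)
Definition drift u : R := pairing (@min01 R) [:: (1, u)] xi / pairing (@min01 R) xi xi.

Lemma continuous_min01 v : continuous (fun u : R => min01 u v).
Proof.
move=> u; apply: continuous_min; last exact: cvg_cst.
exact: continuous_clip.
Qed.

Lemma is_path_drift c f : is_path (fun u => f u + c * drift u).
Proof.
have dE u : drift u = (\sum_(q <- xi) q.1 * min01 u q.2) / pairing (@min01 R) xi xi.
  rewrite /drift /pairing big_seq1; congr (_ / _); apply: eq_bigr => q _.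
  by rewrite /= mul1r.
have m0 v : min01 0 v = 0 :> R.
  rewrite /min01 (@clip_id _ 0 1 0) ?lexx ?ler01// min_l//.
  by case/andP: (@clip_in R 0 1 v ler01).
split.
- move=> u; apply: cvgD; first exact: path_continuous.
  apply: cvgM; first exact: cvg_cst.
  suff : {for u, continuous drift} by [].
  rewrite (funext dE); apply: cvgM; last exact: cvg_cst.
  suff : forall l, {for u, continuous (fun u => \sum_(q <- l) q.1 * min01 u q.2)} by apply.
  elim=> [|q l IH].
    by rewrite (_ : (fun _ => _) = cst 0); [exact: cvg_cst|apply/funext => ?; rewrite big_nil].
  rewrite (_ : (fun _ => _) = fun u => q.1 * min01 u q.2 + \sum_(q <- l) q.1 * min01 u q.2).
    by apply: cvgD => //; apply: cvgM; [exact: cvg_cst|exact: continuous_min01].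
  by apply/funext => ?; rewrite big_cons.
- rewrite path0 dE big1 ?mul0r ?mulr0 ?addr0// => q _.
  by rewrite m0 mulr0.
- move=> u; rewrite path_clip; congr (_ + _ * _); rewrite !dE; congr (_ / _).
  by apply: eq_bigr => q _; rewrite /min01 (@clip_id _ 0 1 (clip01 u))//; exact: clip_in.
Qed.

Definition path_shift c f : cpath R := Path (is_path_drift c f).

Lemma shiftD c c' f : path_shift c (path_shift c' f) = path_shift (c' + c) f.
Proof. by apply: path_eq => u /=; rewrite mulrDl addrA. Qed.

End Drift.

Section CameronMartin.
Variables (R : realType) (lam : R) (mu : probability (cpath R) R).
Hypothesis hmu : bridge_marginals lam mu (fun u (f : cpath R) => f u).
Implicit Types (f g : cpath R) (l : seq (R * R)).

Let coord : R -> cpath R -> R := fun u f => f u.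

(** Follows from the existence of [mu]. With a negative variance the square root would be 0 and both
    [l] and its double would have the uniform law on [0, 1]; but doubling takes ]1/2, 1] to ]1,
    2]. *)
Lemma bridge_var_ge0 l : 0 <= bridge_var l.
Proof.
rewrite leNgt; apply/negP => vl.
have [mc ec] := hmu.
have neg m v (A : set R) : v < 0 -> measurable A ->
    normal_law m v A = lebesgue_measure (A `&` `[0, 1]).
  move=> v0 mA; rewrite /normal_law lt_eqF// /normal_prob ler0_sqrtr ?ltW//.
  rewrite /normal_pdf eqxx integral_indic// setIC//.
have vl2 : bridge_var (scale_comb 2 l) < 0.
  rewrite /bridge_var pairing_scalel pairing_scaler weight_scale.
  by move: vl; rewrite /bridge_var; lra.
have := ec l `]1/2, 1]%classic (measurable_itv _).
have := ec (scale_comb 2 l) `]1, 2]%classic (measurable_itv _).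
rewrite !neg//; try exact: measurable_itv.
rewrite (_ : lin_comb _ (scale_comb 2 l) @^-1` _ = lin_comb coord l @^-1` `]1/2, 1]%classic); last first.
  by apply/seteqP; split => f /=; rewrite lin_comb_scale !in_itv /= => /andP[? ?]; apply/andP; split; lra.
move=> ->.
rewrite (_ : `]1, 2]%classic `&` `[0, 1]%classic = set0 :> set R); last first.
  by apply/seteqP; split => x //=; rewrite !in_itv /=; lra.
rewrite (_ : `]1/2, 1]%classic `&` `[0, 1]%classic = `]1/2, 1]%classic :> set R); last first.
  by apply/seteqP; split => x //=; rewrite !in_itv /= => h; [case: h|split => //; lra].
rewrite measure0 lebesgue_measure_itv /= lte_fin ifT; last by lra.
by rewrite -EFinB => /eqP; rewrite eqe; apply/negP; rewrite lt_eqF//; lra.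
Qed.

Variable xi : seq (R * R).
Hypothesis xi_weight : weight xi = 0.
Let s2 := pairing (@min01 R) xi xi.
Hypothesis s20 : 0 < s2.

Local Notation drift := (drift xi).
Local Notation path_shift := (path_shift xi).

Lemma driftE u : pairing (@min01 R) [:: (1, u)] xi = s2 * drift u.
Proof. by rewrite /drift -/s2 mulrC divfK// gt_eqF. Qed.

Let xiv f := lin_comb coord xi f.

Let mxiv : measurable_fun setT xiv.
Proof. by apply: measurable_lin_comb; exact: path_coord. Qed.

(** The part of the value at [u] that is uncorrelated with [xi]. *)
Let residual u : seq (R * R) := (1, u) :: scale_comb (- drift u) xi.

Let residual_weight u : weight (residual u) = clip01 u.
Proof. by rewrite weight_cons weight_scale xi_weight mulr0 addr0 mul1r. Qed.

Let residual_pairing s t :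
  pairing (@min01 R) (residual s) (residual t) = min01 s t - s2 * (drift s * drift t).
Proof.
rewrite /residual pairing_consl (pairing_consr _ (1, t) [:: (1, s)] (scale_comb _ xi)).
rewrite (pairing_consr _ (1, t) (scale_comb _ xi) (scale_comb _ xi)) /=.
rewrite !pairing_scalel !pairing_scaler pairing11 (pairingC xi _ (@min01C R)) !driftE -/s2; ring.
Qed.

(* The component of the bridge along xi is replaced by an independent copy. *)
Let resample (p : cpath R * cpath R) := path_shift (xiv p.2 - xiv p.1) p.1.

Let resampleE l p : lin_comb (fun u p => resample p u) l p =
  lin_comb coord (subst_comb residual l) p.1 +
  lin_comb coord (scale_comb (\sum_(q <- l) q.1 * drift q.2) xi) p.2.
Proof.
rewrite lin_comb_subst lin_comb_scale -/(xiv p.2) /lin_comb mulr_suml -big_split.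
apply: eq_bigr => q _ /=; rewrite -/(lin_comb coord (residual q.2) p.1).
rewrite lin_comb_cons lin_comb_scale -/(xiv p.1) /coord /=; ring.
Qed.

Let measurable_resample : measurable_fun setT resample.
Proof.
apply: measurable_path => u.
apply: measurable_funD; first exact: (measurableT_comp (path_coord u) measurable_fst).
apply: measurable_funM; last exact: measurable_cst.
apply: measurable_funB; first exact: (measurableT_comp mxiv measurable_snd).
exact: (measurableT_comp mxiv measurable_fst).
Qed.

Let resample_marginals : bridge_marginals lam (mu \x mu)%E (fun u p => resample p u).
Proof.
split=> [u|l A mA]; first exact: (measurableT_comp (path_coord u) measurable_resample).
have [mc ec] := hmu.
pose l1 := subst_comb residual l.
pose l2 := scale_comb (\sum_(q <- l) q.1 * drift q.2) xi.
rewrite (_ : _ @^-1` A = [set p | A (lin_comb coord l1 p.1 + lin_comb coord l2 p.2)]); last first.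
  by apply/funext => p; rewrite /= resampleE.
apply: etrans (normal_law_conv (measurable_lin_comb _ mc) (measurable_lin_comb _ mc)
  (bridge_var_ge0 l1) (bridge_var_ge0 l2) (ec l1) (ec l2) mA) _.
congr (normal_law _ _ A).
  by rewrite weight_scale xi_weight mulr0 mulr0 addr0 /l1 weight_subst.
rewrite /bridge_var /l1 weight_subst// pairing_subst.
rewrite (_ : (fun s t => _) = fun s t => min01 s t - s2 * (drift s * drift t)); last first.
  by apply/funext => s; apply/funext => t; rewrite residual_pairing.
rewrite pairing_perturb /l2 weight_scale xi_weight pairing_scalel pairing_scaler -/s2; ring.
Qed.

Let mshift E a f : measurable E -> measurable [set x | E (path_shift (x - a) f)].
Proof.
move=> mE; have : measurable_fun [set: R] (fun x => path_shift (x - a) f).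
  apply: measurable_path => u; apply: measurable_funD => //.
  by apply: measurable_funM => //; exact: measurable_funB.
by move=> /(_ measurableT _ mE); rewrite setTI.
Qed.

(** Given the first path, resampling leaves only the new [xi]-coordinate random, and this is a
    centred normal variable of variance [s2]. *)
Let shift_fubini E : measurable E ->
  mu E = (\int[mu]_f normal_law 0 s2 [set x | E (path_shift (x - xiv f) f)])%E.
Proof.
move=> mE; have [mc ec] := hmu.
transitivity ((mu \x mu)%E (resample @^-1` E)).
  by rewrite -(bridge_marginals_law hmu resample_marginals mE).
rewrite -[LHS]/(\int[mu]_f mu (xsection (resample @^-1` E) f))%E.
apply: eq_integral => f _.
rewrite (_ : xsection _ _ = xiv @^-1` [set x | E (path_shift (x - xiv f) f)]); last first.
  by apply/seteqP; split => g; rewrite /xsection /= inE.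
rewrite (ec xi); last exact: mshift.
by rewrite xi_weight mulr0 /bridge_var xi_weight expr0n subr0.
Qed.

Lemma measurable_shift c : measurable_fun setT (path_shift c).
Proof.
by apply: measurable_path => u; apply: measurable_funD => //; exact: path_coord.
Qed.

(** In the disintegration [shift_fubini] the shift merely translates the normal variable, which does
    not change its null sets; a null preimage would make [E] null. *)
Lemma shift_pos c E : measurable E -> (0 < mu E)%E -> (0 < mu (path_shift c @^-1` E))%E.
Proof.
move=> mE muE; rewrite lt_neqAle measure_ge0 andbT; apply/negP => /eqP E0.
have mEc : measurable (path_shift c @^-1` E).
  by have := measurable_shift c measurableT mE; rewrite setTI.
pose h E f := normal_law 0 s2 [set x | E (path_shift (x - xiv f) f)].
have mh F : measurable F -> measurable_fun setT (h F).
  move=> mF; have [mc ec] := hmu.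
  rewrite (_ : h F = fun f => mu (xsection (resample @^-1` F) f)).
    apply: measurable_fun_xsection.
    by have := measurable_resample measurableT mF; rewrite setTI.
  apply/funext => f; rewrite /h.
  rewrite (_ : xsection _ _ = xiv @^-1` [set x | F (path_shift (x - xiv f) f)]); last first.
    by apply/seteqP; split => g; rewrite /xsection /= inE.
  rewrite (ec xi); last exact: mshift.
  by rewrite xi_weight mulr0 /bridge_var xi_weight expr0n subr0.
have h0 F f : (0 <= h F f)%E by exact: normal_law_ge0.
have sq : Num.sqrt s2 != 0 by rewrite gt_eqF// sqrtr_gt0.
have hN F f : h F f = normal_prob 0 (Num.sqrt s2) [set x | F (path_shift (x - xiv f) f)].
  by rewrite /h /normal_law gt_eqF.
have hc f : h (path_shift c @^-1` E) f = 0%E -> h E f = 0%E.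
  rewrite !hN (_ : [set x | _] = [set x | [set y | E (path_shift (y - xiv f) f)] (x + c)]); last first.
    by apply/seteqP; split => x /=; rewrite shiftD addrAC.
  rewrite normal_prob_translate//; last exact: mshift.
  by apply: normal_prob_null => //; exact: mshift.
have : ae_eq mu setT (h (path_shift c @^-1` E)) (cst 0%E).
  apply/(ae_eq_integral_abs mu measurableT (mh _ mEc)).
  by under eq_integral do rewrite gee0_abs//; rewrite -shift_fubini.
move=> hc0; move: muE; rewrite shift_fubini//.
suff -> : (\int[mu]_f h E f = 0)%E by rewrite ltxx.
have : ae_eq mu setT (h E) (cst 0%E).
  by case: hc0 => N [mN N0 sN]; exists N; split => // f hf; apply: sN => /= h'; apply: hf => _; apply: hc; exact: h'.
move/(ae_eq_integral_abs mu measurableT (mh _ mE)).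
by under eq_integral do rewrite gee0_abs//.
Qed.

End CameronMartin.

(** * Discretization of paths and positivity of tubes *)

Lemma measurable_implyb d (T : measurableType d) (b : bool) (p : T -> bool) :
  measurable [set x | p x] -> measurable [set x | b ==> p x].
Proof.
by case: b => //= _; rewrite (_ : [set x | _] = setT)//; exact/seteqP.
Qed.

Section Oscillation.
Variable R : realType.
Implicit Types (f : cpath R).

Lemma small_oscillation f (e : R) : 0 < e ->
  \forall n \near \oo, forall i u, (i < n.+1)%N -> 0 <= u <= 1 ->
    `|f ((i%:R + u) / n.+1%:R) - f (i%:R / n.+1%:R)| <= e.
Proof.
move=> e0.
have /compact_near_coveringP/near_covering_withinP := @segment_compact R 0 1.
pose P n x := forall u, `|u - x| <= n.+1%:R^-1 -> `|f u - f x| <= e.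
move=> /(_ nat \oo P _); case.
  move=> x /= x01; have [|d d0 hd] := @cont_near R f x (e / 2) (@path_continuous R f).
    by rewrite divr_gt0.
  have d20 : 0 < d / 2 by rewrite divr_gt0.
  near=> x' n => /= _ u ux.
  have xx : `|x' - x| < d / 2 by near: x'; apply/nbhs_ballP; exists (d / 2) => // z; rewrite /ball /= distrC.
  have nd : n.+1%:R^-1 < d / 2.
    by near: n; exact: near_infty_natSinv_lt (PosNum d20).
  have := hd x'; have := hd u.
  have -> : `|u - x| < d.
    rewrite (_ : u - x = (u - x') + (x' - x)); last by ring.
    rewrite (le_lt_trans (ler_normD _ _))// (splitr d) ler_ltD//.
    exact: le_trans ux (ltW nd).
  have -> : `|x' - x| < d by apply: lt_trans xx _; rewrite gtr_pMr// invf_lt1// ltr1n.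
  move=> /(_ isT) h1 /(_ isT) h2.
  rewrite (_ : f u - f x' = (f u - f x) - (f x' - f x)); last by ring.
  by rewrite (le_trans (ler_normB _ _))// (splitr e) lerD// ltW.
move=> N _ hN; exists N => // n Nn i u i_n /andP[u0 u1].
have n0 : 0 < n.+1%:R :> R by [].
apply: (hN n Nn (i%:R / n.+1%:R)).
  rewrite /= in_itv /= divr_ge0//= ler_pdivrMr// mul1r ler_nat ltnW//.
rewrite -mulrBl addrAC subrr add0r normrM (ger0_norm u0) gtr0_norm ?invr_gt0//.
by rewrite ler_piMl// invr_ge0 ltW.
Unshelve. all: by end_near. Qed.

Definition osc_set (n : nat) (e : R) : set (cpath R) :=
  [set f | forall i k, (i < n.+1)%N ==>
    (`|f ((i%:R + dense01 R k) / n.+1%:R) - f (i%:R / n.+1%:R)| <= e)].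

Lemma osc_setP n e f i u : osc_set n e f -> (i < n.+1)%N -> 0 <= u <= 1 ->
  `|f ((i%:R + u) / n.+1%:R) - f (i%:R / n.+1%:R)| <= e.
Proof.
move=> hf i_n; pose g u := `|f ((i%:R + u) / n.+1%:R) - f (i%:R / n.+1%:R)|.
apply: (@cont_le_dense _ g).
  move=> v; apply: cvg_norm.
  apply: cvgB; last exact: cvg_cst.
  apply: (@cvg_path _ f (fun v => (i%:R + v) / n.+1%:R)).
  by apply: cvgM; [apply: cvgD => //; exact: cvg_cst|exact: cvg_cst].
by move=> k; rewrite mul1r; have /implyP := hf i k; exact.
Qed.

Lemma measurable_osc_set n e : measurable (osc_set n e).
Proof.
apply: measurable_forall => i; apply: measurable_forall => k.
apply: measurable_implyb.
apply: measurable_ler_set => //; apply: measurableT_comp => //.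
by apply: measurable_funB; exact: path_coord.
Qed.

End Oscillation.

Section PositiveMass.
Variables (R : realType) (mu : probability (cpath R) R).

Lemma pos_bigcup (E : set (cpath R)) (A : nat -> set (cpath R)) :
  measurable E -> (forall n, measurable (A n)) ->
  E `<=` \bigcup_n A n -> (0 < mu E)%E -> exists n, (0 < mu (A n))%E.
Proof.
move=> mE mA EA muE; apply: contrapT => /forallNP h.
move: muE; suff -> : mu E = 0%E by rewrite ltxx.
apply: measure_negligible => //; apply: (negligibleS EA); apply: negligible_bigcup => n.
apply/negligibleP => //; apply/eqP; rewrite eq_le measure_ge0 andbT.
by rewrite leNgt; apply/negP; exact: h.
Qed.

Definition knot_set (m : nat) (w c : nat -> R) (e : R) : set (cpath R) :=
  [set f | forall i, (i < m)%N ==> (`|f (w i) - c i| <= e)].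

Lemma measurable_knot_set m w c e : measurable (knot_set m w c e).
Proof.
apply: measurable_forall => i; apply: measurable_implyb.
apply: measurable_ler_set => //; apply: measurableT_comp => //.
by apply: measurable_funB => //; exact: path_coord.
Qed.

(** At each knot, countably many balls with rational centre cover the line, so one of them keeps
    positive mass. *)
Lemma knots_pos (A : set (cpath R)) m w e : measurable A -> (0 < mu A)%E -> 0 < e ->
  exists c, (0 < mu (A `&` knot_set m w c e))%E.
Proof.
move=> mA muA e0; elim: m => [|m [c IH]].
  exists (fun=> 0); rewrite (_ : _ `&` _ = A)//.
  by apply/seteqP; split => f; [case|move=> ?; split].
pose q n : R := ratr (odflt 0 (@unpickle rat n)).
pose B n := A `&` knot_set m w c e `&` [set f | `|f (w m) - q n| <= e].
have mB n : measurable (B n).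
  apply: measurableI; first by apply: measurableI => //; exact: measurable_knot_set.
  apply: measurable_ler_set => //; apply: measurableT_comp => //.
  by apply: measurable_funB => //; exact: path_coord.
have [||//|n Bn] := @pos_bigcup (A `&` knot_set m w c e) B _ mB.
- by apply: measurableI => //; exact: measurable_knot_set.
- move=> f hf; have [|r] := @rat_in_itvoo R (f (w m) - e) (f (w m) + e); first by lra.
  rewrite in_itv /= => /andP[r1 r2]; exists (pickle r) => //; split => //=.
  by rewrite /q pickleK /= ler_norml; apply/andP; split; lra.
exists (fun i => if i == m then q n else c i).
apply: (lt_le_trans Bn); apply: le_measure; rewrite ?inE//.
  by apply: measurableI => //; exact: measurable_knot_set.
move=> f [[Af hf] /= hm]; split => // i; apply/implyP; rewrite ltnS leq_eqVlt.
by case: eqVneq => [-> //|_ /= im]; have /implyP := hf i; exact.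
Qed.

End PositiveMass.

Section PiecewiseLinear.
Variables (R : realType) (n : nat) (c : nat -> R).
Local Notation N := (n.+1%:R : R).

Let knot (i : nat) : R := i%:R / N.

(** The Paley-Wiener integral of the slope of [pl]: its covariance with the value at [u] under the
    Brownian kernel is [pl u]. *)
Definition pl_comb : seq (R * R) :=
  flatten [seq [:: (N * (c j.+1 - c j), knot j.+1); (- (N * (c j.+1 - c j)), knot j)]
          | j <- index_iota 0 n.+1].

(** The linear interpolation of [c - c 0] on the grid: each difference of minima is the length of
    the part of a cell to the left of [u]. *)
Definition pl u := \sum_(0 <= j < n.+1)
  N * (c j.+1 - c j) * (min01 u (knot j.+1) - min01 u (knot j)).

Lemma sum_pl_comb (h : R -> R) : \sum_(p <- pl_comb) p.1 * h p.2 =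
  \sum_(0 <= j < n.+1) N * (c j.+1 - c j) * (h (knot j.+1) - h (knot j)).
Proof.
rewrite /pl_comb big_flatten big_map; apply: eq_bigr => j _.
by rewrite !big_cons big_nil /=; ring.
Qed.

Lemma pairing_pl u : pairing (@min01 R) [:: (1, u)] pl_comb = pl u.
Proof.
rewrite /pl -(sum_pl_comb (fun v => min01 u v)) /pairing big_seq1.
by apply: eq_bigr => q _ /=; rewrite mul1r.
Qed.

Let N0 : N != 0. Proof. by rewrite pnatr_eq0. Qed.

Let knot_in i : (i <= n.+1)%N -> 0 <= knot i <= 1.
Proof. by move=> i_n; rewrite divr_ge0//= ler_pdivrMr// mul1r ler_nat. Qed.

Lemma pl_at i u : (i < n.+1)%N -> 0 <= u <= 1 ->
  pl ((i%:R + u) / N) = c i + u * (c i.+1 - c i) - c 0%N.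
Proof.
move=> i_n /andP[u0 u1]; set t := (i%:R + u) / N.
have ti : knot i <= t by rewrite ler_pM2r ?invr_gt0// lerDl.
have ti1 : t <= knot i.+1 by rewrite ler_pM2r ?invr_gt0// -natr1 lerD2l.
have knot_le j k : (j <= k)%N -> knot j <= knot k.
  by move=> jk; rewrite ler_pM2r ?invr_gt0// ler_nat.
have t01 : 0 <= t <= 1.
  have /andP[? ?] := knot_in (ltnW i_n); have /andP[? ?] := knot_in i_n.
  by apply/andP; split; lra.
have lo j : (j <= i)%N -> min01 t (knot j) = knot j.
  move=> ji; rewrite min01E// clip_id ?min_r//; first exact: le_trans (knot_le _ _ ji) ti.
  by apply: knot_in; exact: leq_trans ji (ltnW i_n).
have hi j : (i < j)%N -> (j <= n.+1)%N -> min01 t (knot j) = t.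
  move=> ij jn; rewrite min01E// clip_id ?knot_in// min_l//.
  exact: le_trans ti1 (knot_le _ _ ij).
rewrite /pl (@big_cat_nat _ _ _ i)//=; last exact: ltnW.
rewrite (eq_big_nat _ _ (F2 := fun j => c j.+1 - c j)); last first.
  move=> j /andP[_ ji]; rewrite !lo ?(ltnW ji)// /knot -[j.+1%:R]natr1; field; rewrite ?natr1 ?nat1r; exact: N0.
rewrite telescope_sumr// big_ltn// (lo i)// (hi i.+1)//.
rewrite big_nat_cond big1 ?addr0; last first.
  move=> j; rewrite andbT => /andP[ij jn]; rewrite !hi// ?subrr ?mulr0//.
  - exact: ltnW.
  - exact: leqW.
rewrite /t /knot; field; rewrite ?natr1 ?nat1r; exact: N0.
Qed.

Lemma pl_knot i : (i <= n.+1)%N -> pl (knot i) = c i - c 0%N.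
Proof.
case: i => [|i] i_n.
  have := @pl_at 0 0 isT; rewrite lexx ler01 addr0 => /(_ isT) ->.
  by rewrite mul0r addr0.
have := @pl_at i 1 i_n; rewrite lexx ler01 natr1 => /(_ isT) ->; ring.
Qed.

Lemma weight_pl : weight pl_comb = c n.+1 - c 0%N.
Proof.
rewrite /weight sum_pl_comb -telescope_sumr//; apply: eq_big_nat => j /andP[_ jn].
rewrite !clip_id ?knot_in//; last exact: ltnW.
rewrite /knot -[j.+1%:R]natr1; field; rewrite ?natr1 ?nat1r; exact: N0.
Qed.

Lemma pairing_pl_comb : pairing (@min01 R) pl_comb pl_comb =
  \sum_(0 <= j < n.+1) N * (c j.+1 - c j) ^+ 2.
Proof.
transitivity (\sum_(p <- pl_comb) p.1 * pl p.2).
  apply: eq_bigr => p _; rewrite -pairing_pl /pairing big_seq1 mulr_sumr.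
  by apply: eq_bigr => q _ /=; ring.
rewrite sum_pl_comb; apply: eq_big_nat => j /andP[_ jn].
rewrite !pl_knot//; [ring|exact: ltnW].
Qed.

(** The shift by the variance of [pl_comb] undoes the normalization of [drift] and gives [pl]. If
    that variance is 0, all increments of [c] vanish and the identity serves. *)
Lemma pl_shift_pos (lam : R) (mu : probability (cpath R) R) (E : set (cpath R)) :
  bridge_marginals lam mu (fun u (f : cpath R) => f u) ->
  c 0%N = 0 -> c n.+1 = 0 -> measurable E -> (0 < mu E)%E ->
  exists S : cpath R -> cpath R, [/\ measurable_fun setT S,
    forall f u, S f u = f u + pl u & (0 < mu (S @^-1` E))%E].
Proof.
move=> hmu c0 cn mE muE.
have w0 : weight pl_comb = 0 by rewrite weight_pl cn c0 subr0.
have [s2|s2] := ltP 0 (pairing (@min01 R) pl_comb pl_comb).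
  exists (path_shift pl_comb (pairing (@min01 R) pl_comb pl_comb)); split.
  - exact: measurable_shift.
  - by move=> f u /=; rewrite -driftE// pairing_pl.
  - exact: (shift_pos hmu w0 s2).
exists id; split => // f u; rewrite (_ : pl u = 0) ?addr0//.
have dc0 j : (j < n.+1)%N -> c j.+1 - c j = 0.
  have sq0 i : true -> 0 <= N * (c i.+1 - c i) ^+ 2 by rewrite mulr_ge0 ?sqr_ge0.
  move: s2; rewrite pairing_pl_comb => s2 jn.
  have : \sum_(0 <= i < n.+1) N * (c i.+1 - c i) ^+ 2 == 0.
    by rewrite eq_le s2 sumr_ge0.
  rewrite psumr_eq0// => /allP /(_ j); rewrite mem_index_iota jn => /(_ isT) /=.
  by rewrite mulf_eq0 (negbTE N0) sqrf_eq0 => /eqP.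
rewrite /pl big_nat_cond big1// => j; rewrite andbT => /andP[_ jn].
by rewrite dc0// mulr0 mul0r.
Qed.

End PiecewiseLinear.

Section Tube.
Variables (R : realType) (lam : R) (mu : probability (cpath R) R).
Hypothesis hmu : bridge_marginals lam mu (fun u (f : cpath R) => f u).
Implicit Types (f : cpath R).

Definition tube_set (y : cpath R) (e : R) : set (cpath R) := at_end lam `&`
  [set f | forall k, `|f (dense01 R k) - y (dense01 R k)| <= e].

Lemma measurable_tube_set y e : measurable (tube_set y e).
Proof.
apply: measurableI; first exact: measurable_at_end.
apply: measurable_forall => k; apply: measurable_ler_set => //.
apply: measurableT_comp => //.
by apply: measurable_funB => //; exact: path_coord.
Qed.

Lemma tube_setP y e f u : tube_set y e f -> `|f u - y u| <= e.
Proof.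
move=> [_ hf]; rewrite -(path_clip f) -(path_clip y); pose g u := `|f u - y u|.
have cg : continuous g by move=> v; apply: cvg_norm; apply: cvgB; exact: path_continuous.
have hg k : g (1 * dense01 R k) <= e by rewrite mul1r; exact: hf.
exact: (cont_le_dense cg hg (clip_in u ler01)).
Qed.

Lemma at_end_1 : mu (at_end lam) = 1%E.
Proof.
have [mc ec] := hmu; have c1 : clip01 1 = 1 :> R by rewrite clip_id// lexx ler01.
rewrite (_ : at_end lam = lin_comb (fun u (f : cpath R) => f u) [:: (1, 1)] @^-1` [set lam]).
  rewrite ec// /bridge_var pairing11 /min01 /weight big_seq1 /= c1 minxx !mulr1 expr1n subrr.
  by rewrite /normal_law eqxx diracE mem_set.
by apply/seteqP; split => f /=; rewrite /at_end /lin_comb big_seq1 /= mul1r.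
Qed.

Lemma grid_cell (n : nat) (u : R) : 0 <= u <= 1 -> exists i t,
  [/\ (i < n.+1)%N, 0 <= t <= 1 & u = (i%:R + t) / n.+1%:R].
Proof.
move=> /andP[u0 u1].
have N0 : n.+1%:R != 0 :> R by rewrite pnatr_eq0.
suff : forall m, u * n.+1%:R <= m.+1%:R -> exists i t,
    [/\ (i < m.+1)%N, 0 <= t <= 1 & u * n.+1%:R = i%:R + t].
  move=> /(_ n); rewrite ler_piMl// => /(_ isT) [i [t [? ? e]]].
  by exists i, t; split => //; rewrite -e mulfK.
elim=> [|m IH] h; first by exists 0%N, (u * n.+1%:R); rewrite mulr_ge0// add0r.
have [/IH [i [t [im ? ?]]]|hm] := leP (u * n.+1%:R) m.+1%:R.
  by exists i, t; split => //; exact: leq_trans im _.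
exists m.+1, (u * n.+1%:R - m.+1%:R); split => //; last by rewrite addrC subrK.
by rewrite subr_ge0 ltW//= lerBlDl natr1.
Qed.

(** Some grid and some knot values [k] are followed by paths of small oscillation with positive
    mass. Moving these paths by the interpolation of [k - y] brings them close to [y], and such a
    shift keeps the mass positive. *)
Lemma tube_pos (y : cpath R) e : y 1 = lam -> 0 < e -> (0 < mu (tube_set y e))%E.
Proof.
(* Seven errors of size [dl] add up: the oscillations of both paths up to [u], the deviation from
   [k] at the left knot, and four for the increment of [k - y] over the cell. *)
move=> y1 e0; pose dl := e / 7; have dl0 : 0 < dl by rewrite divr_gt0.
have [N _ hN] := small_oscillation y dl0.
pose A n := at_end lam `&` osc_set (N + n) dl.
have mA n : measurable (A n).
  by apply: measurableI; [exact: measurable_at_end|exact: measurable_osc_set].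
have [||//|m Am] := @pos_bigcup _ mu (at_end lam) A _ mA.
- exact: measurable_at_end.
- move=> f fe; have [N' _ hN'] := small_oscillation f dl0.
  exists N' => //; split => // i k; apply/implyP => iN.
  by apply: hN' => //=; [exact: leq_addl|exact: dense01_in].
- by have := at_end_1; rewrite /= => ->; exact: lte01.
pose n := (N + m)%N; pose knot (i : nat) : R := i%:R / n.+1%:R.
have knot0 : knot 0 = 0 by rewrite /knot mul0r.
have knot1 : knot n.+1 = 1 by rewrite /knot divff// pnatr_eq0.
have [k0 Ak0] := knots_pos n.+1 knot (mA m) Am dl0.
(* At the ends the exact values 0 and [lam] are taken, so that the interpolation of [k - y] vanishes
   at 0 and 1. *)
pose k i := if i == 0%N then 0 else if i == n.+1 then lam else k0 i.
pose E := A m `&` knot_set n.+1 knot k0 dl.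
have mE : measurable E by apply: measurableI => //; exact: measurable_knot_set.
have hk g i : E g -> (i <= n.+1)%N -> `|g (knot i) - k i| <= dl.
  move=> [[ge _] hg] i_n; rewrite /k; have [->|i0] := eqVneq i 0%N.
    by rewrite knot0 path0 subrr normr0 ltW.
  have [->|i1] := eqVneq i n.+1; first by rewrite knot1 ge subrr normr0 ltW.
  by have /implyP := hg i; apply; rewrite ltn_neqAle i1.
pose c i := k i - y (knot i).
have c0 : c 0%N = 0 by rewrite /c /k eqxx knot0 path0 subrr.
have c1 : c n.+1 = 0 by rewrite /c /k /= eqxx knot1 y1 subrr.
have [S [mS eS S0]] := pl_shift_pos hmu c0 c1 mE Ak0.
apply: (lt_le_trans S0); apply: le_measure; rewrite ?inE.
- by have := mS measurableT _ mE; rewrite setTI.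
- exact: measurable_tube_set.
move=> f Ef; have [[fe fo] _] := Ef; split.
  have := fe; rewrite /at_end /= eS -{2}knot1 pl_knot// c1 c0 subrr addr0//.
move=> j; set u := dense01 R j; have [i [t [i_n /andP[t0 t1] uE]]] := grid_cell n (dense01_in R j).
have t01 : 0 <= t <= 1 by rewrite t0.
have osc s : 0 <= s <= 1 -> `|S f ((i%:R + s) / n.+1%:R) - S f (knot i)| <= dl.
  by move=> s01; exact: (osc_setP fo).
have oscy s : 0 <= s <= 1 -> `|y ((i%:R + s) / n.+1%:R) - y (knot i)| <= dl.
  by move=> s01; apply: hN => //=; exact: leq_addr.
have s1 : 0 <= (1 : R) <= 1 by rewrite lexx ler01.
have := hk _ _ Ef i_n; have := hk _ _ Ef (ltnW i_n).
have := osc _ t01; have := osc _ s1; have := oscy _ t01; have := oscy _ s1.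
rewrite natr1 -/(knot i.+1) -uE -/u.
have : S f u = f u + (c i + t * (c i.+1 - c i)) by rewrite eS /u uE pl_at// c0 subr0.
rewrite /c; move: (S f u) (S f (knot i)) (S f (knot i.+1)) (f u) (y u) (y (knot i)) (y (knot i.+1)) (k i) (k i.+1).
move=> a ai ai1 fu yu yi yi1 ki ki1 aE.
rewrite !ler_norml => /andP[h1 h1'] /andP[h2 h2'] /andP[h3 h3'] /andP[h4 h4'] /andP[h5 h5'] /andP[h6 h6'].
pose D := (ki1 - yi1) - (ki - yi).
have D1 : - (4 * dl) <= D <= 4 * dl by rewrite /D; apply/andP; split; lra.
have tD : - (4 * dl) <= t * D <= 4 * dl by apply/andP; split; nra.
have fE : fu = a - (ki - yi) - t * D by rewrite aE /D; ring.
have e7 : e = 7 * dl by rewrite /dl; field.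
by rewrite fE e7; apply/andP; split; lra.
Qed.

End Tube.

(** * A target path and the tube around it *)

Ltac no_max x :=
  lazymatch x with
  | context[Order.max _ _] => fail
  | context[Order.min _ _] => fail
  | _ => idtac
  end.

(** Extrema are removed from the inside out, so that [lra] only compares linear terms. *)
Ltac elim_max :=
  repeat match goal with
  | |- context[Order.max ?x ?y] => no_max x; no_max y;
    first [ rewrite (@max_l _ _ x y); [|solve [lra]]
          | rewrite (@max_r _ _ x y); [|solve [lra]]
          | case: (leP x y) => ? ]
  | |- context[Order.min ?x ?y] => no_max x; no_max y;
    first [ rewrite (@min_l _ _ x y); [|solve [lra]]
          | rewrite (@min_r _ _ x y); [|solve [lra]]
          | case: (leP x y) => ? ] end.

Section Target.
Variables (R : realType) (lam : R).
Hypothesis lam0 : 0 < lam.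
Implicit Types (f : cpath R) (u : R).

(** A tent that falls to level 3 at distance 1/16. With the minimum at 5/16, the centre 5/8 is that
    of the block for [a = 3/16], and 15/16 is where [V] at 5/8 is read. The height lies between 3 +
    3 - 1, to be exceeded at the centre of a high block, and the upper bound 3 + 3. *)
Definition peak (c u : R) : R := 11 / 2 - 40 * Num.max (u - c) (c - u).

(* A valley at 5/16, then height 3 except for peaks of height 11/2 at 5/8 and
   15/16. *)
Definition profile u : R := Num.max (2 - 32 / 5 * u)
  (Num.min (32 * u - 10) (Num.max 3 (Num.max (peak (5 / 8) u) (peak (15 / 16) u)))).

Lemma continuous_profile : continuous profile.
Proof.
have lin (a b : R) : continuous (fun u => a * u + b).
  by move=> u; apply: cvgD; [apply: cvgM; [exact: cvg_cst|exact: cvg_id]|exact: cvg_cst].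
have pk c : continuous (peak c).
  move=> u; apply: cvgB; first exact: cvg_cst.
  apply: cvgM; first exact: cvg_cst.
  suff : {for u, continuous (fun v => Num.max (v - c) (c - v))} by [].
  by apply: continuous_max; apply: cvgB; by [exact: cvg_cst|exact: cvg_id].
move=> u; suff : {for u, continuous (fun u => Num.max (2 - 32 / 5 * u) (Num.min
  (32 * u - 10) (Num.max 3 (Num.max (peak (5 / 8) u) (peak (15 / 16) u)))))} by [].
apply: continuous_max.
  by apply: cvgB; [exact: cvg_cst|apply: cvgM; [exact: cvg_cst|exact: cvg_id]].
apply: continuous_min.
  by apply: cvgB; [apply: cvgM; [exact: cvg_cst|exact: cvg_id]|exact: cvg_cst].
apply: continuous_max; first exact: cvg_cst.
by apply: continuous_max; exact: pk.
Qed.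

(** In units of [lam], 1/50 is twice the radius of the tube: the profile at the minimizer of a path
    in the tube cannot exceed it. *)
Lemma profile_valley u : profile u <= 50^-1 -> 5 / 16 - 300^-1 <= u <= 5 / 16 + 1000^-1.
Proof.
rewrite /profile ge_max ge_min ge_max => /andP[h1 /orP[h2|/andP[h2 _]]];
by apply/andP; split; lra.
Qed.

Lemma profile_bounds u : 7 / 16 <= u <= 1 -> 3 <= profile u <= 11 / 2.
Proof. by move=> /andP[? ?]; rewrite /profile /peak; elim_max; try (apply/andP; split); lra. Qed.

Lemma profile_flat u : 7 / 16 <= u <= 9 / 16 \/ 11 / 16 <= u <= 7 / 8 -> profile u = 3.
Proof. by case=> /andP[? ?]; rewrite /profile /peak; elim_max; try (apply/andP; split); lra. Qed.

Lemma profile_peak u : 5 / 8 - 200^-1 <= u <= 5 / 8 + 200^-1 \/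
  15 / 16 - 200^-1 <= u <= 15 / 16 + 200^-1 -> 53 / 10 <= profile u.
Proof. by case=> /andP[? ?]; rewrite /profile /peak; elim_max; try (apply/andP; split); lra. Qed.

Lemma profile_0 : profile 0 = 2.
Proof. by rewrite /profile /peak; elim_max; try (apply/andP; split); lra. Qed.

Lemma profile_1 : profile 1 = 3.
Proof. by rewrite /profile /peak; elim_max; try (apply/andP; split); lra. Qed.

Lemma profile_5_16 : profile (5 / 16) = 0.
Proof. by rewrite /profile /peak; elim_max; try (apply/andP; split); lra. Qed.

Lemma is_path_target : is_path (fun u => lam * (profile (clip01 u) - 2)).
Proof.
split.
- move=> u; apply: cvgM; first exact: cvg_cst.
  apply: cvgB; last exact: cvg_cst.
  apply: (@continuous_comp _ _ _ (clip01) profile); first exact: continuous_clip.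
  exact: continuous_profile.
- by rewrite clip_id ?lexx ?ler01// profile_0 subrr mulr0.
- by move=> u; rewrite (@clip_id _ 0 1 (clip01 u))//; exact: clip_in.
Qed.

Definition target : cpath R := Path is_path_target.

Lemma target_1 : target 1 = lam.
Proof. by rewrite /= clip_id ?lexx ?ler01// profile_1; ring. Qed.

Section InTube.
Variable f : cpath R.
Hypothesis hf : tube_set lam target (lam / 100) f.

Let f1 : f 1 = lam. Proof. by case: hf. Qed.

Let fb u c1 c2 : 0 <= u <= 1 -> c1 <= profile u <= c2 ->
  lam * c1 - 2 * lam - lam / 100 <= f u <= lam * c2 - 2 * lam + lam / 100.
Proof.
move=> u01 /andP[h1 h2]; have := tube_setP u hf; rewrite /= clip_id// ler_norml.
have l0 := lam0; have : lam * c1 <= lam * profile u by rewrite ler_pM2l.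
have : lam * profile u <= lam * c2 by rewrite ler_pM2l.
by move=> ? ? /andP[? ?]; apply/andP; split; lra.
Qed.

Let tau_near : 5 / 16 - 300^-1 <= tau f <= 5 / 16 + 1000^-1.
Proof.
apply: profile_valley; have l0 := lam0; have t01 := tau_in f.
have /andP[_ h] := @fb (5 / 16) 0 0 ltac:(apply/andP; split; lra) ltac:(by rewrite profile_5_16 lexx).
have /andP[h' _] := @fb (tau f) (profile (tau f)) (profile (tau f)) t01 ltac:(by rewrite lexx).
have := tau_min f (5 / 16) => hm.
rewrite -(ler_pM2l lam0); lra.
Qed.

Let ft : - (2 * lam) - lam / 100 <= f (tau f) <= - (2 * lam) + lam / 100.
Proof.
have l0 := lam0; have t01 := tau_in f; have /andP[t1 t2] := tau_near.
have /andP[_ h] := @fb (5 / 16) 0 0 ltac:(apply/andP; split; lra) ltac:(by rewrite profile_5_16 lexx).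
have := tau_min f (5 / 16) => hm.
have p0 : 0 <= profile (tau f) <= profile (tau f).
  by rewrite lexx andbT /profile /peak; elim_max; lra.
have /andP[h' _] := fb t01 p0.
by apply/andP; split; lra.
Qed.

(** The block runs from about 1/2 to about 3/4. Both ends are on the flat part at height 3, and the
    centre is within 1/200 of the peak, where the profile is still at least 53/10; this leaves room
    for the errors of the tube. *)
Lemma tube_evt_hi a : 3 / 16 <= a <= 3 / 16 + 1000^-1 -> evt_hi lam a f.
Proof.
move=> /andP[a1 a2]; have l0 := lam0; have /andP[t1 t2] := tau_near.
have /andP[f1' f2'] := ft.
apply/evt_hiP; [lra|apply/andP; split; lra|].
have /andP[h1 h1'] := @fb (tau f + a) 3 3 ltac:(apply/andP; split; lra)
  ltac:(by rewrite profile_flat ?lexx//; left; apply/andP; split; lra).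
have /andP[h2 h2'] := @fb (tau f + a + 4^-1) 3 3 ltac:(apply/andP; split; lra)
  ltac:(by rewrite profile_flat ?lexx//; right; apply/andP; split; lra).
split.
- move=> x /andP[x1 x2].
  have /andP[h3 h3'] := @fb x 3 (11 / 2) ltac:(apply/andP; split; lra)
    ltac:(apply: profile_bounds; apply/andP; split; lra).
  lra.
- move=> x /andP[x1 x2].
  have /andP[h3 h3'] := @fb x 3 (11 / 2) ltac:(apply/andP; split; lra)
    ltac:(apply: profile_bounds; apply/andP; split; lra).
  lra.
- have p : 53 / 10 <= profile (tau f + a + 8^-1) <= profile (tau f + a + 8^-1).
    by rewrite lexx andbT; apply: profile_peak; left; apply/andP; split; lra.
  have /andP[h3 _] := @fb (tau f + a + 8^-1) _ _ ltac:(apply/andP; split; lra) p.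
  lra.
Qed.

Lemma tube_late : late_rot_set f /\ 4^-1 <= tau f.
Proof.
have l0 := lam0; have /andP[t1 t2] := tau_near; have /andP[f1' f2'] := ft.
split; last lra.
apply/tau_rotP; rewrite f1//; split; first lra.
move=> u /andP[u1 u2].
have /andP[h3 h3'] := @fb u 3 (11 / 2) ltac:(apply/andP; split; lra)
  ltac:(apply: profile_bounds; apply/andP; split; lra).
lra.
Qed.

(** Reflecting [7/8, 1] turns the second peak into a dip of height at most about 3 + 3 - 53/10,
    which is less than 1, at the place where [V] at 5/8 is read. [V] at 1/2 is read near 13/16,
    outside the block. *)
Lemma tube_low : [/\ at_end lam (flip (7 / 8) 1 f), low_set lam (flip (7 / 8) 1 f)
  & V (flip (7 / 8) 1 f) 2^-1 = V f 2^-1].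
Proof.
have l0 := lam0; have e1 := f1; have /andP[t1 t2] := tau_near; have /andP[f1' f2'] := ft.
have a0 : 0 <= 7 / 8 :> R by lra.
have ab : 7 / 8 <= 1 :> R by lra.
have /andP[h1 h1'] := @fb (7 / 8) 3 3 ltac:(apply/andP; split; lra)
  ltac:(by rewrite profile_flat ?lexx//; right; apply/andP; split; lra).
have tg : tau (flip (7 / 8) 1 f) = tau f.
  apply: tau_flip => //; first lra.
  move=> x /andP[x1 x2].
  have /andP[h3 h3'] := @fb x 3 (11 / 2) ltac:(apply/andP; split; lra)
    ltac:(apply: profile_bounds; apply/andP; split; lra).
  lra.
have gt : flip (7 / 8) 1 f (tau f) = f (tau f).
  by rewrite flip_out//; apply/orP; left; lra.
split.
- by rewrite /at_end /= flip_out// lexx orbT.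
- rewrite /low_set /= V_lo tg; last lra.
  rewrite gt flip_in//; last by apply/andP; split; lra.
  have p : 53 / 10 <= profile (7 / 8 + 1 - (tau f + 5 / 8)) <= profile (7 / 8 + 1 - (tau f + 5 / 8)).
    by rewrite lexx andbT; apply: profile_peak; right; apply/andP; split; lra.
  have /andP[h3 _] := @fb (7 / 8 + 1 - (tau f + 5 / 8)) _ _ ltac:(apply/andP; split; lra) p.
  lra.
- rewrite !V_lo ?tg; try lra.
  by rewrite gt flip_out//; apply/orP; left; lra.
Qed.

End InTube.
End Target.

(** * Markov property *)

Section DoobDynkin.
Variables (R : realType) (T : Type).

(** Each set [g < q] with [q] rational is the preimage of a Borel set under [Y], and [w y] is the
    infimum of the [q] whose set contains [y]. Off the range of [Y] this may be infinite, hence the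
    extended values. *)
Lemma doob_dynkin (Y g : T -> R) :
  (forall B : set R, measurable B -> sigma_rv Y (g @^-1` B)) ->
  exists2 w : R -> \bar R, measurable_fun setT w & forall x, w (Y x) = (g x)%:E.
Proof.
move=> hg; pose q n : R := ratr (odflt 0 (@unpickle rat n)).
have /choice[B hB] n : exists B : set R, measurable B /\ forall x, B (Y x) <-> g x < q n.
  have [B mB eB] := hg `]-oo, q n[%classic (measurable_itv _).
  exists B; split => // x.
  have := congr1 (fun A : set T => A x) eB; rewrite setTI /= in_itv /= => ->.
  by split.
pose u n y : \bar R := if y \in B n then (q n)%:E else +oo%E.
exists (fun y => einfs (u ^~ y) 0).
  apply: measurable_fun_einfs => n; apply: measurable_fun_ifT => //.
  apply: (measurable_fun_bool true); rewrite setTI.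
  rewrite (_ : _ @^-1` _ = B n); first exact: (hB n).1.
  by apply/seteqP; split => y /=; [move=> /set_mem|move=> /mem_set].
move=> x; apply/eqP; rewrite eq_le; apply/andP; split.
  rewrite leNgt; apply/negP => h.
  have [r] : exists r : R, g x < r /\ (r%:E <= einfs (u ^~ (Y x)) 0%N)%E.
    case: (einfs (u ^~ (Y x)) 0%N) h => [r| |] //; rewrite ?lte_fin => h.
      by exists r; rewrite lexx.
    by exists (g x + 1); rewrite ltrDl ltr01 leey.
  move=> [gr rw].
  have [p] := @rat_in_itvoo R (g x) r gr; rewrite in_itv /= => /andP[p1 p2].
  have qp : q (pickle p) = ratr p by rewrite /q pickleK.
  suff : (einfs (u ^~ (Y x)) 0%N <= (ratr p)%:E)%E.
    by move=> /(le_trans rw); rewrite lee_fin leNgt p2.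
  apply: ereal_inf_lbound; exists (pickle p) => //; rewrite /u ifT ?qp//.
  by rewrite inE; apply/(hB _).2; rewrite qp.
apply: le_ereal_inf_tmp => _ [n _ <-]; rewrite /u; case: ifPn => [|_]; last exact: leey.
by rewrite inE => /(hB _).2 /ltW; rewrite lee_fin.
Qed.

End DoobDynkin.

Section PathOfProcess.
Context d (T : measurableType d) (R : realType).
Variables (P : probability T R) (lam : R) (X : R -> T -> R).
Hypothesis hX : brownian_bridge P lam X.

Lemma is_path_process w : is_path (fun u => X (clip01 u) w).
Proof.
have [X0 Xc _] := hX; split.
- move=> u; have /subspace_continuousP /(_ (clip01 u)) := Xc w.
  rewrite /= in_itv /= clip_in// => /(_ isT) h.
  apply: cvg_trans h; move=> A /= hA.
  have /(_ _ hA) := @continuous_clip R 0 1 u.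
  move=> h2; change (nbhs u (fun v => A (X (clip01 v) w))); move: h2.
  by apply: (@filterS _ (nbhs u) _) => v /=; apply; rewrite in_itv /=; exact: clip_in.
- by rewrite clip_id ?lexx ?ler01.
- by move=> u; rewrite (@clip_id _ 0 1 (clip01 u))//; exact: clip_in.
Qed.

Definition process_path w : cpath R := Path (is_path_process w).

Lemma process_pathE w u : 0 <= u <= 1 -> process_path w u = X u w.
Proof. by move=> u01; rewrite /= clip_id. Qed.

Lemma measurable_process_path : measurable_fun setT process_path.
Proof.
have [_ _ [mX _]] := hX; apply: measurable_path => u; apply: mX.
by rewrite /= in_itv /=; exact: clip_in.
Qed.

Definition path_law : probability (cpath R) R :=
  distribution P (mfun_Sub (mem_set measurable_process_path)).

Lemma path_lawE A : path_law A = P (process_path @^-1` A).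
Proof. by []. Qed.

Lemma path_law_marginals : bridge_marginals lam path_law (fun u (f : cpath R) => f u).
Proof.
split=> [u|l A mA]; first exact: path_coord.
have [_ _ [_ gX]] := hX; rewrite path_lawE.
pose a (i : 'I_(size l)) := (nth (0, 0) l i).1.
pose u (i : 'I_(size l)) := clip01 (nth (0, 0) l i).2.
have u01 i : `[0, 1]%classic (u i) by rewrite /= in_itv /=; exact: clip_in.
have sumE (F : R * R -> R) : \sum_(p <- l) F p = \sum_(i < size l) F (nth (0, 0) l i).
  by rewrite (big_nth (0, 0)) big_mkord.
have := gX _ a u u01 A mA; rewrite /pushforward.
rewrite (_ : (fun w => _) @^-1` A = process_path @^-1` (lin_comb (fun v (f : cpath R) => f v) l @^-1` A)).
  move=> ->; congr (normal_law _ _ A).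
    by rewrite /weight sumE mulr_sumr; apply: eq_bigr => i _; rewrite mulrCA.
  rewrite /bridge_var /weight expr2 /pairing !sumE mulr_suml -sumrB.
  apply: eq_bigr => i _; rewrite sumE mulr_sumr -sumrB; apply: eq_bigr => j _.
  by rewrite /a /u /min01; ring.
by apply/funext => w; rewrite /= /lin_comb sumE.
Qed.

Lemma vervaat_process w t : 0 <= t <= 1 ->
  vervaat (fun u => X u w) t = V (process_path w) t.
Proof.
move=> /andP[t0 t1].
have eT : first_argmin (fun u => X u w) = tau (process_path w).
  rewrite /tau /first_argmin; congr inf; apply/seteqP; split => s /= [s01 h];
  by split => // r r01; have := h r r01; rewrite /= !clip_id.
have /andP[a0 a1] := tau_in (process_path w).
rewrite VE /vervaat eT; case: ifPn => [ht|].
  by rewrite !process_pathE//; apply/andP; split; lra.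
rewrite -ltNge => ht.
by rewrite !process_pathE//; apply/andP; split; lra.
Qed.

End PathOfProcess.

Section MarkovKernel.
Context d (T : measurableType d) (R : realType) (P : probability T R).
Variables (I : set R) (Y : R -> T -> R).
Hypothesis mY : forall u, I u -> measurable_fun setT (Y u).

Lemma natural_filtration_measurable s A : natural_filtration I Y s A -> measurable A.
Proof.
apply: smallest_sub; first exact: sigma_algebra_measurable.
move=> B [u [Iu _]] [C mC <-]; exact: (mY Iu).
Qed.

(** The version given [Y s] is a function of [Y s] by [doob_dynkin]. It has the right integrals over
    all of the past, because it agrees almost surely with the version given the filtration. *)
Lemma markov_kernel s t (B : set R) : markov_process P I Y ->
  I s -> I t -> s <= t -> measurable B ->
  exists w : R -> \bar R, [/\ measurable_fun setT w, forall x, (0 <= w x)%E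
    & forall A, natural_filtration I Y s A ->
      P (A `&` Y t @^-1` B) = (\int[P]_(x in A) w (Y s x))%E].
Proof.
move=> hM Is It st mB; have [f [g [[_ if_ ef] [mg ig eg] fg]]] := hM s t B Is It st mB.
have [w0 mw0 w0E] := doob_dynkin mg.
have mYB : measurable (Y t @^-1` B) by have := mY It measurableT mB; rewrite setTI.
have indE A : measurable A ->
    (\int[P]_(x in A) (\1_(Y t @^-1` B) x)%:E = P (A `&` Y t @^-1` B))%E.
  by move=> mA; rewrite integral_indic// setIC.
have mgf : measurable_fun setT (EFin \o g) by case/integrableP: ig.
(* A version of a conditional probability may be negative somewhere; but [N] is generated by [Y s],
   so the integral of [g] over it is a probability, and [N] is null. Taking the maximum with 0 then
   changes no integral. *)
pose N := [set x | g x < 0].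
have sN : sigma_rv (Y s) N.
  rewrite (_ : N = g @^-1` `]-oo, 0[); first by apply: mg; exact: measurable_itv.
  by apply/seteqP; split => x /=; rewrite in_itv.
have mN : measurable N.
  by have [C mC <-] := sN; exact: (mY Is).
have PN : P N = 0%E.
  have : (\int[P]_(x in N) `|(- g x)%:E| = 0)%E.
    apply/eqP; rewrite eq_le integral_ge0// andbT.
    rewrite -oppe_ge0 -integral_ge0N//.
    rewrite (eq_integral (fun x => (g x)%:E)); last first.
      move=> x /set_mem Nx; rewrite gee0_abs -?EFinN ?opprK//.
      by rewrite lee_fin oppr_ge0 ltW.
    by rewrite eg// indE// measure_ge0.
  move/ae_eq_integral_abs => /(_ mN); case.
    apply: measurable_funTS; apply/measurable_EFinP; apply: measurableT_comp => //.
    exact/measurable_EFinP.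
  move=> M [mM M0 NM]; apply: (@subset_measure0 _ _ _ P N M) => // x Nx; apply: NM.
  by move=> /(_ Nx) /eqP; rewrite eqe oppr_eq0 lt_eqF.
exists (fun y => maxe (w0 y) 0); split.
- by apply: measurable_maxe.
- by move=> x; rewrite le_max lexx orbT.
move=> A FA; have mA := natural_filtration_measurable FA.
have mfs : measurable_fun setT (EFin \o f) by case/integrableP: if_.
rewrite -indE// -ef//; apply: ae_eq_integral => //.
- exact: measurable_funTS.
- apply: measurable_funTS; apply: measurable_maxe => //.
  by apply: (measurableT_comp mw0); exact: mY.
case: fg => M [mM M0 fgM]; exists (M `|` N); split.
- exact: measurableU.
- by apply: measure_negligible; [exact: measurableU|apply: negligibleU; exact/negligibleP].
move=> x /= h; have [gx|gx] := ltP (g x) 0; first by right.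
left; apply: fgM => fgx; apply: h => _.
by rewrite w0E max_l ?lee_fin// /= fgx.
Qed.

End MarkovKernel.

Section BridgeKernel.
Context d (T : measurableType d) (R : realType) (P : probability T R).
Variables (lam : R) (X : R -> T -> R).
Hypothesis hX : brownian_bridge P lam X.

Let Y t x := vervaat (fun u => X u x) t.
Let pp := process_path hX.
Let mu := path_law hX.
Let I : set R := `[0, 1]%classic.
Let F := natural_filtration I Y 2^-1.

Let YE u x : 0 <= u <= 1 -> Y u x = V (pp x) u.
Proof. exact: vervaat_process. Qed.

Let mY u : I u -> measurable_fun setT (Y u).
Proof.
rewrite /I /= in_itv /= => u01; rewrite (_ : Y u = fun x => V (pp x) u); last first.
  by apply/funext => x; exact: YE.
by apply: measurable_V => //; exact: measurable_process_path.
Qed.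

Let G := \bigcup_(u in [set u | I u /\ u <= 2^-1]) sigma_rv (Y u).

Let mVF u : 0 <= u <= 2^-1 ->
  @measurable_fun _ _ (g_sigma_algebraType G) R setT (fun x => V (pp x) u).
Proof.
move=> /andP[u0 u2] _ B mB; apply: sub_sigma_algebra.
exists u; first by rewrite /I /= in_itv /=; split => //; apply/andP; split; lra.
exists B => //; congr (_ `&` _); apply/funext => x /=.
by rewrite YE//; apply/andP; split; lra.
Qed.

Lemma filtration_hi a : window a -> F (pp @^-1` [set f | evt_hi lam a f]).
Proof.
move=> /andP[a8 a4].
have := @measurable_evt_hi R lam _ (g_sigma_algebraType G) pp (fun=> a).
apply => c /andP[c0 c4]; apply: mVF; apply/andP; split; lra.
Qed.

Lemma filtration_lo a : window a -> F (pp @^-1` [set f | evt_lo lam a f]).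
Proof.
move=> /andP[a8 a4].
have := @measurable_evt_lo R lam _ (g_sigma_algebraType G) pp (fun=> a).
apply => c /andP[c0 c4]; apply: mVF; apply/andP; split; lra.
Qed.

Lemma filtration_mid (B : set R) : measurable B -> F (pp @^-1` [set f | B (V f 2^-1)]).
Proof.
move=> mB; have := mVF (u := 2^-1); rewrite lexx invr_ge0 ler0n => /(_ isT).
by move=> /(_ measurableT _ mB); rewrite setTI.
Qed.

(** [at_end] is an event at time 1 and not part of the past of 1/2; having full measure, it can be
    inserted on both sides after the kernel identity is applied to [S]. *)
Lemma bridge_kernel : markov_process P I Y -> mu (at_end lam) = 1%E ->
  exists w : R -> \bar R, [/\ measurable_fun setT w, forall x, (0 <= w x)%E
  & forall S : set (cpath R), measurable S -> F (pp @^-1` S) ->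
    mu (S `&` at_end lam `&` low_set lam) =
    (\int[mu]_(f in S `&` at_end lam) w (V f 2^-1))%E].
Proof.
move=> hM mu1.
have [|||//|w [mw w0 hw]] := markov_kernel mY (s := 2^-1) (t := 5 / 8) (B := `]-oo, lam[) hM.
- by rewrite /I /= in_itv /=; apply/andP; split; lra.
- by rewrite /I /= in_itv /=; apply/andP; split; lra.
- lra.
exists w; split => // S mS FS; have mE := measurable_at_end lam.
have mEc : mu (~` at_end lam) = 0%E.
  by rewrite probability_setC// mu1 subee.
have mwV : measurable_fun setT (fun f : cpath R => w (V f 2^-1)).
  by apply: (measurableT_comp mw); exact: measurable_V.
have drop (A : set (cpath R)) : measurable A -> mu (A `&` at_end lam) = mu A.
  move=> mA; have mAE : measurable (A `&` at_end lam) by exact: measurableI.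
  apply/eqP; rewrite eq_le; apply/andP; split.
    by apply: le_measure; rewrite ?inE// => f [].
  apply: (@le_trans _ _ (mu (A `&` at_end lam `|` ~` at_end lam))).
    apply: le_measure; rewrite ?inE//; first by apply: measurableU => //; exact: measurableC.
    by move=> f Af; have [?|?] := pselect (at_end lam f); [left|right].
  apply: le_trans (measureU2 mu mAE (measurableC mE)) _.
  by rewrite [X in (_ + X <= _)%E](_ : _ = 0%E) ?adde0//; exact: mEc.
have mL := measurable_low_set lam.
rewrite setIAC drop; last exact: measurableI.
rewrite (_ : S `&` at_end lam = S `\` ~` at_end lam); last by rewrite setDE setCK.
rewrite -ge0_negligible_integral//; last 2 first.
- exact: measurableC.
- exact: measurable_funTS.
transitivity (P (pp @^-1` S `&` Y (5 / 8) @^-1` `]-oo, lam[)).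
  rewrite /mu path_lawE; congr (P _); apply/seteqP; split => x /=;
    by rewrite in_itv /= /low_set /= YE//; apply/andP; split; lra.
rewrite hw// -[RHS]/(\int[pushforward P pp]_(f in S) w (V f 2^-1))%E.
rewrite ge0_integral_pushforward//; last 2 first.
- exact: measurable_process_path.
- exact: measurable_funTS.
apply: eq_integral => x _; rewrite /= YE//; apply/andP; split; lra.
Qed.

End BridgeKernel.

Theorem corollary3p3 (R : realType) (d : measure_display) (T : measurableType d)
    (P : probability T R) (lam : R) (X : R -> T -> R) :
  0 < lam ->
  brownian_bridge P lam X ->
  ~ markov_process P `[0, 1] (fun t w => vervaat (fun u => X u w) t).
Proof.
move=> lam0 hX hM; pose mu := path_law hX.
have hmu : bridge_marginals lam mu (fun u (f : cpath R) => f u) by exact: path_law_marginals.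
have [w [mw w0 hw]] := bridge_kernel hM (at_end_1 hmu).
have mhi a : measurable [set f | evt_hi lam a f].
  by apply: (@measurable_evt_hi _ _ _ _ id (fun=> a)) => c _; exact: measurable_V.
have mlo a : measurable [set f | evt_lo lam a f].
  by apply: (@measurable_evt_lo _ _ _ _ id (fun=> a)) => c _; exact: measurable_V.
have mmid (B : set R) : measurable B -> measurable [set f : cpath R | B (V f 2^-1)].
  move=> mB; have mV : measurable_fun setT (fun f : cpath R => V f 2^-1) by exact: measurable_V.
  by have := mV measurableT _ mB; rewrite setTI.
have e0 : 0 < lam / 100 by rewrite divr_gt0.
have tube_end : tube_set lam (target lam) (lam / 100) `<=` at_end lam by move=> f [].
apply: (@no_kernel R lam mu hmu lam0 w mw w0 _ _ _ _ (3 / 16) (3 / 16 + 1000^-1)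
  (measurable_tube_set lam (target lam) (lam / 100))
  (tube_pos hmu (target_1 lam) e0) tube_end).
- move=> a wa; rewrite -(hw _ (mhi a) (filtration_hi hX wa)); congr (mu _).
  by apply/seteqP; split => f /=; [case|case=> -[]].
- move=> a wa; rewrite -(hw _ (mlo a) (filtration_lo hX wa)); congr (mu _).
  by apply/seteqP; split => f /=; [case|case=> -[]].
- move=> B mB; have -> : [set f : cpath R | at_end lam f /\ B (V f 2^-1)] =
    [set f : cpath R | B (V f 2^-1)] `&` at_end lam by rewrite setIC.
  rewrite -(hw _ (mmid B mB) (filtration_mid hX mB)); congr (mu _).
  by apply/seteqP; split => f /=; [case|case=> -[]].
- lra.
- by move=> a /andP[a1 a2]; rewrite /window /=; apply/andP; split; lra.
- by move=> f a hf ha; exact: (tube_evt_hi lam0 hf ha).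
- by move=> f hf; exact: (tube_late lam0 hf).
- by move=> f hf; exact: (tube_low lam0 hf).
Qed.
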